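(* Let $p>1$, let $H$ satisfy the assumptions $(h_H)$ stated in the context, let $g:\mathbb R\to\mathbb R$ be of class $C^1$, and let $G(t)=\int_0^tg(s)\,ds$. Let $\Omega\subset\mathbb R^N$ be a bounded smooth domain that is strictly star-shaped with respect to the origin. Then any weak solution $u\in C^1(\overline\Omega)$ of $$\begin{cases}-\Delta^H_pu=g(u)&\text{in }\Omega,\\ u=0&\text{on }\partial\Omega,\end{cases}$$ such that $\nabla u\not\equiv0$ on $\partial\Omega$, satisfies $$N\int_\Omega G(u)\,dx-\frac{N-p}{p}\int_\Omega g(u)u\,dx>0 .$$ In particular, in the special case $g(u)=|u|^{m-1}u$ with $m>0$ and $1<p<N$, the inequality $N\int_\Omega G(u)\,dx-\frac{N-p}{p}\int_\Omega g(u)u\,dx>0$ still holds (for any such solution $u$ with $\nabla u\not\equiv 0$ on $\partial\Omega$), and it gives $$\left(\frac{N}{m+1}-\frac{N-p}{p}\right)\int_\Omega|u|^{m+1}\,dx>0 .$$ Therefore $u\not\equiv0$ in $\Omega$ implies $$m<\frac{N(p-1)+p}{N-p}=p^*-1,\qquad p^*=\frac{Np}{N-p}.$$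
   Context: **Assumptions $(h_H)$ on $H:\mathbb R^N\to\mathbb R$.** (i) $H\in C^{3,\beta}_{loc}(\mathbb R^N\setminus\{0\})$ with $\beta\in(0,1)$, and $H(\xi)>0$ for all $\xi\in\mathbb R^N\setminus\{0\}$; (ii) $H(s\xi)=|s|H(\xi)$ for all $\xi\in\mathbb R^N\setminus\{0\}$ and $s\in\mathbb R$ (so $H(0)=0$); (iii) $H$ is uniformly elliptic, i.e. the set $\mathcal B_1^H=\{\xi\in\mathbb R^N: H(\xi)<1\}$ is uniformly convex, meaning that there exists $\Lambda>0$ such that $\langle D^2H(\xi)v,v\rangle\ge\Lambda|v|^2$ for all $\xi\in\partial\mathcal B_1^H$ and all $v\in\nabla H(\xi)^\bot$. **Operator and weak solutions.** The anisotropic $p$-Laplacian is $-\Delta_p^Hu:=-\operatorname{div}\big(H^{p-1}(\nabla u)\nabla H(\nabla u)\big)$. A function $u\in C^1(\Omega)$ is a weak solution of $-\Delta_p^Hu=g(u)$ in $\Omega$ if $$\int_\Omega H^{p-1}(\nabla u)\langle\nabla H(\nabla u),\nabla\varphi\rangle\,dx=\int_\Omega g(u)\varphi\,dx\qquad\forall\varphi\in C_c^\infty(\Omega).$$ Here $\nabla H(\nabla u)$ denotes the gradient of $H$ evaluated at $\nabla u$, and $H^{p-1}(\nabla u)\nabla H(\nabla u)$ is understood to be $0$ where $\nabla u=0$. **Strictly star-shaped.** $\Omega$ is star-shaped with respect to the origin if for every $x\in\Omega$ the segment $\overline{0x}$ is contained in $\Omega$; it is strictly star-shaped with respect to the origin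 if in addition $x\cdot\eta>0$ on the whole boundary $\partial\Omega$, where $\eta$ is the unit outward normal. *)

(* Defs.v *)
From HB Require Import structures.
From mathcomp Require Import all_boot all_order all_algebra.
From mathcomp Require Import all_classical all_reals all_analysis.

Set Implicit Arguments.
Unset Strict Implicit.
Unset Printing Implicit Defensive.

Import Order.TTheory GRing.Theory Num.Theory.
Import numFieldNormedType.Exports.

Local Open Scope classical_set_scope.
Local Open Scope ring_scope.

Section euclidean.
Context {R : realType} {N : nat}.
Implicit Types x y : 'rV[R]_N.

Definition dot x y : R := \sum_i x 0 i * y 0 i.

(* The norm `|x| on row vectors is the sup norm, hence a separate definition. *)
Definition enorm x : R := Num.sqrt (dot x x).

End euclidean.

Section lebesgue_measure_Rn.
Context {R : realType}.

Local Notation RB := (measurableTypeR R).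

Definition cons_pair n (z : RB * n.-tuple RB) : n.+1.-tuple RB :=
  [the n.+1.-tuple RB of z.1 :: z.2].

Lemma measurable_cons_pair n : measurable_fun [set: RB * n.-tuple RB] (@cons_pair n).
Proof. by apply: measurable_cons. Qed.

Section step.
Variables (n : nat) (mu : {measure set (n.-tuple RB) -> \bar R}).
Let prod_mu : {measure set (RB * n.-tuple RB) -> \bar R} :=
  [the measure _ _ of (@lebesgue_measure R \x^ mu)%E].

Definition lebesgue_step (A : set (n.+1.-tuple RB)) : \bar R :=
  pushforward prod_mu (@cons_pair n) A.

Lemma lebesgue_step0 : lebesgue_step set0 = 0%E.
Proof. by rewrite /lebesgue_step /pushforward preimage_set0 measure0. Qed.

Lemma lebesgue_step_ge0 A : (0 <= lebesgue_step A)%E.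
Proof. exact: (measure_ge0 prod_mu). Qed.

Lemma lebesgue_step_sigma_additive : semi_sigma_additive lebesgue_step.
Proof.
have mcons : forall A, measurable A -> measurable (@cons_pair n @^-1` A).
  by move=> A mA; rewrite -[X in measurable X]setTI; exact: measurable_cons_pair.
move=> F mF tF mUF; rewrite /lebesgue_step /pushforward preimage_bigcup.
apply: measure_semi_sigma_additive.
- by move=> i; exact: mcons.
- apply/trivIsetP => i j _ _ ij; rewrite -preimage_setI.
  by move/trivIsetP : tF => /(_ _ _ _ _ ij) ->//; rewrite preimage_set0.
- by rewrite -preimage_bigcup; exact: mcons.
Qed.

HB.instance Definition _ := isMeasure.Build _ _ _ lebesgue_step
  lebesgue_step0 lebesgue_step_ge0 lebesgue_step_sigma_additive.

End step.

(* Lebesgue measure on R^n, as the n-fold product of the one on R. *)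
Fixpoint lebesgue_tuple (n : nat) : {measure set (n.-tuple RB) -> \bar R} :=
  match n with
  | 0 => [the {measure set (0.-tuple RB) -> \bar R} of
           dirac ([tuple] : 0.-tuple RB)]
  | n'.+1 => [the {measure set (n'.+1.-tuple RB) -> \bar R} of
               lebesgue_step (lebesgue_tuple n')]
  end.

Lemma lebesgue_tuple_box n (A : 'I_n -> set R) :
  (forall i, measurable (A i)) ->
  lebesgue_tuple n [set t | forall i, A i (tnth t i)] =
  (\prod_(i < n) lebesgue_measure (A i))%E.
Proof.
elim: n A => [|n IH] A mA.
  rewrite big_ord0 /= diracE mem_set//=; by case.
rewrite big_ord_recl -(IH (fun i => A (lift ord0 i)))//.
rewrite -product_measure2E//=; first last.
  rewrite (_ : [set _ | _] = \bigcap_(i in [set: 'I_n])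
      ((fun t : n.-tuple RB => tnth t i) @^-1` A (lift ord0 i))); last first.
    apply/seteqP; split => t /= H i; first by move=> _; exact: H.
    exact: H.
  apply: fin_bigcap_measurable; first exact: finite_finset.
  move=> i _.
  by rewrite -[X in measurable X]setTI;
    apply: (@measurable_tnth _ RB n i measurableT); exact: mA.
  exact: mA.
rewrite /lebesgue_step /pushforward.
have mE (P Q : set (RB * n.-tuple RB)) : P = Q ->
    (lebesgue_measure \x^ lebesgue_tuple n)%E P =
    (lebesgue_measure \x^ lebesgue_tuple n)%E Q by move=> ->.
apply: mE; apply/seteqP; split => -[x t] /= H.
  split; first by have := H ord0; rewrite (tnth_nth 0).
  by move=> i; have := H (lift ord0 i); rewrite !(tnth_nth 0).
case: H => Hx Ht i.
case: (unliftP ord0 i) => [j ->|->]; last by rewrite (tnth_nth 0).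
by have := Ht j; rewrite !(tnth_nth 0).
Qed.

Definition rV_of_tuple n (t : n.-tuple RB) : 'rV[R]_n := \row_i tnth t i.

(* Integral over D with respect to Lebesgue measure, read through the
   bijection rV_of_tuple, row vectors having no measurable structure. *)
Definition integral_rV n (D : set 'rV[R]_n) (f : 'rV[R]_n -> R) : R :=
  Rintegral (lebesgue_tuple n) (@rV_of_tuple n @^-1` D) (f \o @rV_of_tuple n).

(* The integral of g from 0 to t, with the usual sign when t < 0. *)
Definition primitive0 (g : R -> R) (t : R) : R :=
  if 0 <= t then Rintegral lebesgue_measure `[0, t] g
  else - Rintegral lebesgue_measure `[t, 0] g.

End lebesgue_measure_Rn.

Section smoothness.
Context {R : realType} {N : nat}.
Implicit Types (U : set 'rV[R]_N) (f : 'rV[R]_N -> R).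

Definition partial (i : 'I_N) f : 'rV[R]_N -> R :=
  fun x => 'D_(delta_mx 0 i) f x.

Definition grad f x : 'rV[R]_N := \row_i partial i f x.

Definition hess f x : 'M[R]_N := \matrix_(i, j) partial j (partial i f) x.

(* The derivatives up to order k exist on U and those of order k satisfy P. *)
Fixpoint derivatives_upto (P : ('rV[R]_N -> R) -> Prop) (k : nat) U f : Prop :=
  match k with
  | 0 => P f
  | k'.+1 => (forall x, U x -> differentiable f x) /\
             (forall i, derivatives_upto P k' U (partial i f))
  end.

Definition continuous_on U f : Prop := forall x, U x -> {for x, continuous f}.

Definition Ck k U f : Prop := derivatives_upto (continuous_on U) k U f.

Definition Cinfty U f : Prop := forall k, Ck k U f.

Definition holder_loc (beta : R) U f : Prop :=
  forall K : set 'rV[R]_N, compact K -> K `<=` U ->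
  exists C : R, forall x y, K x -> K y ->
    `|f x - f y| <= C * enorm (x - y) `^ beta.

Definition Ckholder_loc k (beta : R) U f : Prop :=
  derivatives_upto (holder_loc beta U) k U f.

End smoothness.

Definition C1_real {R : realType} (g : R -> R) : Prop :=
  (forall t, derivable g t 1) /\ continuous (derive1 g).

Section domains.
Context {R : realType} {N : nat}.
Implicit Types (Omega : set 'rV[R]_N).

Definition bdry Omega : set 'rV[R]_N := closure Omega `\` interior Omega.

(* rho is a smooth function defining Omega near its boundary point x. *)
Definition defining_function Omega (x : 'rV[R]_N) (rho : 'rV[R]_N -> R) : Prop :=
  exists U : set 'rV[R]_N,
    [/\ open U, U x, Cinfty U rho, (forall y, U y -> grad rho y != 0)
      & Omega `&` U = [set y | U y /\ rho y < 0]].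

Definition smooth_boundary Omega : Prop :=
  forall x, bdry Omega x -> exists rho, defining_function Omega x rho.

Definition unit_outward_normal Omega (x eta : 'rV[R]_N) : Prop :=
  exists2 rho, defining_function Omega x rho &
    eta = (enorm (grad rho x))^-1 *: grad rho x.

Definition bounded_smooth_domain Omega : Prop :=
  [/\ Omega !=set0, open Omega, connected Omega, bounded_set Omega
    & smooth_boundary Omega].

Definition star_shaped Omega : Prop :=
  forall x, Omega x -> forall t : R, 0 <= t <= 1 -> Omega (t *: x).

Definition strictly_star_shaped Omega : Prop :=
  star_shaped Omega /\
  (forall x eta, bdry Omega x -> unit_outward_normal Omega x eta ->
     0 < dot x eta).

(* u is of class C^1 up to the boundary; Du is the continuous extension of
   its gradient to the closure of Omega. *)
Definition C1_closure Omega (u : 'rV[R]_N -> R)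
    (Du : 'rV[R]_N -> 'rV[R]_N) : Prop :=
  [/\ Ck 1 Omega u,
      {within closure Omega, continuous u},
      {within closure Omega, continuous Du}
    & forall x, Omega x -> Du x = grad u x].

Definition test_function Omega (phi : 'rV[R]_N -> R) : Prop :=
  [/\ Cinfty setT phi, compact (closure [set x | phi x != 0])
    & closure [set x | phi x != 0] `<=` Omega].

End domains.

Section anisotropic.
Context {R : realType} {N : nat}.
Implicit Types (H : 'rV[R]_N -> R) (Omega : set 'rV[R]_N).

Definition uniformly_elliptic H : Prop :=
  exists2 Lambda : R, 0 < Lambda &
    forall xi v : 'rV[R]_N,
      bdry [set z | H z < 1] xi -> dot v (grad H xi) = 0 ->
      Lambda * enorm v ^+ 2 <= dot (v *m (hess H xi)^T) v.

Definition hypH H : Prop :=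
  [/\ (exists2 beta : R, 0 < beta < 1 & Ckholder_loc 3 beta [set~ 0] H),
      (forall xi, xi != 0 -> 0 < H xi),
      (forall xi (s : R), xi != 0 -> H (s *: xi) = `|s| * H xi)
    & uniformly_elliptic H].

Definition flux (p : R) H (xi : 'rV[R]_N) : 'rV[R]_N :=
  if xi == 0 then 0 else H xi `^ (p - 1) *: grad H xi.

Definition weak_solution (p : R) H (g : R -> R) Omega (u : 'rV[R]_N -> R) : Prop :=
  Ck 1 Omega u /\
  forall phi, test_function Omega phi ->
    integral_rV Omega (fun x => dot (flux p H (grad u x)) (grad phi x)) =
    integral_rV Omega (fun x => g (u x) * phi x).

Definition dirichlet_solution (p : R) H (g : R -> R) Omega
    (u : 'rV[R]_N -> R) (Du : 'rV[R]_N -> 'rV[R]_N) : Prop :=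
  [/\ C1_closure Omega u Du, weak_solution p H g Omega u
    & forall x, bdry Omega x -> u x = 0].

End anisotropic.

(* |t|^(m-1) t; at t = 0 the value is 0 for every m, also when m < 1. *)
Definition power_nonlinearity {R : realType} (m t : R) : R :=
  `|t| `^ (m - 1) * t.

Definition pstar {R : realType} (N : nat) (p : R) : R :=
  N%:R * p / (N%:R - p).

(* Main.v *)
(* Let v be u extended by zero. As u vanishes on the boundary, v is Lipschitz with
   bounded support, and for c > 1 strict star-shapedness makes v(c x) an admissible
   test function. Young's inequality for the flux (convexity of H^p) gives
     int g(u) v(c x) <= (1 - 1/p) a + c^(p-N) a / p - V (1 - c^-N),
   where a = int H(grad u)^p = int g(u) u. The gain V is positive: near a boundary
   point where grad u does not vanish, v(c x) is zero on the shell between Omega / c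
   and Omega, while H(grad u)^p is bounded below there; over a cone with vertex 0
   this shell has the fraction 1 - c^-N of the volume. On the other hand
     int g(u) (v(c x) - u) = int (G(v(c x)) - G(u)) + o(c - 1)
   and int G(v(c x)) = c^-N int G(u). Dividing by c - 1 and letting c -> 1 yields
     N int G(u) - (N - p)/p a >= N V > 0.
   The argument needs no second derivatives of u. *)

(* The classical multiplier [x . grad u] is not an admissible test function for a [C^1] solution;
   difference quotients under dilations replace it. Only [c > 1] is available, since supports have
   to move inwards, so the quotients are one-sided and the outcome is an inequality. Strict
   star-shapedness makes a defining function decrease to first order along the ray from a boundary
   point to the origin. Hence the closure of [Omega] divided by [c > 1] lies in [Omega], which gives
   compact supports and also shows that the boundary is null. The weak formulation knows only smooth
   test functions, whereas [v(c x)] is Lipschitz and has no gradient on a null set. Spline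
   interpolants with uniformly bounded gradients, convergent wherever the gradient exists, bridge
   this by dominated convergence. The gain is what Young's inequality wastes where the test gradient
   vanishes: the left side is 0 and [(1 - 1/p) H(grad u)^p] remains on the right. The equality of
   the two forms of [a] is itself a limit [c -> 1], as [u] need not have compact support in
   [Omega]. *)
From HB Require Import structures.
Require Import Defs.
From mathcomp Require Import all_boot all_order all_algebra.
From mathcomp Require Import all_classical all_reals all_analysis.
From mathcomp Require Import measurable_realfun.
From mathcomp Require Import ring lra.
Import Order.TTheory GRing.Theory Num.Theory.
Import numFieldNormedType.Exports.
Local Open Scope classical_set_scope.
Local Open Scope ring_scope.
Set Implicit Arguments.
Unset Strict Implicit.

(** * Smooth functions on the line *)

Section smooth_real.
Context {R : realType}.
Implicit Types (f g : R -> R) (x y z : R).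

Lemma is_derive_add f g x a b : is_derive x 1 f a -> is_derive x 1 g b ->
  is_derive x 1 (fun y => f y + g y) (a + b).
Proof. by move=> ? ?; exact: is_deriveD. Qed.

Lemma is_derive_mul f g x a b : is_derive x 1 f a -> is_derive x 1 g b ->
  is_derive x 1 (fun y => f y * g y) (a * g x + f x * b).
Proof.
move=> fa gb; have H := is_deriveM fa gb.
by apply: (is_derive_eq H); rewrite addrC mulrC.
Qed.

Lemma is_derive_const (c : R) x : is_derive x 1 (fun _ : R => c) 0.
Proof. exact: is_derive_cst. Qed.

Lemma is_derive_affine (a b x : R) : is_derive x 1 (fun y => a * y + b) a.
Proof.
have H := is_derive_add (is_derive_mul (is_derive_const a x) (is_derive_id x 1))
  (is_derive_const b x).
by apply: (is_derive_eq H); rewrite mul0r add0r mulr1 addr0.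
Qed.

Lemma is_derive_comp_affine f a b x d : is_derive (a * x + b) 1 f d ->
  is_derive x 1 (fun y => f (a * y + b)) (a * d).
Proof. move=> H; rewrite mulrC.
exact: (is_derive1_comp (f := f) (g := fun y => a * y + b) H (is_derive_affine a b x)). Qed.

Lemma is_derive_inv f x d : f x != 0 -> is_derive x 1 f d ->
  is_derive x 1 (fun y => (f y)^-1) (- d * ((f x)^-1 * (f x)^-1)).
Proof.
move=> fx0 [fd <-]; apply: DeriveDef; first exact: derivableV.
rewrite deriveV//; rewrite /GRing.scale/= mulNr mulrC mulNr.
by congr (- (_ * _)); rewrite -invfM -expr2.
Qed.

(** Derivatives enter as witnesses rather than through [derive1], so closure under sums, products
    and inverses is a plain induction on the order. *)
Fixpoint dern_upto (k : nat) f : Prop :=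
  if k is k'.+1 then exists2 f', (forall x, is_derive x 1 f (f' x)) & dern_upto k' f'
  else True.

Definition smooth1 f := forall k, dern_upto k f.

Lemma dern_uptoW k f : dern_upto k.+1 f -> dern_upto k f.
Proof.
elim: k f => // k IH f [f' ff' H]; exists f' => //; exact: IH.
Qed.

Lemma dern_uptoD k f g : dern_upto k f -> dern_upto k g ->
  dern_upto k (fun x => f x + g x).
Proof.
elim: k f g => // k IH f g [f' ff' Hf] [g' gg' Hg].
exists (fun x => f' x + g' x); last exact: IH.
by move=> x; apply: is_derive_add.
Qed.

Lemma dern_uptoM k f g : dern_upto k f -> dern_upto k g ->
  dern_upto k (fun x => f x * g x).
Proof.
elim: k f g => // k IH f g Hf Hg.
have Hf0 := dern_uptoW Hf; have Hg0 := dern_uptoW Hg.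
move: Hf Hg => [f' ff' Hf] [g' gg' Hg].
exists (fun x => f' x * g x + f x * g' x); first by move=> x; apply: is_derive_mul.
by apply: dern_uptoD; apply: IH.
Qed.

Lemma dern_upto_cst k (c : R) : dern_upto k (fun=> c).
Proof.
elim: k c => // k IH c; exists (fun=> 0) => // x; exact: is_derive_const.
Qed.

Lemma dern_upto_affine k (a b : R) : dern_upto k (fun x => a * x + b).
Proof.
case: k => // k; exists (fun=> a); last exact: dern_upto_cst.
by move=> x; exact: is_derive_affine.
Qed.

Lemma dern_upto_comp_affine k f (a b : R) : dern_upto k f ->
  dern_upto k (fun x => f (a * x + b)).
Proof.
elim: k f => // k IH f [f' ff' Hf]; exists (fun x => a * f' (a * x + b)).
  by move=> x; exact: is_derive_comp_affine.
by apply: dern_uptoM; [exact: dern_upto_cst|exact: IH].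
Qed.

Lemma dern_uptoV k f : (forall x, f x != 0) -> dern_upto k f ->
  dern_upto k (fun x => (f x)^-1).
Proof.
move=> f0; elim: k => // k IH Hf; have Hf0 := dern_uptoW Hf.
move: Hf => [f' ff' Hf].
exists (fun x => - f' x * ((f x)^-1 * (f x)^-1)).
  by move=> x; exact: is_derive_inv.
apply: dern_uptoM; last by apply: dern_uptoM; exact: IH.
rewrite (_ : (fun x => - f' x) = (fun x => (fun=> -1) x * f' x)).
  by apply: dern_uptoM => //; exact: dern_upto_cst.
by apply/funext => x /=; rewrite mulN1r.
Qed.

(** The difference quotient at [x] is at most [C * |h|]. This settles the derivative of [flat n] at
    the origin, where its two formulas meet. *)
Lemma is_derive_flat f x (C : R) : (forall y, `|f y - f x| <= C * (y - x) ^+ 2) ->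
  is_derive x 1 f 0.
Proof.
move=> fC.
have lim0 : (fun h : R => h^-1 * (f (h + x) - f x)) @ 0^' --> (0 : R).
  have C0 : 0 <= C.
    have := fC (x + 1); rewrite [x + 1]addrC addrK expr1n mulr1.
    exact: le_trans.
  have abs0 : (fun h : R => C * `|h|) @ 0^' --> (0 : R).
    rewrite -[X in _ --> X](mulr0 C); apply: cvgMr.
    have := @norm_continuous R R 0; rewrite /continuous_at normr0; exact: cvg_within_filter.
  apply: (squeeze_cvgr (f := fun h : R => - (C * `|h|)) _ _ abs0); last first.
    by rewrite -[X in _ --> X]oppr0; apply: cvgN.
  near=> h; rewrite -ler_norml normrM normfV.
  have h0 : `|h| > 0.
    by rewrite normr_gt0; near: h; apply/nbhs_dnbhs_neq.
  rewrite ler_pdivrMl// (le_trans (fC _))//.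
  by rewrite addrK -[X in C * X]ger0_norm ?sqr_ge0// normrX; nra.
have E : (fun h : R => h^-1 *: (f (h *: 1 + x) - f x)) = (fun h : R => h^-1 * (f (h + x) - f x)).
  by apply/funext => h; rewrite /GRing.scale/= mulr1.
apply: DeriveDef; first by apply/cvg_ex; exists 0; rewrite /= E.
by apply: cvg_lim => //; rewrite E.
Unshelve. all: by end_near. Qed.

(* The family is stable under differentiation: [flat n]' is
   [- n * flat n.+1 + flat n.+2], also at the origin. *)
Definition flat (n : nat) x : R := if 0 < x then x ^- n * expR (- x^-1) else 0.

(** From [exp y >= y^(n+2) / (n+2)!] at [y = 1/x]: the power [x^-n] is absorbed and two powers of
    [x] remain. *)
Lemma flat_bound n x : `|flat n x| <= n.+2`!%:R * x ^+ 2.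
Proof.
rewrite /flat; case: ifPn => [x0|_]; last by rewrite normr0 mulr_ge0// sqr_ge0.
rewrite ger0_norm; last by rewrite mulr_ge0 ?expR_ge0// invr_ge0 exprn_ge0// ltW.
rewrite expRN ler_pdivrMr ?expR_gt0//.
have x'0 : 0 <= x^-1 by rewrite invr_ge0 ltW.
have H := expR_ge1Dxn n.+1 x'0.
have : (n.+2`!)%:R * x ^+ 2 * ((x^-1) ^+ n.+2 / n.+2`!%:R) <= (n.+2`!)%:R * x ^+ 2 * expR x^-1.
  rewrite ler_wpM2l//; first by rewrite mulr_ge0// sqr_ge0.
  by apply: le_trans H; rewrite lerDr.
apply: le_trans.
rewrite le_eqVlt; apply/orP; left; apply/eqP.
rewrite exprVn.
have F0 : (n.+2`!)%:R != 0 :> R by rewrite pnatr_eq0 -lt0n fact_gt0.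
have xn0 : x ^+ n != 0 by rewrite expf_neq0// gt_eqF.
by rewrite !exprS; field; rewrite F0 xn0 gt_eqF.
Qed.

Lemma is_derive_flatn n x :
  is_derive x 1 (flat n) (- n%:R * flat n.+1 x + flat n.+2 x).
Proof.
have [x0|x0|->] := ltgtP x 0.
- rewrite /flat ltNge (ltW x0)/= mulr0 addr0.
  have H : is_derive x 1 (fun=> 0 : R) 0 := is_derive_const 0 x.
  apply: near_eq_is_derive H.
  near=> y; have y0 : y < 0 by near: y; exact: lt_nbhsl.
  by rewrite ltNge (ltW y0).
- rewrite /flat x0.
  apply: (@near_eq_is_derive _ _ _ (fun y => (y ^+ n)^-1 * expR (- y^-1))).
    near=> y; have -> // : 0 < y by near: y; exact: lt_nbhsr.
  have xn0 : x != 0 by rewrite gt_eqF.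
  have H1 : is_derive x 1 (fun y : R => y^-1) (- 1 * (x^-1 * x^-1)).
    exact: (is_derive_inv xn0 (is_derive_id x 1)).
  have H2 : is_derive x 1 (fun y : R => expR (- y^-1)) (expR (- x^-1) * (x^-1 * x^-1)).
    have H1' : is_derive x 1 (fun y : R => - y^-1) (x^-1 * x^-1).
      have H := is_derive_mul (is_derive_const (-1) x) H1.
      rewrite (_ : (fun y : R => - y^-1) = (fun y => -1 * y^-1)); last first.
        by apply/funext => y; rewrite mulN1r.
      by apply: (is_derive_eq H); ring.
    exact: (@is_derive1_comp R expR (fun y : R => - y^-1) x _ _ (is_derive_expR _) H1').
  have H3 : is_derive x 1 (fun y : R => y ^+ n) (n%:R * x ^+ n.-1).
    have H := @is_deriveX _ _ id n x 1 1 (is_derive_id x 1).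
    rewrite (_ : (fun y : R => y ^+ n) = id ^+ n); last by apply/funext => y; rewrite exprfctE.
    by apply: (is_derive_eq H); rewrite /GRing.scale/= mulr1.
  have H4 := is_derive_inv (f := fun y => y ^+ n) (expf_neq0 n xn0) H3.
  have H := is_derive_mul H4 H2.
  apply: (is_derive_eq H).
  case: n {H H3 H4} => [|n]/=; rewrite !exprS; field; rewrite ?xn0//= expf_neq0//.
- rewrite /flat ltxx mulr0 addr0.
  apply: (@is_derive_flat _ _ n.+2`!%:R) => y.
  by rewrite ltxx !subr0; exact: flat_bound.
Unshelve. all: by end_near. Qed.

Lemma flat_smooth n : smooth1 (flat n).
Proof.
move=> k; elim: k n => // k IH n.
exists (fun x => - n%:R * flat n.+1 x + flat n.+2 x); first exact: is_derive_flatn.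
apply: dern_uptoD; last exact: IH.
by apply: dern_uptoM; [exact: dern_upto_cst|exact: IH].
Qed.

Lemma flat_gt0 n x : 0 < x -> 0 < flat n x.
Proof. by move=> x0; rewrite /flat x0 mulr_gt0 ?expR_gt0// invr_gt0 exprn_gt0. Qed.

Lemma flat_eq0 n x : x <= 0 -> flat n x = 0.
Proof. by move=> x0; rewrite /flat ltNge x0. Qed.

Lemma flat_ge0 n x : 0 <= flat n x.
Proof. by have [x0|x0] := leP x 0; [rewrite flat_eq0|rewrite ltW// flat_gt0]. Qed.

(** The identity times a smooth step, hence a smooth version of [max(x, 0)] that differs from it
    only between 0 and 1. *)
Definition sramp x : R := x * (flat 0 x * (flat 0 x + flat 0 (-1 * x + 1))^-1).

Lemma sramp_smooth : smooth1 sramp.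
Proof.
move=> k; apply: dern_uptoM.
  rewrite (_ : (fun x : R => x) = (fun x => 1 * x + 0)); first exact: dern_upto_affine.
  by apply/funext => x; rewrite mul1r addr0.
apply: dern_uptoM; first exact: flat_smooth.
apply: dern_uptoV.
  move=> x; rewrite gt_eqF//; have [x0|x0] := leP x 0.
    by rewrite ltr_wpDl// ?flat_ge0// flat_gt0//; lra.
  by rewrite ltr_pwDl// ?flat_ge0// flat_gt0.
apply: dern_uptoD; first exact: flat_smooth.
by apply: dern_upto_comp_affine; exact: flat_smooth.
Qed.

Lemma sramp_le0 x : x <= 0 -> sramp x = 0.
Proof. by move=> x0; rewrite /sramp flat_eq0// mul0r mulr0. Qed.

Lemma sramp_ge1 x : 1 <= x -> sramp x = x.
Proof.
move=> x1; rewrite /sramp (@flat_eq0 _ (-1 * x + 1)); last by lra.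
by rewrite addr0 mulfV ?mulr1// gt_eqF// flat_gt0//; lra.
Qed.

Lemma smooth1_derive f : smooth1 f ->
  (forall x, is_derive x 1 f (derive1 f x)) /\ smooth1 (derive1 f).
Proof.
move=> sf; have [f' ff' _] := sf 1%N.
have E g : (forall x, is_derive x 1 f (g x)) -> g = derive1 f.
  by move=> fg; apply/funext => x; rewrite derive1E; have [_ ->] := fg x.
split; first by move=> x; rewrite -(E _ ff').
by move=> k; have [g fg] := sf k.+1; rewrite (E _ fg).
Qed.

Lemma smooth1_continuous f : smooth1 f -> continuous f.
Proof.
move=> /smooth1_derive[df _] x; have [dfx _] := df x.
by apply: differentiable_continuous; apply/derivable1_diffP.
Qed.

Lemma derive1_sramp_lt0 x : x < 0 -> derive1 sramp x = 0.
Proof.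
move=> x0; rewrite derive1E (@near_eq_derive _ _ _ _ (cst 0)) ?derive_cst//.
by near=> y; rewrite sramp_le0// ltW//; near: y; exact: lt_nbhsl.
Unshelve. all: by end_near. Qed.

Lemma derive1_sramp_gt1 x : 1 < x -> derive1 sramp x = 1.
Proof.
move=> x0; rewrite derive1E (@near_eq_derive _ _ _ _ id) ?derive_id//.
by near=> y; rewrite sramp_ge1// ltW//; near: y; exact: lt_nbhsr.
Unshelve. all: by end_near. Qed.

Definition diff2 f y := f (y + 1) - 2 * f y + f (y - 1).

Lemma diff2_smooth f : smooth1 f -> smooth1 (diff2 f).
Proof.
move=> sf k; rewrite /diff2.
have -> : (fun y => f (y + 1) - 2 * f y + f (y - 1)) =
  (fun y => f (1 * y + 1) + (- 2) * f y + f (1 * y + -1)).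
  by apply/funext => y; rewrite !mul1r mulNr.
apply: dern_uptoD; last exact: dern_upto_comp_affine.
apply: dern_uptoD; first exact: dern_upto_comp_affine.
by apply: dern_uptoM; [exact: dern_upto_cst|exact: sf].
Qed.

Lemma derive1_diff2 f : smooth1 f -> derive1 (diff2 f) = diff2 (derive1 f).
Proof.
move=> /smooth1_derive[df _]; apply/funext => y; rewrite derive1E /diff2.
have -> : (fun y => f (y + 1) - 2 * f y + f (y - 1)) =
  (fun y => f (1 * y + 1) + (- 2) * f y + f (1 * y + -1)).
  by apply/funext => z; rewrite !mul1r mulNr.
have H := is_derive_add (is_derive_add (is_derive_comp_affine (df (1 * y + 1)))
   (is_derive_mul (is_derive_const (-2) y) (df y)))
  (is_derive_comp_affine (df (1 * y + -1))).
have [_ ->] := H; rewrite !mul1r; ring.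
Qed.

(** Telescoping leaves the first differences at the two ends; for a ramp these are its slopes 1 and
    0. *)
Lemma sum_diff2 f M z :
  \sum_(k < M) diff2 f (z - k%:R) =
  f (z + 1) - f z - (f (z - M%:R + 1) - f (z - M%:R)).
Proof.
elim: M => [|M IH]; first by rewrite big_ord0 subr0; ring.
rewrite big_ord_recr/= IH /diff2 -[in RHS]natr1.
have -> : z - (M%:R + 1) + 1 = z - M%:R by ring.
have -> : z - (M%:R + 1) = z - M%:R - 1 by ring.
ring.
Qed.

(** Summation by parts. For the derivative of the ramp the terms at the lower end vanish. *)
Lemma sum_mul_diff2 f M z :
  \sum_(k < M) k%:R * diff2 f (z - k%:R) =
  f z - f (z - M%:R) - M%:R * (f (z - M%:R + 1) - f (z - M%:R)).
Proof.
elim: M => [|M IH]; first by rewrite big_ord0 subr0; ring.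
rewrite big_ord_recr/= IH /diff2 -[in RHS]natr1.
have -> : z - (M%:R + 1) + 1 = z - M%:R by ring.
have -> : z - (M%:R + 1) = z - M%:R - 1 by ring.
ring.
Qed.

Lemma sum_norm_le (f : R -> R) (B : R) M z : 0 <= B ->
  (forall y, `|f y| <= B) -> (forall y, y < -1 -> f y = 0) -> (forall y, 2 < y -> f y = 0) ->
  \sum_(k < M) `|f (z - k%:R)| <= 4 * B.
Proof.
(* With [h] the indicator of [-1, oo), the four differences add up to the indicator of [-1, 3),
   which covers the support. For fixed [r] the sum over [k] telescopes and is at most 1; hence the
   constant 4. *)
move=> B0 fB f1 f2; pose h (y : R) : R := (-1 <= y :> R)%R%:R.
have fh y : `|f y| <= B * \sum_(r < 4) (h (y - r%:R) - h (y - r%:R - 1)).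
  have -> : \sum_(r < 4) (h (y - r%:R) - h (y - r%:R - 1)) = h y - h (y - 4).
    rewrite !big_ord_recr big_ord0/= subr0.
    have -> : y - 1 - 1 = y - 2 by ring.
    have -> : y - 2 - 1 = y - 3 by ring.
    have -> : y - 3 - 1 = y - 4 by ring.
    ring.
  have [y1|y1] := ltP y (-1).
    have [h1 h2] : (-1 <= y) = false /\ (-1 <= y - 4) = false.
      by split; apply/negbTE; rewrite -ltNge; lra.
    by rewrite f1// normr0 /h h1 h2 subr0 mulr0.
  rewrite /h.
  have [y2|y2] := ltP 2 y; last first.
    have -> : (-1 <= y - 4) = false by apply/negbTE; rewrite -ltNge; lra.
    by rewrite y1 subr0 mulr1.
  by rewrite f2// normr0 mulr_ge0// subr_ge0 y1; case: (_ <= _ - _); rewrite ?lexx ?ler01.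
apply: (@le_trans _ _ (\sum_(k < M) B * \sum_(r < 4) (h (z - k%:R - r%:R) - h (z - k%:R - r%:R - 1)))).
  by apply: ler_sum => k _.
rewrite -mulr_sumr exchange_big/= mulrC ler_wpM2r//.
have : \sum_(r < 4) \sum_(k < M) (h (z - k%:R - r%:R) - h (z - k%:R - r%:R - 1)) <= \sum_(r < 4) (1 : R).
  apply: ler_sum => r _.
  have -> : \sum_(k < M) (h (z - k%:R - r%:R) - h (z - k%:R - r%:R - 1)) =
    h (z - r%:R) - h (z - r%:R - M%:R).
    elim: M => [|M IH]; first by rewrite big_ord0 subr0 subrr.
    rewrite big_ord_recr/= IH -natr1.
    have -> : z - r%:R - (M%:R + 1) = z - M%:R - r%:R - 1 by ring.
    have -> : z - M%:R - r%:R = z - r%:R - M%:R by ring.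
    by ring.
  by rewrite /h lerBlDr; case: (_ <= z - r%:R); case: (_ <= z - r%:R - _); rewrite /=; lra.
by rewrite sumr_const card_ord.
Qed.

(** A smooth analogue of the hat function, which is the second difference of [max(y, 0)]. It
    vanishes off [-1, 2] because the ramp is affine on either side of [0, 1]. *)
Definition bspline : R -> R := diff2 sramp.

Lemma bspline_smooth : smooth1 bspline.
Proof. exact: diff2_smooth sramp_smooth. Qed.

Lemma bspline_lt y : y < -1 -> bspline y = 0.
Proof. by move=> ?; rewrite /bspline /diff2 !sramp_le0; lra. Qed.

Lemma bspline_gt y : 2 < y -> bspline y = 0.
Proof. by move=> ?; rewrite /bspline /diff2 !sramp_ge1; lra. Qed.

Lemma dbspline_lt y : y < -1 -> derive1 bspline y = 0.
Proof.
move=> ?; rewrite /bspline derive1_diff2; last exact: sramp_smooth.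
by rewrite /diff2 !derive1_sramp_lt0; lra.
Qed.

Lemma dbspline_gt y : 2 < y -> derive1 bspline y = 0.
Proof.
move=> ?; rewrite /bspline derive1_diff2; last exact: sramp_smooth.
by rewrite /diff2 !derive1_sramp_gt1; lra.
Qed.

Lemma continuous_supp_bounded f : continuous f -> (forall y, y < -1 -> f y = 0) ->
  (forall y, 2 < y -> f y = 0) -> exists2 B, 0 <= B & forall y, `|f y| <= B.
Proof.
move=> cf f1 f2.
have [c _ cB] : exists2 c, c \in `[(-1 : R), 2] & forall t, t \in `[(-1 : R), 2] -> `|f t| <= `|f c|.
  apply: (@EVT_max _ (fun t => `|f t|)); first by lra.
  apply: continuous_subspaceT => x; apply: cvg_norm; exact: cf.
exists (`|f c|) => // y.
have [y1|y1] := ltP y (-1); first by rewrite f1// normr0.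
have [y2|y2] := ltP 2 y; first by rewrite f2// normr0.
by apply: cB; rewrite in_itv/= y1.
Qed.

(** The bound depends neither on the number of translates nor on the shift, so one constant serves
    all grids. *)
Lemma bspline_bounded : exists2 B, 0 <= B &
  forall M z, \sum_(k < M) `|bspline (z - k%:R)| <= B /\
    \sum_(k < M) `|derive1 bspline (z - k%:R)| <= B.
Proof.
have [_ ds] := smooth1_derive bspline_smooth.
have [B1 B10 HB1] := continuous_supp_bounded (smooth1_continuous bspline_smooth) bspline_lt bspline_gt.
have [B2 B20 HB2] := continuous_supp_bounded (smooth1_continuous ds) dbspline_lt dbspline_gt.
exists (4 * B1 + 4 * B2) => [|M z]; first by rewrite addr_ge0// mulr_ge0.
split.
  apply: le_trans (sum_norm_le _ _ B10 HB1 bspline_lt bspline_gt) _.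
  by rewrite lerDl mulr_ge0.
apply: le_trans (sum_norm_le _ _ B20 HB2 dbspline_lt dbspline_gt) _.
by rewrite lerDr mulr_ge0.
Qed.

Lemma sum_bspline M z : 1 < z -> z < M%:R - 1 -> \sum_(k < M) bspline (z - k%:R) = 1.
Proof.
move=> z1 zM; rewrite /bspline sum_diff2.
rewrite (@sramp_ge1 (z + 1)) ?(@sramp_ge1 z) ?(@sramp_le0 (z - M%:R + 1)) ?(@sramp_le0 (z - M%:R)); lra.
Qed.

Lemma sum_dbspline M z : 1 < z -> z < M%:R - 1 ->
  \sum_(k < M) derive1 bspline (z - k%:R) = 0.
Proof.
move=> z1 zM; rewrite /bspline derive1_diff2; last exact: sramp_smooth.
rewrite sum_diff2 ?(@derive1_sramp_gt1 z) ?(@derive1_sramp_gt1 (z + 1)) ?(@derive1_sramp_lt0 (z - M%:R + 1))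
  ?(@derive1_sramp_lt0 (z - M%:R)); lra.
Qed.

(** This is the derivative in [z] of the sum of [k * bspline (z - k)]: linear data are interpolated
    with the exact slope. *)
Lemma sum_mul_dbspline M z : 1 < z -> z < M%:R - 1 ->
  \sum_(k < M) k%:R * derive1 bspline (z - k%:R) = 1.
Proof.
move=> z1 zM; rewrite /bspline derive1_diff2; last exact: sramp_smooth.
rewrite sum_mul_diff2 ?(@derive1_sramp_gt1 z) ?(@derive1_sramp_lt0 (z - M%:R + 1))
  ?(@derive1_sramp_lt0 (z - M%:R)); lra.
Qed.

End smooth_real.

(** * Smooth approximation of Lipschitz functions *)

Section calculus_rV.
Context {R : realType} {N : nat}.
Implicit Types (f : 'rV[R]_N -> R) (x y v : 'rV[R]_N).

Lemma normrV_le x (M : R) : 0 <= M -> (`|x| <= M) <-> (forall i, `|x 0 i| <= M).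
Proof.
move=> M0; rewrite {1}/Num.norm/= mx_normrE; split.
  by move/bigmax_leP => [_ H] i; exact: (H (0, i)).
by move=> H; apply/bigmax_leP; split => // -[i j] _ /=; rewrite ord1.
Qed.

Lemma normrV_coord x i : `|x 0 i| <= `|x|.
Proof. by have /(_ (normr_ge0 x))[H _] := @normrV_le x `|x|; apply: H. Qed.

Lemma derive_line f x v : 'D_v f x = 'D_1 (fun t : R => f (t *: v + x)) 0.
Proof.
suff E : (fun h : R => h^-1 *: ((f \o shift x) (h *: v) - f x)) =
    (fun h : R => h^-1 *: (((fun t : R => f (t *: v + x)) \o shift 0) (h *: 1) - f (0 *: v + x))).
  by rewrite /derive E.
by apply/funext => t /=; rewrite addr0 scale0r add0r /GRing.scale/= mulr1.
Qed.

Lemma is_derive_line f x v d : is_derive (0 : R) 1 (fun t : R => f (x + t *: v)) d ->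
  is_derive x v f d.
Proof.
rewrite (_ : (fun t : R => f (x + t *: v)) = (fun t : R => f (t *: v + x))); last first.
  by apply/funext => t; rewrite addrC.
by move=> [dv <-]; apply: DeriveDef; [exact/derivable1P|exact: derive_line].
Qed.

Lemma derive_dot f x v : differentiable f x -> 'D_v f x = dot (grad f x) v.
Proof.
move=> df; rewrite deriveE// {1}(row_sum_delta v) linear_sum /dot.
apply: eq_bigr => i _; rewrite linearZ/= mxE /partial deriveE//.
by rewrite mulrC.
Qed.

Lemma is_derive_along f x v (t : R) : differentiable f (x + t *: v) ->
  is_derive t 1 (fun s : R => f (x + s *: v)) (dot (grad f (x + t *: v)) v).
Proof.
move=> df; have H : is_derive (0 : R) 1 (fun s : R => f (s *: v + (x + t *: v))) (dot (grad f (x + t *: v)) v).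
  have D := @diff_derivable _ _ _ f _ v df.
  apply: DeriveDef; first exact: (proj1 (derivable1P f _ v) D).
  by rewrite -derive_dot// derive_line.
have H' : is_derive (1 * t + - t) 1 (fun s => f (s *: v + (x + t *: v))) (dot (grad f (x + t *: v)) v).
  by rewrite mul1r subrr.
have := is_derive_comp_affine H'; rewrite mul1r.
rewrite (_ : (fun y : R => f ((1 * y + - t) *: v + (x + t *: v))) = (fun s : R => f (x + s *: v)))//.
by apply/funext => s; rewrite mul1r addrCA -scalerDl subrK.
Qed.

End calculus_rV.

(** * Sums of products of functions of one variable *)

Section smooth_products.
Context {R : realType} {N : nat}.

Definition prodf (p : 'I_N -> R -> R) (x : 'rV[R]_N) : R := \prod_i p i (x 0 i).

Definition dprodf (j : 'I_N) (p : 'I_N -> R -> R) : 'I_N -> R -> R :=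
  fun i => if i == j then derive1 (p i) else p i.

Lemma prodf_differentiable p x : (forall i, smooth1 (p i)) -> differentiable (prodf p) x.
Proof.
move=> sp; rewrite /prodf; elim: (index_enum _) => [|i s IH].
  under eq_fun do rewrite big_nil; exact: differentiable_cst.
under eq_fun do rewrite big_cons.
apply: (@differentiableM _ _ (fun x : 'rV[R]_N => p i (x 0 i)) _ x _ IH).
apply: (@differentiable_comp _ _ _ _ (fun x : 'rV[R]_N => x 0 i) (p i)).
  exact: differentiable_coord.
by apply/derivable1_diffP; have [/(_ (x 0 i))[]] := smooth1_derive (sp i).
Qed.

Lemma prodf_partial p j : (forall i, smooth1 (p i)) ->
  partial j (prodf p) = prodf (dprodf j p).
Proof.
move=> sp; apply/funext => x; rewrite /partial.
suff [_ ->] : is_derive x (delta_mx 0 j) (prodf p) (prodf (dprodf j p) x) by [].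
apply: is_derive_line.
have E : (fun t : R => prodf p (x + t *: delta_mx 0 j)) =
    (fun t => p j (1 * t + x 0 j) * \prod_(i | i != j) p i (x 0 i)).
  apply/funext => t; rewrite /prodf (bigD1 j)//= !mxE !eqxx mulr1 mul1r addrC.
  congr (_ * _); apply: eq_bigr => i ij.
  by rewrite !mxE (negbTE ij) andbF mulr0 addr0.
have -> : prodf (dprodf j p) x = derive1 (p j) (x 0 j) * \prod_(i | i != j) p i (x 0 i).
  rewrite /prodf (bigD1 j)//= {1}/dprodf eqxx; congr (_ * _).
  by apply: eq_bigr => i /negbTE ij; rewrite /dprodf ij.
rewrite E.
have [dp _] := smooth1_derive (sp j).
have H : is_derive (1 * 0 + x 0 j) 1 (p j) (derive1 (p j) (x 0 j)).
  by rewrite mulr0 add0r; apply: dp.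
have := is_derive_mul (is_derive_comp_affine H) (is_derive_const (\prod_(i | i != j) p i (x 0 i)) 0).
by move=> D; apply: (is_derive_eq D); rewrite mul1r mulr0 addr0.
Qed.

Lemma dprodf_smooth p j : (forall i, smooth1 (p i)) -> forall i, smooth1 (dprodf j p i).
Proof.
by move=> sp i; rewrite /dprodf; case: ifP => // _; have [] := smooth1_derive (sp i).
Qed.

(** This class contains the interpolants below and is stable under [partial], so smoothness of every
    order follows by induction. *)
Definition sumprodf (s : seq (R * ('I_N -> R -> R))) (x : 'rV[R]_N) : R :=
  \sum_(q <- s) q.1 * prodf q.2 x.

Definition allsmooth (s : seq (R * ('I_N -> R -> R))) : Prop :=
  forall q, List.In q s -> forall i, smooth1 (q.2 i).

Lemma sumprodf_partial s : allsmooth s -> forall x,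
  differentiable (sumprodf s) x /\
  (forall j, partial j (sumprodf s) x = sumprodf [seq (q.1, dprodf j q.2) | q <- s] x).
Proof.
elim: s => [_ x|q s IH sm x].
  rewrite /sumprodf; split; first by under eq_fun do rewrite big_nil; exact: differentiable_cst.
  move=> j; rewrite big_nil /partial.
  by under eq_fun do rewrite big_nil; rewrite derive_cst.
have sq : forall i, smooth1 (q.2 i) by apply: sm; left.
have {}IH := IH (fun q' H => sm q' (or_intror H)).
have E : sumprodf (q :: s) = (q.1 \*: prodf q.2) + sumprodf s.
  by apply/funext => y; rewrite /sumprodf big_cons.
have d1 := prodf_differentiable x sq; have [d2 P] := IH x.
split.
  by rewrite E; apply: differentiableD => //; exact: differentiableZ.
move=> j; rewrite /partial E deriveD; last 2 first.
- exact/derivableZ/diff_derivable.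
- exact: diff_derivable.
rewrite deriveZ; last exact: diff_derivable.
have -> : 'D_(delta_mx 0 j) (sumprodf s) x = partial j (sumprodf s) x by [].
have -> : 'D_(delta_mx 0 j) (prodf q.2) x = partial j (prodf q.2) x by [].
by rewrite P prodf_partial// /sumprodf /= big_cons.
Qed.

Lemma sumprodf_Cinfty s : allsmooth s -> Cinfty setT (sumprodf s).
Proof.
move=> + k; elim: k s => [|k IH] s sm.
  move=> x _; apply: differentiable_continuous.
  by have [] := sumprodf_partial sm x.
split; first by move=> x _; have [] := sumprodf_partial sm x.
move=> j; rewrite (_ : partial j (sumprodf s) = sumprodf [seq (q.1, dprodf j q.2) | q <- s]); last first.
  by apply/funext => x; have [_ ->] := sumprodf_partial sm x.
apply: IH => q /List.in_map_iff[q' [<- q's]] /=.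
exact: dprodf_smooth (sm _ q's).
Qed.

End smooth_products.

(* The integer translates of [bspline] sum to 1 and reproduce affine functions.
   Interpolating a Lipschitz function with them on the grid of the points
   [(k - c) / (n + 1)] gives smooth functions with gradients bounded in [n], and
   these converge wherever the function is differentiable. *)
Section quasi_interpolation.
Context {R : realType} {N : nat} (f : 'rV[R]_N -> R) (n M : nat) (c : R).
Let d : R := n.+1%:R.

Definition qnode (k : {ffun 'I_N -> 'I_M}) : 'rV[R]_N :=
  \row_i (d^-1 * ((k i)%:R - c)).

(** The argument [d * x 0 i + c - k i] is [d] times the offset of [x] from the node. The profile [h]
    may depend on the coordinate, so that a partial derivative of a weight has the same form up to
    the factor [d]. *)
Definition qweight (h : 'I_N -> R -> R) (k : {ffun 'I_N -> 'I_M}) (x : 'rV[R]_N) : R :=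
  \prod_i h i (d * x 0 i + c - (k i)%:R).

Definition qinterp (x : 'rV[R]_N) : R :=
  \sum_k f (qnode k) * qweight (fun=> bspline) k x.

Definition qderiv (j : 'I_N) : 'I_N -> R -> R :=
  fun i => if i == j then derive1 bspline else bspline.

Definition qseq : seq (R * ('I_N -> R -> R)) :=
  [seq (f (qnode k), fun i y => bspline (d * y + (c - (k i)%:R)))
    | k <- index_enum _].

Lemma qseq_smooth : allsmooth qseq.
Proof.
move=> q /List.in_map_iff[k [<- _]] i /= l.
exact/dern_upto_comp_affine/bspline_smooth.
Qed.

Lemma qinterpE : qinterp = sumprodf qseq.
Proof.
apply/funext => x; rewrite /qinterp /sumprodf /qseq big_map/=.
apply: eq_bigr => k _; rewrite /qweight /prodf; congr (_ * _).
by apply: eq_bigr => i _; rewrite addrA.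
Qed.

Lemma qinterp_Cinfty : Cinfty setT qinterp.
Proof. by rewrite qinterpE; apply/sumprodf_Cinfty/qseq_smooth. Qed.

Lemma qinterp_partial j x :
  partial j qinterp x = d * \sum_k f (qnode k) * qweight (qderiv j) k x.
Proof.
rewrite qinterpE; have [_ ->] := sumprodf_partial qseq_smooth x.
rewrite /sumprodf /qseq !big_map/= mulr_sumr.
apply: eq_bigr => k _; rewrite mulrCA; congr (_ * _).
rewrite /qweight /prodf (bigD1 j)//= [in RHS](bigD1 j)//= mulrA; congr (_ * _).
  rewrite /dprodf /qderiv eqxx derive1E.
  have [db _] := smooth1_derive (@bspline_smooth R).
  have [_ ->] := is_derive_comp_affine (db (d * x 0 j + (c - (k j)%:R))).
  by rewrite addrA.
by apply: eq_bigr => i /negbTE ij; rewrite /dprodf /qderiv ij addrA.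
Qed.

Lemma sum_prod_distr (V : 'I_N -> 'I_M -> R) :
  \sum_(k : {ffun 'I_N -> 'I_M}) \prod_i V i (k i) = \prod_i \sum_k V i k.
Proof. by rewrite bigA_distr_bigA. Qed.

Lemma d_gt0 : 0 < d. Proof. by rewrite ltr0n. Qed.

(** Profiles supported in [-1, 2] see only the nodes within two grid steps of [x]. *)
Lemma qweight_near h k x : (forall i y, y < -1 -> h i y = 0) -> (forall i y, 2 < y -> h i y = 0) ->
  qweight h k x != 0 -> `|qnode k - x| <= 2 * d^-1.
Proof.
move=> h1 h2 /prodf_neq0 H; apply/normrV_le; first by rewrite mulr_ge0// invr_ge0 ltW// d_gt0.
move=> i; have := H i isT; rewrite !mxE => Hi.
have y1 : -1 <= d * x 0 i + c - (k i)%:R.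
  by rewrite leNgt; apply/negP => /h1 E; rewrite E eqxx in Hi.
have y2 : d * x 0 i + c - (k i)%:R <= 2.
  by rewrite leNgt; apply/negP => /h2 E; rewrite E eqxx in Hi.
have -> : d^-1 * ((k i)%:R - c) - x 0 i = - (d * x 0 i + c - (k i)%:R) * d^-1.
  by field; rewrite gt_eqF// d_gt0.
rewrite normrM normrN (ger0_norm (_ : 0 <= d^-1)); last by rewrite invr_ge0 ltW// d_gt0.
rewrite ler_wpM2r//; first by rewrite invr_ge0 ltW// d_gt0.
by rewrite ler_norml; apply/andP; split; lra.
Qed.

Lemma qweight_bound h B x : (forall i z, \sum_(k < M) `|h i (z - k%:R)| <= B) ->
  \sum_k `|qweight h k x| <= B ^+ N.
Proof.
move=> hB; rewrite (eq_bigr (fun k : {ffun 'I_N -> 'I_M} => \prod_i `|h i (d * x 0 i + c - (k i)%:R)|)); last first.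
  by move=> k _; rewrite /qweight normr_prod.
rewrite (sum_prod_distr (fun i k => `|h i (d * x 0 i + c - k%:R)|)).
rewrite -[X in _ <= _ ^+ X]card_ord -prodr_const; apply: ler_prod => i _.
by rewrite hB andbT sumr_ge0.
Qed.

Variable x : 'rV[R]_N.
(** The rescaled coordinates stay in the range where [sum_bspline] and its companions hold. *)
Hypothesis xin : forall i, 1 < d * x 0 i + c /\ d * x 0 i + c < M%:R - 1.

Lemma sum_qweight : \sum_k qweight (fun=> bspline) k x = 1.
Proof.
rewrite /qweight (sum_prod_distr (fun i k => bspline (d * x 0 i + c - k%:R))).
by rewrite big1// => i _; apply: sum_bspline; have [] := xin i.
Qed.

Lemma sum_qweight_deriv j : \sum_k qweight (qderiv j) k x = 0.
Proof.
rewrite /qweight (sum_prod_distr (fun i k => qderiv j i (d * x 0 i + c - k%:R))).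
rewrite (bigD1 j)//= /qderiv eqxx sum_dbspline ?mul0r//; by have [] := xin j.
Qed.

Lemma sum_node_qweight_deriv j l :
  \sum_(k : {ffun 'I_N -> 'I_M}) (k l)%:R * qweight (qderiv j) k x = (l == j)%:R.
Proof.
(* The factor [k l] is moved into the [l]-th coordinate factor, so that the sum over the grid still
   splits into one-dimensional sums. *)
pose V i (k : 'I_M) := (if i == l then k%:R else 1) * qderiv j i (d * x 0 i + c - k%:R).
rewrite (eq_bigr (fun k : {ffun 'I_N -> 'I_M} => \prod_i V i (k i))); last first.
  move=> k _; rewrite /qweight /V big_split/=; congr (_ * _).
  by rewrite (bigD1 l)//= eqxx big1 ?mulr1// => i /negbTE ->.
rewrite (sum_prod_distr V) (bigD1 j)//= /V /qderiv eqxx.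
have [x1 x2] := xin j.
have [lj|lj] := eqVneq l j.
  rewrite lj sum_mul_dbspline// mul1r big1// => i /negbTE ij; rewrite ij.
  under eq_bigr do rewrite mul1r.
  by apply: sum_bspline; have [] := xin i.
under eq_bigr do rewrite mul1r.
by rewrite sum_dbspline// mul0r.
Qed.

Lemma qderiv_lt j i y : y < -1 -> qderiv j i y = 0.
Proof. by rewrite /qderiv; case: ifP => _ ?; [exact: dbspline_lt|exact: bspline_lt]. Qed.

Lemma qderiv_gt j i y : 2 < y -> qderiv j i y = 0.
Proof. by rewrite /qderiv; case: ifP => _ ?; [exact: dbspline_gt|exact: bspline_gt]. Qed.

(** Only nodes within two grid steps carry weight, and the absolute weights add up to at most
    [B ^+ N]. *)
Lemma weighted_sum_bound h B (g : {ffun 'I_N -> 'I_M} -> R) (e : R) : 0 <= e ->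
  (forall i y, y < -1 -> h i y = 0) -> (forall i y, 2 < y -> h i y = 0) ->
  (forall i z, \sum_(k < M) `|h i (z - k%:R)| <= B) ->
  (forall k, `|qnode k - x| <= 2 * d^-1 -> `|g k| <= e) ->
  `|\sum_k g k * qweight h k x| <= e * B ^+ N.
Proof.
move=> e0 h1 h2 hB ge; apply: (le_trans (ler_norm_sum _ _ _)).
apply: (@le_trans _ _ (\sum_k e * `|qweight h k x|)); last first.
  by rewrite -mulr_sumr ler_wpM2l//; exact: qweight_bound.
apply: ler_sum => k _; rewrite normrM.
have [->|w0] := eqVneq (qweight h k x) 0; first by rewrite normr0 !mulr0.
by rewrite ler_wpM2r//; apply: ge; exact: qweight_near w0.
Qed.

Lemma qinterp_value (e B : R) : 0 <= e ->
  (forall z, \sum_(k < M) `|bspline (z - k%:R)| <= B) ->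
  (forall y : 'rV[R]_N, `|y - x| <= 2 * d^-1 -> `|f y - f x| <= e) ->
  `|qinterp x - f x| <= e * B ^+ N.
Proof.
move=> e0 hB fe; rewrite -[X in _ - X]mulr1 -sum_qweight /qinterp mulr_sumr -sumrB.
under eq_bigr do rewrite -mulrBl.
apply: weighted_sum_bound => //.
- by move=> _; exact: bspline_lt.
- by move=> _; exact: bspline_gt.
- by move=> k; exact: fe.
Qed.

(** The differentiated weights annihilate constants and reproduce the slope [a], so only the
    first-order remainder of [f] contributes. The factor [d] is the price of differentiating; it is
    harmless because [e] will be of order [1/d] or smaller. *)
Lemma qinterp_grad j (a : 'rV[R]_N) (e B : R) : 0 <= e ->
  (forall z, \sum_(k < M) `|bspline (z - k%:R)| <= B) ->
  (forall z, \sum_(k < M) `|derive1 bspline (z - k%:R)| <= B) ->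
  (forall y : 'rV[R]_N, `|y - x| <= 2 * d^-1 -> `|f y - f x - dot a (y - x)| <= e) ->
  `|partial j qinterp x - a 0 j| <= d * (e * B ^+ N).
Proof.
move=> e0 hB hB' fe.
have d0 : d != 0 by rewrite gt_eqF// d_gt0.
have L : \sum_k dot a (qnode k - x) * qweight (qderiv j) k x = d^-1 * a 0 j.
  rewrite /dot; under eq_bigr do rewrite mulr_suml.
  rewrite exchange_big/=.
  rewrite (eq_bigr (fun l => d^-1 * a 0 l * (l == j)%:R)); last first.
    move=> l _; rewrite -sum_node_qweight_deriv mulr_sumr.
    (* The [l]-th coordinate of [qnode k - x] is [d^-1] times [k l - (d * x 0 l + c)]; the part
       independent of [k] is killed because the differentiated weights sum to 0. *)
    have := congr1 ( *%R (d^-1 * a 0 l * (d * x 0 l + c))) (sum_qweight_deriv j).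
    rewrite mulr0 mulr_sumr => Z; rewrite -[RHS]subr0 -[X in _ = _ - X]Z -sumrB.
    by apply: eq_bigr => k _; rewrite !mxE; field.
  rewrite (bigD1 j)//= eqxx mulr1 big1 ?addr0// => l /negbTE ->.
  by rewrite mulr0.
have -> : a 0 j = d * (d^-1 * a 0 j) by rewrite mulVKf.
rewrite -L qinterp_partial -mulrBr normrM ger0_norm; last by rewrite ltW// d_gt0.
rewrite ler_wpM2l//.
have -> : \sum_k f (qnode k) * qweight (qderiv j) k x =
    \sum_k (f (qnode k) - f x) * qweight (qderiv j) k x.
  under [RHS]eq_bigr do rewrite mulrBl.
  by rewrite sumrB -mulr_sumr sum_qweight_deriv mulr0 subr0.
rewrite -sumrB; under eq_bigr do rewrite -mulrBl.
apply: weighted_sum_bound => //.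
- exact: qderiv_lt.
- exact: qderiv_gt.
- by move=> i z; rewrite /qderiv; case: ifP.
- by move=> k; exact: fe.
Qed.

End quasi_interpolation.

Section approximation.
Context {R : realType} {N : nat}.

(** Differentiability at one point with a prescribed gradient, in the quantitative form that
    [qinterp_grad] consumes. *)
Definition has_grad (f : 'rV[R]_N -> R) (x a : 'rV[R]_N) : Prop :=
  forall e : R, 0 < e -> exists2 r : R, 0 < r & forall y : 'rV[R]_N, `|y - x| <= r ->
    `|f y - f x - dot a (y - x)| <= e * `|y - x|.

Lemma differentiable_has_grad (f : 'rV[R]_N -> R) x : differentiable f x ->
  has_grad f x (grad f x).
Proof.
move=> df e e0.
have /diff_locally/eqaddoP/(_ e e0) := df.
move=> /nbhs_ballP[r /= r0 H]; exists (r / 2); first by rewrite divr_gt0.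
move=> y yx; have : ball (0 : 'rV[R]_N) r (y - x).
  by rewrite -ball_normE/= sub0r normrN (le_lt_trans yx)// ltr_pdivrMr//; lra.
move/H => /=; rewrite !fctE /= subrK.
by rewrite -derive_dot// deriveE// opprD addrA.
Qed.

(** The clauses are what dominated convergence needs in the weak formulation: control of supports,
    uniform convergence, bounded gradients, and convergence of gradients wherever [f] has one. The
    ball of radius [r] is there because each grid is finite. *)
Lemma lipschitz_approx (f : 'rV[R]_N -> R) (L r : R) : 0 <= L ->
  (forall x y : 'rV[R]_N, `|f x - f y| <= L * `|x - y|) ->
  exists (phi : nat -> 'rV[R]_N -> R) (C : R),
    [/\ forall n, Cinfty setT (phi n),
        forall n x, phi n x != 0 -> exists2 y, f y != 0 & `|y - x| <= 2 * n.+1%:R^-1,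
        forall n (x : 'rV[R]_N), `|x| <= r -> `|phi n x - f x| <= C * n.+1%:R^-1,
        forall n (x : 'rV[R]_N), `|x| <= r -> forall j, `|partial j (phi n) x| <= C
      & forall x a : 'rV[R]_N, `|x| <= r -> has_grad f x a -> forall j,
          (fun n => partial j (phi n) x) @ \oo --> a 0 j].
Proof.
move=> L0 fL; have [B B0 HB] := @bspline_bounded R.
have HB1 M z := (HB M z).1; have HB2 M z := (HB M z).2.
pose m := (Num.truncn `|r|).+1.
have rm : r <= m%:R.
  by rewrite (le_trans (ler_norm _))// ltW// /m; have /andP[] := truncn_itv (normr_ge0 r).
(* For [|x| <= r <= m] the rescaled coordinate has size at most [K n - 2]. Shifting it by [K n] in a
   grid of [2 * K n] nodes leaves a margin of 2 at both ends. *)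
pose K n := (n.+1 * m + 2)%N.
pose phi n := @qinterp R N f n (K n + K n) (K n)%:R.
have xin n (x : 'rV[R]_N) : `|x| <= r -> forall i, 1 < n.+1%:R * x 0 i + (K n)%:R /\
    n.+1%:R * x 0 i + (K n)%:R < (K n + K n)%:R - 1.
  move=> xr i; have : `|n.+1%:R * x 0 i| <= n.+1%:R * m%:R :> R.
    rewrite normrM ger0_norm// ler_wpM2l// (le_trans _ rm)//.
    exact: le_trans (normrV_coord _ _) xr.
  by rewrite ler_norml => /andP[h1 h2]; rewrite /K !natrD natrM; split; lra.
exists phi, (2 * L * B ^+ N); split.
- by move=> n; exact: qinterp_Cinfty.
- move=> n x p0.
  have [k kH] : exists k : {ffun 'I_N -> 'I_(K n + K n)}, f (qnode n (K n)%:R k) * qweight n (K n)%:R (fun=> bspline) k x != 0.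
    apply: contrapT => H; move/eqP: p0; apply.
    rewrite /phi /qinterp big1// => k _; apply: contrapT => kH.
    by apply: H; exists k; apply/eqP.
  move: kH; rewrite mulf_eq0 negb_or => /andP[f0 w0].
  exists (qnode n (K n)%:R k) => //; apply: qweight_near w0.
    by move=> _; exact: bspline_lt.
  by move=> _; exact: bspline_gt.
- move=> n x xr.
  have := qinterp_value (f := f) (xin n x xr) (e := L * (2 * n.+1%:R^-1)) _ (HB1 _).
  rewrite /phi; have -> : 2 * L * B ^+ N * n.+1%:R^-1 = L * (2 * n.+1%:R^-1) * B ^+ N by ring.
  apply; first by rewrite !mulr_ge0.
  by move=> y yx; rewrite (le_trans (fL _ _))// ler_wpM2l.
- move=> n x xr j.
  (* With slope 0 the Lipschitz estimate itself is the first-order remainder; it is of order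
     [1/(n+1)], so the factor [n+1] leaves a constant. *)
  have := qinterp_grad (f := f) (a := 0) (xin n x xr) j (e := L * (2 * n.+1%:R^-1)) _ (HB1 _) (HB2 _).
  rewrite mxE subr0.
  have -> : n.+1%:R * (L * (2 * n.+1%:R^-1) * B ^+ N) = 2 * L * B ^+ N by field.
  apply; first by rewrite !mulr_ge0.
  move=> y yx; rewrite /dot big1; last by move=> i _; rewrite mxE mul0r.
  by rewrite subr0 (le_trans (fL _ _))// ler_wpM2l.
- move=> x a xr df j; apply/cvgrPdist_le => e e0.
  have BN : 0 < 2 * B ^+ N + 1 by rewrite ltr_wpDl// mulr_ge0// exprn_ge0.
  (* The remainder [e' * 2 / (n+1)] gets multiplied by [(n+1) * B ^+ N]; the [+ 1] keeps the
     denominator positive even when [B = 0]. *)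
  pose e' := e / (2 * B ^+ N + 1).
  have e'0 : 0 < e' by rewrite divr_gt0.
  have [s s0 Hs] := df _ e'0.
  have s20 : 0 < s / 2 by rewrite divr_gt0.
  have Hn := near_infty_natSinv_lt (PosNum s20).
  near=> n.
  have ns : n.+1%:R^-1 <= s / 2.
    by near: n; apply: filterS Hn => k /ltW.
  have := qinterp_grad (f := f) (a := a) (xin n x xr) j (e := e' * (2 * n.+1%:R^-1)) _ (HB1 _) (HB2 _).
  rewrite distrC => H; apply: (le_trans (H _ _)).
  + by apply: mulr_ge0; [exact: ltW|rewrite mulr_ge0].
  + move=> y yx; apply: (le_trans (Hs _ _)); last by rewrite ler_wpM2l// ltW.
    by rewrite (le_trans yx)// mulrC -ler_pdivlMr.
  + have -> : n.+1%:R * (e' * (2 * n.+1%:R^-1) * B ^+ N) = e' * (2 * B ^+ N) by field.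
    rewrite /e' mulrAC ler_pdivrMr// ler_pM2l// lerDl//.
Unshelve. all: by end_near. Qed.

End approximation.

(** * Dilations and Lebesgue measure *)

Section dilation_measure.
Context {R : realType}.
Local Notation RB := (measurableTypeR R).
Local Notation leb := (@lebesgue_measure R).

Definition dil1 (c : R) : RB -> RB := fun x => c * x.

Lemma measurable_dil1 c : measurable_fun setT (dil1 c).
Proof. by apply: continuous_measurable_fun => x; apply: cvgMr; exact: cvg_id. Qed.

HB.instance Definition _ c := isMeasurableFun.Build _ _ _ _ (dil1 c) (measurable_dil1 c).

(** The push-forward under the dilation, rescaled by [c], gives half-open intervals their length, so
    uniqueness of Lebesgue measure applies. *)
Lemma lebesgue_dil1 (c : R) (A : set RB) : 0 < c -> measurable A ->
  leb (dil1 c @^-1` A) = ((c^-1)%:E * leb A)%E.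
Proof.
move=> c0 mA; have c1 : 0 <= c by exact: ltW.
pose push : {measure set RB -> \bar R} := pushforward leb (dil1 c).
pose mu : {measure set RB -> \bar R} := mscale (NngNum c1) (push (measurable_dil1 c)).
have : leb A = mu A.
  apply: lebesgue_measure_unique => // _ [[a b]] _ <-.
  rewrite /mu /= /mscale /= /pushforward.
  have -> : dil1 c @^-1` [set` `]a, b]] = [set` `]c^-1 * a, c^-1 * b]].
    apply/seteqP; split => x /=; rewrite !in_itv/= /dil1.
      by rewrite ltr_pdivrMl// ler_pdivlMl.
    by rewrite ltr_pdivrMl// ler_pdivlMl.
  rewrite !lebesgue_measure_itv/= !lte_fin ltr_pM2l ?invr_gt0//.
  case: ifPn => _; last by rewrite mule0.
  by rewrite -!EFinD -EFinM -mulrBr mulVKf// gt_eqF.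
rewrite /mu/= /mscale/= /pushforward => ->.
by rewrite muleA -EFinM mulVf ?mul1e// gt_eqF.
Qed.

Definition dil n (c : R) (t : n.-tuple RB) : n.-tuple RB := map_tuple (dil1 c) t.

Lemma measurable_dil n c : measurable_fun setT (@dil n c).
Proof.
apply/measurable_fun_tnthP => i.
rewrite (_ : _ \o _ = dil1 c \o (@tnth n RB)^~ i); last first.
  by apply/funext => t /=; rewrite tnth_map.
by apply: measurableT_comp; [exact: measurable_dil1|exact: measurable_tnth].
Qed.

HB.instance Definition _ n c :=
  isMeasurableFun.Build _ _ _ _ (@dil n c) (@measurable_dil n c).

Lemma dil_cons n c (x : RB) (t : n.-tuple RB) :
  dil c (cons_pair (x, t)) = cons_pair (dil1 c x, dil c t).
Proof. exact: val_inj. Qed.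

(** Induction through sections of the product measure: each section contributes one factor [c^-1],
    and the induction hypothesis, read as an equality of measures, changes variables in the
    remaining integral. *)
Lemma lebesgue_dil n (c : R) (A : set (n.-tuple RB)) : 0 < c -> measurable A ->
  lebesgue_tuple n (dil c @^-1` A) = ((c ^- n)%:E * lebesgue_tuple n A)%E.
Proof.
move=> c0; elim: n A => [|n IH] A mA.
  rewrite expr0 invr1 mul1e /= (_ : dil c @^-1` A = A)//.
  by apply/seteqP; split => t /=; rewrite (tuple0 (dil c t)) (tuple0 t).
pose B := @cons_pair R n @^-1` A.
have mB : measurable B.
  by rewrite -[B]setTI; exact: measurable_cons_pair.
pose h (t : n.-tuple RB) : \bar R := leb (ysection B t).
have mh : measurable_fun [set: n.-tuple RB] h by exact: measurable_fun_ysection.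
rewrite /= /lebesgue_step /pushforward /=.
have -> : @cons_pair R n @^-1` (dil c @^-1` A) =
    [set z | B (dil1 c z.1, dil c z.2)].
  by apply/seteqP; split => -[x t] /=; rewrite dil_cons.
rewrite [LHS]/product_measure2 -/B [in RHS]/product_measure2.
transitivity (\int[lebesgue_tuple n]_t ((c^-1)%:E * (h \o dil c) t))%E.
  apply: eq_integral => t _ /=.
  have -> : ysection [set z | B (dil1 c z.1, dil c z.2)] t = dil1 c @^-1` ysection B (dil c t).
    by apply/seteqP; split => x /=; rewrite /ysection /= !inE.
  by rewrite lebesgue_dil1//; exact: measurable_ysection.
have cV0 : (0 <= c^-1)%R by rewrite invr_ge0 ltW.
rewrite ge0_integralZl//; last exact: measurableT_comp mh (measurable_dil c).
have cn0 : (0 <= c ^- n)%R by rewrite invr_ge0 exprn_ge0// ltW.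
transitivity ((c^-1)%:E * \int[pushforward (lebesgue_tuple n) (@dil n c)]_t h t)%E.
  congr (_ * _)%E; rewrite (ge0_integral_pushforward (measurable_dil c))//.
rewrite (@eq_measure_integral _ _ _ _ (mscale (NngNum cn0) (lebesgue_tuple n)))//; last first.
  by move=> E mE _; rewrite /= /mscale /= -IH.
rewrite ge0_integral_mscale//=.
by rewrite muleA -EFinM exprSr invfM mulrC.
Qed.

End dilation_measure.

(** * Measurability and dilation of integrals on row vectors *)

Section measurability_rV.
Context {R : realType} {N : nat}.
Local Notation RB := (measurableTypeR R).
Local Notation mu := (@lebesgue_tuple R N).
Implicit Types (D U : set 'rV[R]_N) (f g : 'rV[R]_N -> R).

Definition pre D : set (N.-tuple RB) := @rV_of_tuple R N @^-1` D.

Lemma measurable_ball_rV (x : 'rV[R]_N) (e : R) : 0 < e -> measurable (pre (ball x e)).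
Proof.
move=> e0.
rewrite (_ : pre _ = \bigcap_(i in [set: 'I_N])
    ((fun t : N.-tuple RB => tnth t i) @^-1` ball (x 0 i) e)); last first.
  apply/seteqP; split => t /=; rewrite /pre /= /ball/=.
    by move=> [_ H] i _; have := H 0 i; rewrite mxE.
  by move=> H; split => // i j; rewrite mxE (ord1 i); exact: H.
apply: fin_bigcap_measurable; first exact: finite_finset.
move=> i _; rewrite -[X in measurable X]setTI.
by apply: (@measurable_tnth _ RB N i measurableT); exact: measurable_ball.
Qed.

Definition ratball (p : {ffun 'I_N -> rat} * nat) : set 'rV[R]_N :=
  ball (\row_i ratr (p.1 i) : 'rV[R]_N) (p.2.+1%:R^-1 : R).

(** An open set is the union of the balls with rational centre and radius [1/(k+1)] that it
    contains. [F] enumerates these through [unpickle], with the empty set for every other code. *)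
Lemma open_measurable_rV U : open U -> measurable (pre U).
Proof.
move=> oU.
pose F (n : nat) : set 'rV[R]_N :=
  if unpickle n is Some p then (if asbool (ratball p `<=` U) then ratball p else set0) else set0.
rewrite (_ : pre U = \bigcup_n pre (F n)).
  apply: bigcupT_measurable => n; rewrite /F.
  case: unpickle => [p|]; last by rewrite /pre preimage_set0.
  case: asboolP => _; last by rewrite /pre preimage_set0.
  by apply: measurable_ball_rV; rewrite invr_gt0.
apply/seteqP; split => t /=; last first.
  move=> [n _]; rewrite /pre /F /=; case: unpickle => // p.
  by case: asboolP => // pU; exact: pU.
rewrite /pre/=; set x := rV_of_tuple t => Ux.
have /nbhs_ballP[r /= r0 rU] := open_nbhs_nbhs (conj oU Ux).
have r20 : 0 < r / 2 by rewrite divr_gt0.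
have [k _ /(_ k (leqnn k))/= kr] := near_infty_natSinv_lt (PosNum r20).
have k0 : 0 < k.+1%:R^-1 :> R by rewrite invr_gt0.
have [q Hq] : exists q : {ffun 'I_N -> rat}, forall i, ratr (q i) \in `]x 0 i - k.+1%:R^-1, x 0 i + k.+1%:R^-1[.
  have H i : exists q : rat, ratr q \in `]x 0 i - k.+1%:R^-1, x 0 i + k.+1%:R^-1[.
    by apply: rat_in_itvoo; rewrite ltrD2l gtrN.
  exists [ffun i => sval (cid (H i))] => i; rewrite ffunE; exact: svalP (cid (H i)).
have xq : ratball (q, k) x.
  split => // i j; rewrite (ord1 i) mxE /ball/=.
  by have := Hq j; rewrite in_itv/= ltr_distl.
exists (pickle (q, k)) => //; rewrite /F pickleK.
case: asboolP => // -[]; apply: (subset_trans _ rU) => y /= qy.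
have := ball_triangle (ball_sym xq) qy; apply: le_ball => /=.
rewrite (splitr r); apply: lerD; exact: ltW.
Qed.

Lemma closed_measurable_rV D : closed D -> measurable (pre D).
Proof.
move=> cD; rewrite (_ : pre D = ~` (pre (~` D))); last first.
  by apply/seteqP; split => t; rewrite /pre /= => H; [exact|exact: contrapT].
by apply: measurableC; apply: open_measurable_rV; exact: closed_openC.
Qed.

Definition mfun_rV D f := measurable_fun (pre D) (f \o @rV_of_tuple R N).

Lemma continuous_mfun_rV U f : open U -> (forall x, U x -> {for x, continuous f}) ->
  mfun_rV U f.
Proof.
move=> oU cf; apply: (measurability _ (RGenOpens.measurableE R)).
move=> _ [_ [a [b ->] <-]].
rewrite (_ : _ `&` _ = pre (U `&` f @^-1` `]a, b[)); last by [].
apply: open_measurable_rV; rewrite openE => x [Ux /= fx].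
apply: filterI; first exact: open_nbhs_nbhs.
by apply: (cf x Ux); apply: open_nbhs_nbhs; split => //; exact: interval_open.
Qed.

Lemma measurable_pre_bounded D (r : R) : (forall x, D x -> `|x| <= r) -> measurable (pre D) ->
  (mu (pre D) < +oo)%E.
Proof.
move=> Dr mD.
pose B := [set t : N.-tuple RB | forall i : 'I_N, `[- r, r]%classic (tnth t i)].
have mB : measurable B.
  rewrite (_ : B = \bigcap_(i in [set: 'I_N])
    ((fun t : N.-tuple RB => tnth t i) @^-1` `[- r, r]%classic)); last first.
    by apply/seteqP; split => t /= H i; [move=> _; exact: H|exact: H].
  apply: fin_bigcap_measurable; first exact: finite_finset.
  move=> i _; rewrite -[X in measurable X]setTI.
  by apply: (@measurable_tnth _ RB N i measurableT); exact: measurable_itv.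
apply: (@le_lt_trans _ _ (mu B)).
  apply: le_measure; rewrite ?inE// => t Dt i /=.
  rewrite in_itv/= -ler_norml; apply: le_trans (Dr _ Dt).
  by have := normrV_coord (rV_of_tuple t) i; rewrite mxE.
rewrite /B (@lebesgue_tuple_box R N (fun=> `[- r, r]%classic))// -(@fineK _ (\prod_(i < N) _)%E) ?ltry//.
apply: prode_fin_num => i _; rewrite lebesgue_measure_itv/=.
by case: ifP => _ //; rewrite -EFinD.
Qed.

Lemma open_measure_gt0 U : open U -> U !=set0 -> (0 < mu (pre U))%E.
Proof.
move=> oU [x Ux]; have /nbhs_ballP[r /= r0 rU] := open_nbhs_nbhs (conj oU Ux).
pose B := [set t : N.-tuple RB | forall i : 'I_N, (ball (x 0 i) r) (tnth t i)].
have BE : B = pre (ball x r).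
  apply/seteqP; split => t; rewrite /pre /= /B /=.
    by move=> H; split => // i j; rewrite (ord1 i) mxE; exact: H.
  by move=> [_ H] i; have := H 0 i; rewrite mxE.
have mB : measurable B by rewrite BE; exact: measurable_ball_rV.
apply: (@lt_le_trans _ _ (mu B)); last first.
  apply: le_measure; rewrite ?inE//; first exact: open_measurable_rV.
  by rewrite BE => t; apply: rU.
rewrite /B (@lebesgue_tuple_box R N (fun i => ball (x 0 i) r)); last by move=> i; exact: measurable_ball.
rewrite (eq_bigr (fun=> (r *+ 2)%:E)); last by move=> i _; rewrite lebesgue_measure_ball// ltW.
rewrite prodEFin lte_fin; apply: prodr_gt0 => i _.
by rewrite pmulrn_lgt0.
Qed.

Lemma rV_of_dil (c : R) (t : N.-tuple RB) : rV_of_tuple (dil c t) = c *: rV_of_tuple t.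
Proof. by apply/rowP => i; rewrite !mxE tnth_map. Qed.

Lemma measure_dilation (c : R) D : 0 < c -> measurable (pre D) ->
  mu (pre [set x | D (c *: x)]) = ((c ^- N)%:E * mu (pre D))%E.
Proof.
move=> c0 mD; rewrite -lebesgue_dil//; congr (lebesgue_tuple N _).
by apply/seteqP; split => t; rewrite /pre /= rV_of_dil.
Qed.

Lemma mfun_dilation f (c : R) : mfun_rV setT f -> mfun_rV setT (fun x => f (c *: x)).
Proof.
move=> mf; rewrite /mfun_rV.
rewrite (_ : _ \o _ = (f \o @rV_of_tuple R N) \o @dil R N c); last first.
  by apply/funext => t /=; rewrite rV_of_dil.
by apply: measurableT_comp; [exact: mf|exact: measurable_dil].
Qed.

Lemma integral_dilation f (c : R) : 0 < c -> mfun_rV setT f ->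
  mu.-integrable setT (EFin \o f \o @rV_of_tuple R N) ->
  mu.-integrable setT (EFin \o (fun x => f (c *: x)) \o @rV_of_tuple R N) ->
  integral_rV setT (fun x => f (c *: x)) = c ^- N * integral_rV setT f.
Proof.
move=> c0 mf intf intfc; rewrite /integral_rV /Rintegral.
have cn0 : 0 <= c ^- N by rewrite invr_ge0 exprn_ge0// ltW.
pose F : N.-tuple RB -> \bar R := EFin \o f \o @rV_of_tuple R N.
have mF : measurable_fun setT F by apply/measurable_EFinP.
have E : (\int[mu]_t (F \o dil c) t = (c ^- N)%:E * \int[mu]_t F t)%E.
  have intFc : mu.-integrable setT (F \o dil c).
    move: intfc; congr (integrable _ _ _); apply/funext => t /=.
    by rewrite /F/= rV_of_dil.
  rewrite -(integral_pushforward (@measurable_dil R N c) (f := F) (D := setT))//.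
  rewrite (@eq_measure_integral _ _ _ _ (mscale (NngNum cn0) (lebesgue_tuple N)))//; last first.
    by move=> A mA _; rewrite /= /mscale /= -lebesgue_dil.
  (* The rescaling of the measure is applied to the positive and negative parts separately;
     finiteness of the negative part allows recombining them. *)
  rewrite integralE [in RHS]integralE.
  rewrite !ge0_integral_mscale//=; last 2 first.
  - exact: measurable_funeneg.
  - exact: measurable_funepos.
  have : (\int[mu]_x F^\- x)%E \is a fin_num by exact: integrable_neg_fin_num.
  move: (\int[mu]_x F^\+ x)%E (\int[mu]_x F^\- x)%E => u v v_fin.
  by rewrite muleBr// fin_num_adde_defl// fin_numN.
transitivity (fine (\int[mu]_t (F \o dil c) t)).
  congr (fine _); apply: eq_integral => t _ /=.
  by rewrite /F/= rV_of_dil.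
rewrite E fineM//.
exact: integrable_fin_num.
Qed.

End measurability_rV.

(** * The anisotropic norm and its flux *)

Section dot_lemmas.
Context {R : realType} {N : nat}.
Implicit Types x y z : 'rV[R]_N.

Lemma dotC x y : dot x y = dot y x.
Proof. by apply: eq_bigr => i _; rewrite mulrC. Qed.

Lemma dotDr x y z : dot x (y + z) = dot x y + dot x z.
Proof. by rewrite /dot -big_split; apply: eq_bigr => i _; rewrite mxE mulrDr. Qed.

Lemma dotZr a x y : dot x (a *: y) = a * dot x y.
Proof. by rewrite /dot mulr_sumr; apply: eq_bigr => i _; rewrite mxE mulrCA. Qed.

Lemma dotNr x y : dot x (- y) = - dot x y.
Proof. by rewrite -scaleN1r dotZr mulN1r. Qed.

Lemma dotBr x y z : dot x (y - z) = dot x y - dot x z.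
Proof. by rewrite dotDr dotNr. Qed.

Lemma dotZl a x y : dot (a *: x) y = a * dot x y.
Proof. by rewrite dotC dotZr dotC. Qed.

Lemma dotr0 x : dot x 0 = 0.
Proof. by rewrite /dot big1// => i _; rewrite mxE mulr0. Qed.

Lemma dot0r x : dot 0 x = 0.
Proof. by rewrite dotC dotr0. Qed.

Lemma dot_delta x i : dot x (delta_mx 0 i) = x 0 i.
Proof.
rewrite /dot (bigD1 i)//= mxE !eqxx mulr1 big1 ?addr0// => j ji.
by rewrite mxE (negbTE ji) andbF mulr0.
Qed.

Lemma norm_dot_le x y : `|dot x y| <= (\sum_i `|x 0 i|) * `|y|.
Proof.
rewrite (le_trans (ler_norm_sum _ _ _))// mulr_suml ler_sum// => i _.
by rewrite normrM ler_wpM2l// normrV_coord.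
Qed.

Lemma near0_norm_lt (V : normedModType R) (r : R) : 0 < r -> \forall t \near (0 : V), `|t| < r.
Proof.
by move=> r0; apply/nbhs_ballP; exists r => //= y; rewrite -ball_normE/= sub0r normrN.
Qed.

Lemma near_neq0 x : x != 0 -> \forall z \near x, z != 0.
Proof.
move=> x0; apply/nbhs_ballP; exists `|x| => /=; first by rewrite normr_gt0.
move=> z; rewrite -ball_normE/=; apply: contraTneq => ->.
by rewrite subr0 ltxx.
Qed.

Lemma near0R_lt (r : R) : 0 < r -> \forall t \near (0 : R), `|t| < r.
Proof. exact: (@near0_norm_lt R^o). Qed.

Lemma is_derive_along0 (f : 'rV[R]_N -> R) x v : differentiable f x ->
  is_derive (0 : R) 1 (fun t : R => f (x + t *: v)) (dot (grad f x) v).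
Proof. by have := @is_derive_along _ _ f x v 0; rewrite scale0r addr0. Qed.

Lemma continuous_at_dist (T : topologicalType) (f : T -> R) (x : T) :
  (forall e : R, 0 < e -> \forall z \near x, `|f x - f z| < e) -> {for x, continuous f}.
Proof. by move=> h; apply/cvgrPdist_lt. Qed.

Lemma continuous_at_distP (T : topologicalType) (f : T -> R) (x : T) (e : R) :
  {for x, continuous f} -> 0 < e -> \forall z \near x, `|f x - f z| < e.
Proof. by move=> /cvgrPdist_lt h; exact: h. Qed.

Lemma near_eq_continuous (T : topologicalType) (f g : T -> R) (x : T) :
  (\forall z \near x, f z = g z) -> {for x, continuous f} -> {for x, continuous g}.
Proof.
move=> fg fx; have fgx := nbhs_singleton fg.
apply: continuous_at_dist => e e0; have := continuous_at_distP fx e0.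
by rewrite fgx; apply: filterS2 fg => z ->.
Qed.

Lemma near_line_neq0 x y : x != 0 -> \forall t \near (0 : R), x + t *: y != 0.
Proof.
move=> x0; have y1 : 0 < `|y| + 1 by rewrite ltr_wpDl.
have r0 : 0 < `|x| / (`|y| + 1) by rewrite divr_gt0// normr_gt0.
near=> t; have t1 : `|t| < `|x| / (`|y| + 1) by near: t; exact: near0R_lt.
apply/eqP => E; have : `|x| <= `|t| * (`|y| + 1).
  have -> : x = - (t *: y) by apply/eqP; rewrite -addr_eq0 E.
  by rewrite normrN normrZ ler_wpM2l// lerDl.
by apply/negP; rewrite -ltNge -ltr_pdivlMr.
Unshelve. all: by end_near. Qed.

Lemma is_derive_unique (f : R -> R) (t a b : R) : is_derive t 1 f a -> is_derive t 1 f b -> a = b.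
Proof. by move=> [_ <-] [_ <-]. Qed.

(** Used with [c = s] for [H], homogeneous of degree one, and with [c = 1] for its partial
    derivatives, of degree zero. *)
Lemma grad_homogeneous (f : 'rV[R]_N -> R) x v (s c : R) : 0 < s ->
  differentiable f x -> differentiable f (s *: x) ->
  (\forall t \near (0 : R), f (s *: (x + t *: v)) = c * f (x + t *: v)) ->
  s * dot (grad f (s *: x)) v = c * dot (grad f x) v.
Proof.
move=> s0 dx dsx H.
have Dx : is_derive (0 : R) 1 (fun t : R => f (x + t *: v)) (dot (grad f x) v).
  exact: is_derive_along0.
have Dsx : is_derive (0 : R) 1 (fun t : R => f (s *: x + t *: v)) (dot (grad f (s *: x)) v).
  exact: is_derive_along0.
have A : is_derive (0 : R) 1 (fun t : R => f (s *: (x + t *: v))) (s * dot (grad f (s *: x)) v).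
  have Dsx' : is_derive (s * 0 + 0) 1 (fun t : R => f (s *: x + t *: v)) (dot (grad f (s *: x)) v).
    by rewrite mulr0 addr0.
  have := is_derive_comp_affine Dsx'.
  rewrite (_ : (fun y : R => f (s *: x + (s * y + 0) *: v)) = (fun t : R => f (s *: (x + t *: v))))//.
  by apply/funext => t; rewrite addr0 scalerDr scalerA.
apply: (is_derive_unique A).
have H' : \forall t \near (0 : R), c * f (x + t *: v) = f (s *: (x + t *: v)).
  by apply: filterS H => t ->.
have D := is_derive_mul (is_derive_const c 0) Dx.
have := near_eq_is_derive H' D; by rewrite mul0r add0r.
Qed.

End dot_lemmas.

Section norm_H.
Context {R : realType} {N : nat} (hN : (0 < N)%N).
Variable H : 'rV[R]_N -> R.
Hypothesis hH : hypH H.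
Implicit Types xi zeta v w : 'rV[R]_N.

Let H_diff xi : xi != 0 -> differentiable H xi.
Proof. by case: hH => -[b _ [dH _]] _ _ _ /eqP x0; exact: dH. Qed.

Let dH_diff i xi : xi != 0 -> differentiable (partial i H) xi.
Proof. by case: hH => -[b _ [_ /(_ i)[dH _]]] _ _ _ /eqP x0; exact: dH. Qed.

Lemma exists_neq0 : exists xi : 'rV[R]_N, xi != 0.
Proof.
exists (delta_mx 0 (Ordinal hN)); apply/eqP => /rowP/(_ (Ordinal hN)).
by rewrite !mxE !eqxx => /eqP; rewrite oner_eq0.
Qed.

(** Homogeneity is assumed at nonzero vectors only, so the value is read off from [s = 0] at one of
    them, which exists as [N > 0]. *)
Lemma H0 : H 0 = 0.
Proof.
have [xi x0] := exists_neq0; case: hH => _ _ /(_ xi 0 x0) + _.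
by rewrite scale0r normr0 mul0r.
Qed.

Lemma H_hom xi (s : R) : H (s *: xi) = `|s| * H xi.
Proof.
have [->|x0] := eqVneq xi 0; first by rewrite scaler0 H0 mulr0.
by case: hH => _ _ /(_ xi s x0).
Qed.

Lemma H_gt0 xi : xi != 0 -> 0 < H xi.
Proof. by move=> x0; case: hH => _ + _ _; apply. Qed.

Lemma H_ge0 xi : 0 <= H xi.
Proof. by have [->|/H_gt0/ltW//] := eqVneq xi 0; rewrite H0. Qed.

(** Euler's identity: along its own ray [H] is an affine function of [t] near 0, with slope
    [H xi]. *)
Lemma H_euler xi : xi != 0 -> dot (grad H xi) xi = H xi.
Proof.
move=> x0; have D : is_derive (0 : R) 1 (fun t : R => H (xi + t *: xi)) (dot (grad H xi) xi).
  by apply: is_derive_along0; exact: H_diff.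
apply: (is_derive_unique D).
have E : \forall t \near (0 : R), H xi * t + H xi = H (xi + t *: xi).
  near=> t; have t1 : `|t| < 1 by near: t; exact: near0R_lt.
  have -> : xi + t *: xi = (1 + t) *: xi by rewrite scalerDl scale1r.
  rewrite H_hom ger0_norm; first by ring.
  by move: t1; rewrite ltr_norml => /andP[? ?]; lra.
apply: (near_eq_is_derive E); exact: is_derive_affine.
Unshelve. all: by end_near. Qed.

Lemma partial_H_hom i xi (s : R) : 0 < s -> xi != 0 ->
  partial i H (s *: xi) = partial i H xi.
Proof.
move=> s0 x0; have sx0 : s *: xi != 0 by rewrite scaler_eq0 negb_or gt_eqF.
have := @grad_homogeneous _ _ H xi (delta_mx 0 i) s s s0 (H_diff x0) (H_diff sx0).
rewrite !dot_delta !mxE => E; apply: (mulfI (lt0r_neq0 s0)); apply: E.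
by near=> t; rewrite H_hom gtr0_norm.
Unshelve. all: by end_near. Qed.

Definition hessform xi v w : R := \sum_i v 0 i * dot (grad (partial i H) xi) w.

Lemma hessformE xi v : hessform xi v v = dot (v *m (hess H xi)^T) v.
Proof.
rewrite /dot; apply: eq_bigr => i _; rewrite mulrC mxE; congr (_ * _).
by apply: eq_bigr => j _; rewrite !mxE mulrC.
Qed.

Lemma hessform_linear xi v v' w w' a b :
  hessform xi (v + a *: v') (w + b *: w') =
  hessform xi v w + b * hessform xi v w' + a * hessform xi v' (w + b *: w').
Proof.
rewrite /hessform !mulr_sumr -!big_split/=; apply: eq_bigr => i _.
by rewrite !mxE !dotDr !dotZr; ring.
Qed.

(** The partial derivatives of [H] are constant along the ray through [xi]. *)
Lemma hessform_r xi v : xi != 0 -> hessform xi v xi = 0.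
Proof.
move=> x0; rewrite /hessform big1// => i _.
suff -> : dot (grad (partial i H) xi) xi = 0 by rewrite mulr0.
have D : is_derive (0 : R) 1 (fun t : R => partial i H (xi + t *: xi)) (dot (grad (partial i H) xi) xi).
  by apply: is_derive_along0; exact: dH_diff.
apply: (is_derive_unique D).
have E : \forall t \near (0 : R), (fun=> partial i H xi) t = partial i H (xi + t *: xi).
  near=> t; have t1 : `|t| < 1 by near: t; exact: near0R_lt.
  have -> : xi + t *: xi = (1 + t) *: xi by rewrite scalerDl scale1r.
  rewrite partial_H_hom//.
  by move: t1; rewrite ltr_norml => /andP[? ?]; lra.
apply: (near_eq_is_derive E); exact: is_derive_const.
Unshelve. all: by end_near. Qed.

(** Euler's identity is differentiated in the direction [v]: the terms [v 0 i * partial i H xi]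
    cancel against the derivative of [H]. *)
Lemma hessform_l xi v : xi != 0 -> hessform xi xi v = 0.
Proof.
move=> x0.
have D : is_derive (0 : R) 1 (fun t : R => H (xi + t *: v)) (dot (grad H xi) v).
  by apply: is_derive_along0; exact: H_diff.
have Di i : is_derive (0 : R) 1 (fun t : R => partial i H (xi + t *: v)) (dot (grad (partial i H) xi) v).
  by apply: is_derive_along0; exact: dH_diff.
pose g i (t : R) := (v 0 i * t + xi 0 i) * partial i H (xi + t *: v).
have Dg : is_derive (0 : R) 1 (\sum_i g i)
    (\sum_i (v 0 i * partial i H xi + xi 0 i * dot (grad (partial i H) xi) v)).
  apply: is_derive_sum => i.
  have := is_derive_mul (is_derive_affine (v 0 i) (xi 0 i) 0) (Di i).
  move=> Q; apply: (is_derive_eq Q).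
  by rewrite scale0r addr0 mulr0 add0r.
have E : \forall t \near (0 : R), H (xi + t *: v) = (\sum_i g i) t.
  have := near_line_neq0 v x0; apply: filterS => t xt.
  rewrite -(H_euler xt) fct_sumE; apply: eq_bigr => i _.
  by rewrite /g !mxE mulrC [t * _]mulrC [xi _ _ + _]addrC.
have := is_derive_unique (near_eq_is_derive E D) Dg.
rewrite big_split/= -/(hessform xi xi v) => /eqP.
rewrite -subr_eq0 opprD addrA subr_eq0 => /eqP <-; apply/eqP.
rewrite subr_eq0 dotC; apply/eqP; apply: eq_bigr => i _; rewrite mxE//.
Qed.

(** Ellipticity is assumed on a topological boundary, while rescaling only produces [H xi = 1].
    Along the ray [H (s *: xi) = s] takes values on both sides of 1 arbitrarily close to [xi]. *)
Lemma bdry_level xi : H xi = 1 -> bdry [set z | H z < 1] xi.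
Proof.
move=> H1; have x0 : xi != 0 by apply/eqP => E; move: H1; rewrite E H0 => /eqP; rewrite eq_sym oner_eq0.
have xp : 0 < `|xi| by rewrite normr_gt0.
have P (s : R) : `|s - 1| < 1 -> H (s *: xi) = s.
  by rewrite ltr_norml => /andP[? ?]; rewrite H_hom H1 mulr1 ger0_norm//; lra.
have Q (e : R) (s : R) : 0 < e -> `|s - 1| < e / `|xi| -> ball xi e (s *: xi).
  move=> e0; rewrite ltr_pdivlMr// => se.
  rewrite -ball_normE/= -[X in X - _]scale1r -scalerBl normrZ distrC.
  exact: se.
have mid (e : R) : 0 < e -> exists2 d : R, 0 < d & d < 1 /\ d < e.
  move=> e0; exists (Num.min (1/2) (e/2)); first by rewrite lt_min; apply/andP; split; lra.
  by rewrite !gt_min; split; apply/orP; [left|right]; lra.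
split.
  move=> A /nbhs_ballP[e /= e0 eA].
  have [d d0 [d1 de]] := mid _ (divr_gt0 e0 xp).
  have B : `|(1 - d) - 1| = d by rewrite addrAC subrr add0r normrN gtr0_norm.
  exists ((1 - d) *: xi); split; last by apply/eA/Q => //; rewrite B.
  by rewrite /= P ?B//; lra.
move=> /nbhs_ballP[e /= e0 eA].
have [d d0 [d1 de]] := mid _ (divr_gt0 e0 xp).
have B : `|(1 + d) - 1| = d by rewrite addrAC subrr add0r gtr0_norm.
have /= := eA ((1 + d) *: xi) _; rewrite P ?B// => /(_ _)/wrap[].
  by apply: Q => //; rewrite B.
by lra.
Qed.

(* [xi] lies in the kernel of the Hessian, so only the component of [w] tangent
   to the level set of [H] contributes, and ellipticity applies to that one. *)
Lemma hessform_ge0 xi w : xi != 0 -> 0 <= hessform xi w w.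
Proof.
move=> x0; have Hx := H_gt0 x0.
pose s := (H xi)^-1; have s0 : 0 < s by rewrite invr_gt0.
pose z := s *: xi; have z0 : z != 0 by rewrite scaler_eq0 negb_or gt_eqF.
have Hz : H z = 1 by rewrite H_hom gtr0_norm// mulVf// gt_eqF.
have -> : hessform xi w w = s * hessform z w w.
  rewrite /hessform mulr_sumr; apply: eq_bigr => i _; rewrite mulrCA; congr (_ * _).
  have := @grad_homogeneous _ _ (partial i H) xi w s 1 s0 (dH_diff i x0) (dH_diff i z0).
  rewrite mul1r => -> //.
  by have := near_line_neq0 w x0; apply: filterS => t xt; rewrite mul1r partial_H_hom.
apply: mulr_ge0; first exact: ltW.
case: hH => _ _ _ [L L0 HL].
(* By Euler's identity [grad H z] pairs with [z] to 1, so this [a] makes [v] orthogonal to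
   [grad H z]. *)
pose a := dot (grad H z) w; pose v := w - a *: z.
have -> : w = v + a *: z by rewrite subrK.
rewrite hessform_linear hessform_r// mulr0 addr0 hessform_l// mulr0 addr0 hessformE.
apply: le_trans (HL z v (bdry_level Hz) _).
  by rewrite mulr_ge0 ?sqr_ge0// ltW.
by rewrite dotC dotBr dotZr H_euler// Hz mulr1 subrr.
Qed.

(* Convexity along the segment from [xi] to [zeta], which avoids the origin
   unless [zeta] is a nonpositive multiple of [xi]. *)
Lemma grad_H_le xi zeta : xi != 0 -> dot (grad H xi) zeta <= H zeta.
Proof.
move=> x0.
have [[c c0 E]|nE] := pselect (exists2 c : R, 0 <= c & zeta = - c *: xi).
  rewrite E dotZr H_euler// (le_trans _ (H_ge0 _))// mulNr oppr_le0.
  by rewrite mulr_ge0// H_ge0.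
pose w := zeta - xi.
have g0 (t : R) : 0 <= t -> t <= 1 -> xi + t *: w != 0.
  move=> t0 t1; apply/eqP => E.
  have tn0 : t != 0 by apply/eqP => t00; move: E x0; rewrite t00 scale0r addr0 => ->; rewrite eqxx.
  apply: nE; exists ((1 - t) / t); first by rewrite divr_ge0// subr_ge0.
  have E' : t *: zeta = - (1 - t) *: xi.
    apply/eqP; rewrite -subr_eq0; apply/eqP; rewrite -[RHS]E /w.
    by apply/rowP => i; rewrite !mxE; ring.
  by rewrite -[LHS](scalerK tn0) E' scalerA; congr (_ *: _); field.
pose h t := H (xi + t *: w).
pose h' t := dot (grad H (xi + t *: w)) w.
have dh (t : R) : 0 <= t -> t <= 1 -> is_derive t 1 h (h' t).
  by move=> t0 t1; apply: is_derive_along; apply: H_diff; exact: g0.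
have dh' (t : R) : 0 <= t -> t <= 1 -> is_derive t 1 h' (hessform (xi + t *: w) w w).
  move=> t0 t1.
  have -> : h' = \sum_i (fun t : R => w 0 i * partial i H (xi + t *: w)).
    apply/funext => s; rewrite fct_sumE /h' /dot; apply: eq_bigr => i _.
    by rewrite mxE mulrC.
  apply: is_derive_sum => i.
  have Di : is_derive t 1 (fun t : R => partial i H (xi + t *: w)) (dot (grad (partial i H) (xi + t *: w)) w).
    by apply: is_derive_along; apply: dH_diff; exact: g0.
  have Q := is_derive_mul (is_derive_const (w 0 i) t) Di.
  by apply: (is_derive_eq Q); rewrite mul0r add0r.
have ch (k k' : R -> R) (b : R) : b <= 1 -> (forall t : R, 0 <= t -> t <= 1 -> is_derive t 1 k (k' t)) ->
    {within `[0, b], continuous k}.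
  move=> b1 dk; apply: derivable_within_continuous => t; rewrite in_itv/= => /andP[t0 tb].
  by have [] := dk t t0 (le_trans tb b1).
have dhI (t : R) : t \in `]0, 1[ -> is_derive t 1 h (h' t).
  by rewrite in_itv/= => /andP[/ltW t0 /ltW t1]; exact: dh.
have [c] := MVT ltr01 dhI (ch _ _ _ (lexx _) dh).
(* The mean value theorem is used twice: [h 1 - h 0 = h' c], and [h' 0 <= h' c] because the
   derivative of [h'] is a Hessian value. As [h' 0] is [dot (grad H xi) zeta - H xi], the term
   [H xi] cancels. *)
rewrite in_itv/= => /andP[c0 c1]; rewrite subr0 mulr1 => Eh.
have dhI' (t : R) : t \in `]0, c[ -> is_derive t 1 h' (hessform (xi + t *: w) w w).
  by rewrite in_itv/= => /andP[/ltW t0 tc]; apply: dh' => //; exact: ltW (lt_trans tc c1).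
have [d] := MVT c0 dhI' (ch _ _ _ (ltW c1) dh').
rewrite in_itv/= => /andP[d0 dc]; rewrite subr0 => Eh'.
have hg : h' 0 <= h' c.
  rewrite -subr_ge0 Eh'; apply: mulr_ge0; last exact: ltW.
  by apply: hessform_ge0; apply: g0; [exact: ltW|exact: ltW (lt_trans dc c1)].
have h0E : h 0 = H xi by rewrite /h scale0r addr0.
have h1E : h 1 = H zeta by rewrite /h scale1r /w addrC subrK.
have h'0E : h' 0 = dot (grad H xi) zeta - H xi.
  by rewrite /h' scale0r addr0 /w dotBr H_euler.
by move: hg; rewrite -Eh h0E h1E h'0E lerD2r.
Qed.

Let K i := H (delta_mx 0 i).

(** [H] is even, so [grad_H_le] at the basis vector and at its opposite bounds the partial
    derivative from both sides. *)
Lemma partial_H_bound i xi : xi != 0 -> `|partial i H xi| <= K i.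
Proof.
move=> x0; have h1 := grad_H_le (delta_mx 0 i) x0.
have h2 := grad_H_le (- delta_mx 0 i) x0.
have E : - delta_mx 0 i = (-1) *: (delta_mx 0 i : 'rV[R]_N) by rewrite scaleN1r.
move: h1 h2; rewrite dotNr !dot_delta mxE E H_hom normrN1 mul1r => h1 h2.
by rewrite ler_norml; apply/andP; split => //; rewrite lerNl.
Qed.

(** Continuity of [H] at the origin, where no differentiability is assumed, rests on this bound. *)
Lemma H_le_norm xi : H xi <= (\sum_i K i) * `|xi|.
Proof.
have [->|x0] := eqVneq xi 0; first by rewrite H0 mulr_ge0// sumr_ge0// => i _; exact: H_ge0.
rewrite -(H_euler x0) (le_trans (ler_norm _))// (le_trans (norm_dot_le _ _))//.
rewrite ler_wpM2r// ler_sum// => i _; rewrite mxE; exact: partial_H_bound.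
Qed.

Lemma H_continuous : continuous H.
Proof.
move=> xi; have [->|x0] := eqVneq xi 0; last exact/differentiable_continuous/H_diff.
apply: continuous_at_dist => e e0; rewrite H0.
pose k := \sum_i K i + 1.
have k0 : 0 < k by rewrite ltr_wpDl// sumr_ge0// => i _; exact: H_ge0.
have ek : 0 < e / k by rewrite divr_gt0.
have Hn := @near0_norm_lt R 'rV[R]_N (e / k) ek.
near=> z; rewrite sub0r normrN ger0_norm ?H_ge0//.
have zk : `|z| < e / k by near: z; exact: Hn.
apply: le_lt_trans (H_le_norm _) _; move: zk; rewrite ltr_pdivlMr// mulrC; apply: le_lt_trans.
by rewrite /k mulrDl lerDl mulr_ge0.
Unshelve. all: by end_near. Qed.

Lemma powR_continuous (T : topologicalType) (f : T -> R) (q : R) x : 0 < q ->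
  (forall y, 0 <= f y) -> {for x, continuous f} ->
  {for x, continuous (fun y => f y `^ q)}.
Proof.
move=> q0 f0 fx; have := f0 x; rewrite le_eqVlt => /predU1P[fx0|fxp].
  apply: continuous_at_dist => e e0; rewrite -fx0 powR0 ?gt_eqF//.
  have d0 : 0 < e `^ q^-1 by rewrite powR_gt0.
  have := continuous_at_distP fx d0; rewrite -fx0; apply: filterS => y.
  rewrite !sub0r !normrN !ger0_norm ?powR_ge0// => yd.
  have -> : e = (e `^ q^-1) `^ q by rewrite -powRrM mulVf ?powRr1 ?gt_eqF// ltW.
  by apply: gt0_ltr_powR => //; rewrite nnegrE; [exact: f0|exact: ltW].
apply: (@continuous_comp _ _ _ f (fun u : R => u `^ q)) => //.
have [d _] := @is_derive1_powR _ q (f x) fxp.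
exact/differentiable_continuous/derivable1_diffP.
Qed.

Variable p : R.
Hypothesis hp : 1 < p.

Let p_gt0 : 0 < p. Proof. exact: lt_trans ltr01 hp. Qed.

Lemma Hp_continuous : continuous (fun xi => H xi `^ p).
Proof.
move=> xi; apply: powR_continuous; [exact: p_gt0|exact: H_ge0|exact: H_continuous].
Qed.

Lemma flux_bound i xi : `|flux p H xi 0 i| <= H xi `^ (p - 1) * K i.
Proof.
rewrite /flux; case: ifPn => [_|x0]; first by rewrite mxE normr0 mulr_ge0 ?powR_ge0 ?H_ge0.
by rewrite !mxE normrM ger0_norm ?powR_ge0// ler_wpM2l ?powR_ge0// partial_H_bound.
Qed.

(** Near the origin [grad H] is merely bounded; the factor [H^(p-1)] tends to 0 there because
    [p > 1]. *)
Lemma flux_continuous i : continuous (fun xi => flux p H xi 0 i).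
Proof.
have p1 : 0 < p - 1 by rewrite subr_gt0.
move=> xi; have [->|x0] := eqVneq xi 0.
  apply: continuous_at_dist => e e0; rewrite (_ : flux p H 0 0 i = 0); last by rewrite /flux eqxx mxE.
  have : {for (0 : 'rV[R]_N), continuous (fun xi => H xi `^ (p - 1) * K i)}.
    have C := powR_continuous p1 H_ge0 (@H_continuous (0 : 'rV[R]_N)).
    exact: cvgMl C.
  move=> /continuous_at_distP/(_ e0); rewrite H0 powR0 ?gt_eqF// mul0r.
  apply: filterS => z; rewrite !sub0r !normrN; apply: le_lt_trans.
  by rewrite (le_trans (flux_bound _ _))// ler_norm.
have Hn := near_neq0 x0.
have E : {near xi, (fun z => H z `^ (p - 1) * partial i H z) =1 (fun z => flux p H z 0 i)}.
  near=> z; have z0 : z != 0.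
    by near: z; exact: Hn.
  by rewrite /flux (negbTE z0) !mxE.
have C1 := powR_continuous p1 H_ge0 (@H_continuous xi).
have C2 := differentiable_continuous (dH_diff i x0).
exact: near_eq_continuous E (cvgM C1 C2).
Unshelve. all: by end_near. Qed.

Lemma flux_self xi : dot (flux p H xi) xi = H xi `^ p.
Proof.
rewrite /flux; case: ifPn => [/eqP ->|x0].
  by rewrite dot0r H0 powR0// gt_eqF.
rewrite dotZl H_euler// -[X in _ * X]powRr1 ?H_ge0// -powRD ?subrK//.
by rewrite (gt_eqF (H_gt0 x0)) implybT.
Qed.

(** [grad_H_le] bounds the left side by [H xi ^ (p-1) * H zeta]; then Young's inequality with
    exponents [p/(p-1)] and [p]. *)
Lemma flux_young xi zeta :
  dot (flux p H xi) zeta <= (1 - p^-1) * H xi `^ p + p^-1 * H zeta `^ p.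
Proof.
have p0 := p_gt0.
have pn0 : p != 0 by rewrite gt_eqF.
have p10 : p - 1 != 0 by rewrite gt_eqF// subr_gt0.
have q0 : 0 < p / (p - 1) by rewrite divr_gt0// subr_gt0.
have qE : (p / (p - 1))^-1 = 1 - p^-1 by rewrite invf_div mulrBl mulfV// mul1r.
apply: (@le_trans _ _ (H xi `^ (p - 1) * H zeta)).
  rewrite /flux; case: ifPn => [_|x0].
    by rewrite dot0r mulr_ge0 ?powR_ge0 ?H_ge0.
  by rewrite dotZl ler_wpM2l ?powR_ge0// grad_H_le.
have := @conjugate_powR _ (H xi `^ (p - 1)) (H zeta) _ _ (powR_ge0 _ _) (H_ge0 _) q0 p0.
rewrite qE subrK => /(_ erefl)/le_trans; apply.
rewrite -powRrM [(p - 1) * _]mulrC divfK// mulrC [X in _ + X]mulrC.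
by [].
Qed.

End norm_H.

(** * Strictly star-shaped domains *)

Section metric_facts.
Context {R : realType} {N : nat}.
Implicit Types (A U : set 'rV[R]_N) (x y : 'rV[R]_N).

Lemma nbhs_rVP x A : nbhs x A <-> exists2 r : R, 0 < r & forall y : 'rV[R]_N, `|y - x| < r -> A y.
Proof.
split=> [/nbhs_ballP[r /= r0 H]|[r r0 H]].
  by exists r => // y yx; apply: H; rewrite -ball_normE/= distrC.
by apply/nbhs_ballP; exists r => // y; rewrite -ball_normE/= distrC; exact: H.
Qed.

Lemma open_rV U x : open U -> U x -> exists2 r : R, 0 < r & forall y : 'rV[R]_N, `|y - x| < r -> U y.
Proof. by move=> oU Ux; apply/nbhs_rVP; exact: open_nbhs_nbhs. Qed.

Lemma closure_rVP A x : closure A x <-> forall e : R, 0 < e -> exists2 y : 'rV[R]_N, A y & `|y - x| < e.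
Proof.
split=> [cx e e0|H B /nbhs_rVP[r r0 rB]].
  have [|y [Ay ye]] := cx [set y : 'rV[R]_N | `|y - x| < e]; last by exists y.
  by apply/nbhs_rVP; exists e.
by have [y Ay yr] := H r r0; exists y; split => //; exact: rB.
Qed.

Lemma nclosure_rV A x : ~ closure A x -> exists2 r : R, 0 < r & forall y : 'rV[R]_N, `|y - x| < r -> ~ closure A y.
Proof.
move=> nx; apply: (@open_rV (~` closure A)) => //.
by apply: closed_openC; exact: closed_closure.
Qed.

Lemma compact_margin A U : compact A -> open U -> A `<=` U ->
  exists2 r : R, 0 < r & forall x y, A y -> `|x - y| <= r -> U x.
Proof.
move=> /compact_near_coveringP cA oU AU.
pose P (r : R) (y : 'rV[R]_N) := forall x : 'rV[R]_N, `|x - y| <= r -> U x.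
have : \forall r \near (0 : R)^'+, A `<=` P r.
  apply: cA => y Ay.
  have [r r0 rU] := open_rV oU (AU y Ay).
  have r20 : 0 < r / 2 by rewrite divr_gt0.
  exists ([set y' : 'rV[R]_N | `|y' - y| < r / 2], [set s : R | s < r / 2]).
    split; first by apply/nbhs_rVP; exists (r / 2).
    exact: nbhs_right_lt.
  move=> [y' s] [/= y'y sr] x xy'; apply: rU.
  rewrite -(subrK y' x) -addrA (le_lt_trans (ler_normD _ _))//.
  by rewrite (splitr r) ler_ltD// (le_trans xy')// ltW.
move=> nP; have gt0 : \forall r \near (0 : R)^'+, 0 < r by exact: nbhs_right_gt.
have [r [r0 rP]] := filter_ex (filterI gt0 nP).
by exists r => // x y Ay; exact: rP.
Qed.

End metric_facts.

Lemma cvg_dilation_ratio (R : realType) : (fun n : nat => 1 + n.+1%:R^-1 : R) @ \oo --> (1 : R).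
Proof.
by rewrite -[X in _ --> X](addr0 (1 : R)); apply: cvgD; [exact: cvg_cst|exact: cvg_harmonic].
Qed.

Lemma cvg_dilation_factor (R : realType) N : (fun n : nat => (1 + n.+1%:R^-1 : R) ^- N) @ \oo --> (1 : R).
Proof.
rewrite -[X in _ --> X]invr1; apply: cvgV; first exact: oner_neq0.
have := cvg_comp _ _ (@cvg_dilation_ratio R) (@exprn_continuous R N 1).
by rewrite expr1n.
Qed.

Section star_domain.
Context {R : realType} {N : nat}.
Variable Omega : set 'rV[R]_N.
Hypothesis hOmega : bounded_smooth_domain Omega.
Hypothesis hstar : strictly_star_shaped Omega.
Implicit Types x y : 'rV[R]_N.
Local Notation mu := (@lebesgue_tuple R N).

Lemma Omega_open : open Omega. Proof. by case: hOmega. Qed.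

Lemma Omega_star x (t : R) : Omega x -> 0 <= t -> t <= 1 -> Omega (t *: x).
Proof. by move=> Ox t0 t1; case: hstar => + _; apply => //; rewrite t0. Qed.

Lemma bdryE : bdry Omega = closure Omega `\` Omega.
Proof. by rewrite /bdry; move/interior_id : Omega_open => ->. Qed.

Lemma Omega_bounded : exists2 r : R, 0 < r & forall x, closure Omega x -> `|x| <= r.
Proof.
case: hOmega => _ _ _ [M [Mr HM]] _.
have HO x : Omega x -> `|x| <= `|M| + 1.
  by apply: HM; rewrite (le_lt_trans (ler_norm _))// ltrDl.
exists (`|M| + 2); first by rewrite ltr_wpDl.
move=> x /closure_rVP/(_ 1 ltr01)[y Oy yx].
have -> : x = y - (y - x) by rewrite opprB addrC subrK.
rewrite (le_trans (ler_normB _ _))//.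
have := HO y Oy; move: yx; lra.
Qed.

Lemma closure_compact : compact (closure Omega).
Proof.
have [r r0 Hr] := Omega_bounded.
apply: bounded_closed_compact; last exact: closed_closure.
exists r; split; first exact: num_real.
by move=> s rs x /Hr xr; exact: le_trans (ltW rs).
Qed.

(** Strictness says that the gradient of a defining function [rho] pairs positively with [x]. As
    [rho x <= 0], moving towards the origin makes [rho] negative to first order. *)
Lemma bdry_shrink x : bdry Omega x ->
  exists2 d : R, 0 < d & forall t : R, 0 < t -> t < d -> Omega ((1 - t) *: x).
Proof.
move=> bx; case: hOmega => _ _ _ _ /(_ x bx)[rho drho].
have [_ /(_ x ((enorm (grad rho x))^-1 *: grad rho x) bx)] := hstar.
have : unit_outward_normal Omega x ((enorm (grad rho x))^-1 *: grad rho x) by exists rho.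
move=> H /(_ H){H}; rewrite dotZr => g0.
have {}g0 : 0 < dot x (grad rho x).
  rewrite ltNge; apply/negP => g1; move: g0; rewrite ltNge => /negP; apply.
  by rewrite mulr_ge0_le0// invr_ge0 sqrtr_ge0.
case: drho => U [oU Ux sm _ OU].
have drho : differentiable rho x by have [d _] := sm 1%N; exact: d.
(* Otherwise [rho] would be positive near [x], a limit of points of [Omega], where [rho < 0]. *)
have rx : rho x <= 0.
  rewrite leNgt; apply/negP => rx.
  have [s s0 Hs] : exists2 s : R, 0 < s & forall y : 'rV[R]_N, `|y - x| < s -> U y /\ 0 < rho y.
    apply/nbhs_rVP; apply: filterI; first exact: open_nbhs_nbhs.
    have := continuous_at_distP (differentiable_continuous drho) rx.
    by apply: filterS => y; rewrite ltr_distlC subrr => /andP[].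
  move: bx => [/closure_rVP/(_ s s0)[y Oy ys] _].
  have [Uy] := Hs y ys; apply/negP; rewrite -leNgt ltW//.
  by have : (Omega `&` U) y by []; rewrite OU => -[].
have [s1 s10 Hs1] := open_rV oU Ux.
have x1 : 0 < `|x| + 1 by rewrite ltr_wpDl.
(* With this [e] the error [e * t * |x|] stays below the first-order decrease
   [t * dot x (grad rho x)]. *)
pose e := dot x (grad rho x) / (`|x| + 1).
have e0 : 0 < e by rewrite divr_gt0.
have [s2 s20 Hs2] := differentiable_has_grad drho e0.
exists (Num.min (s1 / (`|x| + 1)) (s2 / (`|x| + 1))).
  by rewrite lt_min !divr_gt0.
move=> t t0; rewrite lt_min => /andP[t1 t2].
have E : (1 - t) *: x - x = - (t *: x) by rewrite scalerBl scale1r addrAC subrr add0r.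
have nE : `|(1 - t) *: x - x| = t * `|x| by rewrite E normrN normrZ gtr0_norm.
have tx : t * `|x| < t * (`|x| + 1) by rewrite ltr_pM2l// ltrDl.
have Uy : U ((1 - t) *: x).
  by apply: Hs1; rewrite nE (lt_trans tx)// -ltr_pdivlMr.
suff : (Omega `&` U) ((1 - t) *: x) by case.
rewrite OU; split => //.
have := Hs2 ((1 - t) *: x); rewrite nE => /(_ _)/wrap[].
  by rewrite ltW// (lt_trans tx)// -ltr_pdivlMr.
rewrite ler_norml => /andP[_]; rewrite E dotNr dotZr dotC opprK => h.
have : e * (t * `|x|) < t * dot x (grad rho x).
  rewrite mulrCA ltr_pM2l// /e mulrAC ltr_pdivrMr// ltr_pM2l// ltrDl//.
by lra.
Qed.

(** Since [t < 1], there is room to push a boundary point slightly inside by a factor [1 - s] first,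
    and to cover the remaining factor [t / (1 - s) <= 1] by star-shapedness. *)
Lemma closure_star x (t : R) : closure Omega x -> 0 <= t -> t < 1 -> Omega (t *: x).
Proof.
move=> cx t0 t1; have [Ox|nOx] := pselect (Omega x); first by apply: Omega_star => //; exact: ltW.
have [|d d0 Hd] := @bdry_shrink x; first by rewrite bdryE.
pose s := Num.min (1 - t) (d / 2) / 2.
have m0 : 0 < Num.min (1 - t) (d / 2) by rewrite lt_min subr_gt0 t1 divr_gt0.
have s0 : 0 < s by rewrite divr_gt0.
have s2 : s < Num.min (1 - t) (d / 2) by rewrite ltr_pdivrMr//; lra.
move: (s2); rewrite lt_min => /andP[st sd].
have s1 : 0 < 1 - s by lra.
have Os := Hd s s0 (_ : s < d).
have -> : t *: x = (t / (1 - s)) *: ((1 - s) *: x).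
  by rewrite scalerA divfK// gt_eqF.
apply: Omega_star; first by apply: Os; lra.
  by rewrite divr_ge0// ltW.
by rewrite ler_pdivrMr//; lra.
Qed.

(** This puts the support of the dilated function inside [Omega]. *)
Lemma dilate_closure x (c : R) : 1 < c -> closure Omega (c *: x) -> Omega x.
Proof.
move=> c1 cx; have c0 : 0 < c by lra.
rewrite -(scalerK (lt0r_neq0 c0) x); apply: closure_star => //.
  by rewrite invr_ge0 ltW.
by rewrite invf_lt1.
Qed.

Lemma measurable_Omega : measurable (pre Omega).
Proof. by apply: open_measurable_rV; exact: Omega_open. Qed.

Lemma measurable_closure : measurable (pre (closure Omega)).
Proof. by apply: closed_measurable_rV; exact: closed_closure. Qed.

Lemma closure_finite : (mu (pre (closure Omega)) < +oo)%E.
Proof.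
have [r _ Hr] := Omega_bounded.
exact: measurable_pre_bounded Hr measurable_closure.
Qed.

Lemma Omega_finite : (mu (pre Omega) < +oo)%E.
Proof.
apply: le_lt_trans closure_finite; apply: le_measure; rewrite ?inE//.
- exact: measurable_Omega.
- exact: measurable_closure.
- by move=> t; exact: subset_closure.
Qed.

(* A shrunken copy of the closure lies in [Omega]. *)
Lemma closure_measure : mu (pre (closure Omega)) = mu (pre Omega).
Proof.
apply/eqP; rewrite eq_le; apply/andP; split; last first.
  apply: le_measure; rewrite ?inE//.
  - exact: measurable_Omega.
  - exact: measurable_closure.
  - by move=> t; exact: subset_closure.
have H (n : nat) : (mu (pre (closure Omega)) * ((1 + n.+1%:R^-1) ^- N)%:E <= mu (pre Omega))%E.
  pose c : R := 1 + n.+1%:R^-1.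
  have c1 : 1 < c by rewrite ltrDl invr_gt0.
  have c0 : 0 < c by lra.
  rewrite muleC -measure_dilation//; last exact: measurable_closure.
  apply: le_measure; rewrite ?inE; last by move=> t; exact: dilate_closure.
    rewrite (_ : pre _ = dil c @^-1` pre (closure Omega)); last first.
      by apply/seteqP; split => t; rewrite /pre/= rV_of_dil.
    rewrite -[X in measurable X]setTI; apply: (@measurable_dil R N c) => //.
    exact: measurable_closure.
  exact: measurable_Omega.
have m_fin : mu (pre (closure Omega)) \is a fin_num by rewrite ge0_fin_numE// closure_finite.
have w_fin : mu (pre Omega) \is a fin_num by rewrite ge0_fin_numE// Omega_finite.
move: H; rewrite -(fineK m_fin) -(fineK w_fin).
move: (fine _) (fine _) => w m H; rewrite lee_fin.
have C : (fun n : nat => m * (1 + n.+1%:R^-1) ^- N) @ \oo --> m.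
  rewrite -[X in _ --> X]mulr1; apply: cvgMr; exact: cvg_dilation_factor.
rewrite -(cvg_lim _ C)//; apply: limr_le; first by apply/cvg_ex; exists m.
by near=> n; have := H n; rewrite -EFinM lee_fin.
Unshelve. all: by end_near. Qed.

Lemma measurable_bdry : measurable (pre (bdry Omega)).
Proof.
rewrite bdryE (_ : pre _ = pre (closure Omega) `\` pre Omega)//.
by apply: measurableD; [exact: measurable_closure|exact: measurable_Omega].
Qed.

(** The boundary is the exceptional set of [ubar_has_grad]; being null, it is invisible to dominated
    convergence. *)
Lemma bdry_null : mu (pre (bdry Omega)) = 0%E.
Proof.
rewrite bdryE (_ : pre _ = pre (closure Omega) `\` pre Omega)//.
rewrite measureD//; last 3 first.
- exact: measurable_closure.
- exact: measurable_Omega.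
- exact: closure_finite.
rewrite (_ : _ `&` _ = pre Omega); last first.
  by apply/seteqP; split => [t []//|t Ot]; split => //; exact: subset_closure.
rewrite [LHS](_ : _ = mu (pre Omega) - mu (pre Omega))%E; last first.
  by congr (_ - _)%E; exact: closure_measure.
by rewrite subee// ge0_fin_numE// Omega_finite.
Qed.

(* [C] is the cone over a small ball around [x0]. *)
Lemma boundary_cone x0 (r : R) : bdry Omega x0 -> 0 < r ->
  exists (C : set 'rV[R]_N) (c0 : R),
  [/\ open C, Omega `&` C !=set0, forall (t : R) x, 0 < t -> C x -> C (t *: x), 1 < c0
    & forall x (c : R), Omega x -> C x -> 1 < c -> c < c0 -> ~ Omega (c *: x) -> `|x - x0| < r].
Proof.
rewrite bdryE => -[cx0 nx0] r0.
have X0 : 0 < `|x0| + 1 by rewrite ltr_wpDl.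
(* [h] is the radial and [d] the lateral half-width of a window around [x0]. The fractions [r / 8]
   keep both resulting displacements, [2 * d] and [2 * h * (|x0| + 1)], below [r / 4]. *)
pose h := Num.min (1 / 2) (r / (8 * (`|x0| + 1))).
have h0 : 0 < h by rewrite lt_min; apply/andP; split; [lra|rewrite divr_gt0// mulr_gt0].
have h12 : h <= 1 / 2 by rewrite ge_min lexx.
have hr : h * (`|x0| + 1) <= r / 8.
  rewrite -ler_pdivlMr// ge_min; apply/orP; right.
  by rewrite invfM mulrA.
have O1 : Omega ((1 - h) *: x0) by apply: closure_star => //; lra.
have O2 : ~ closure Omega ((1 + h) *: x0).
  move=> /dilate_closure H; apply: nx0; apply: H; lra.
have [d1 d10 Hd1] := open_rV Omega_open O1.
have [d2 d20 Hd2] := nclosure_rV O2.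
pose d := Num.min (r / 8) (Num.min (d1 / 2) (d2 / 2)).
have d0 : 0 < d by rewrite !lt_min !divr_gt0.
have dr : d <= r / 8 by rewrite ge_min lexx.
have dd1 : d <= d1 / 2 by rewrite !ge_min lexx !orbT.
have dd2 : d <= d2 / 2 by rewrite !ge_min lexx !orbT.
have B1 y : `|y - x0| < d -> Omega ((1 - h) *: y).
  move=> yx; apply: Hd1; rewrite -scalerBr normrZ ger0_norm; last by lra.
  by have := normr_ge0 (y - x0); nra.
have B2 y : `|y - x0| < d -> ~ Omega ((1 + h) *: y).
  move=> yx Oy; apply: (Hd2 ((1 + h) *: y)); last exact: subset_closure.
  rewrite -scalerBr normrZ ger0_norm; last by lra.
  by have := normr_ge0 (y - x0); nra.
pose C := [set x | exists2 s : R, 0 < s & `|s *: x - x0| < d].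
exists C, (1 + h); split.
- rewrite openE => x [s s0 sx]; apply/nbhs_rVP.
  exists ((d - `|s *: x - x0|) / s); first by rewrite divr_gt0// subr_gt0.
  move=> y; rewrite ltr_pdivlMr// => yx; exists s => //.
  have -> : s *: y - x0 = s *: (y - x) + (s *: x - x0) by rewrite scalerBr addrA subrK.
  rewrite (le_lt_trans (ler_normD _ _))// normrZ gtr0_norm// mulrC.
  by move: yx; lra.
- exists ((1 - h) *: x0); split => //; exists (1 - h)^-1; first by rewrite invr_gt0; lra.
  by rewrite scalerK ?subrr ?normr0// gt_eqF//; lra.
- move=> t x t0 [s s0 sx]; exists (s / t); first by rewrite divr_gt0.
  by rewrite scalerA divfK// gt_eqF.
- by rewrite ltrDl.
- move=> x c Ox [s s0 sx] c1 ch nOx.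
  have [y yE] : exists y, y = s *: x by exists (s *: x).
  have [t tE] : exists t, t = s^-1 by exists s^-1.
  have t0 : 0 < t by rewrite tE invr_gt0.
  have xE : x = t *: y by rewrite yE tE scalerK// gt_eqF.
  rewrite -yE in sx.
  (* Write [x = t *: y] with [y] close to [x0]. Membership of [x] in [Omega] bounds [t] above; as
     [c *: x] has left [Omega], [c * t > 1 - h], and [c < 1 + h] then gives [t > 1 - 2 * h]. *)
  have th : t < 1 + h.
    rewrite ltNge; apply/negP => ht; apply: (B2 y) => //.
    have -> : (1 + h) *: y = ((1 + h) / t) *: x by rewrite xE scalerA divfK// gt_eqF.
    apply: Omega_star => //; first by rewrite divr_ge0// ?ltW//; lra.
    by rewrite ler_pdivrMr// mul1r.
  have tc : 1 - h < c * t.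
    rewrite ltNge; apply/negP => ht; apply: nOx.
    have -> : c *: x = (c * t / (1 - h)) *: ((1 - h) *: y).
      by rewrite xE !scalerA divfK// gt_eqF//; lra.
    apply: Omega_star; first exact: B1.
      by rewrite divr_ge0// ?mulr_ge0//; lra.
    by rewrite ler_pdivrMr ?mul1r//; lra.
  have t1 : 1 - 2 * h < t by nra.
  have -> : x - x0 = t *: (y - x0) + (t - 1) *: x0.
    by rewrite {1}xE scalerBr scalerBl scale1r addrA subrK.
  rewrite (le_lt_trans (ler_normD _ _))// !normrZ gtr0_norm//.
  have n1 : `|t - 1| <= 2 * h by rewrite ler_norml; apply/andP; split; lra.
  have yd : `|y - x0| < d by [].
  have A1 : t * `|y - x0| <= 2 * d.
    by have := normr_ge0 (y - x0); nra.
  have A2 : `|t - 1| * `|x0| <= 2 * (h * (`|x0| + 1)).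
    by have := normr_ge0 x0; have := normr_ge0 (t - 1); nra.
  by lra.
Qed.

End star_domain.

(** * Extension by zero *)

Section lipschitz_line.
Context {R : realType}.
Implicit Types (h : R -> R) (a b L : R).

Lemma mvt_bound h a b L : a <= b -> continuous h ->
  (forall t : R, a < t -> t < b -> exists2 d : R, is_derive t 1 h d & `|d| <= L) ->
  `|h b - h a| <= L * (b - a).
Proof.
rewrite le_eqVlt => /predU1P[-> _ _|ab ch dh]; first by rewrite !subrr normr0 mulr0.
have dh' (t : R) : t \in `]a, b[ -> is_derive t 1 h (derive1 h t).
  rewrite in_itv/= => /andP[at_ tb]; have [d hd _] := dh t at_ tb.
  by apply: DeriveDef; [have [] := hd|rewrite derive1E].
have [c] := MVT ab dh' (continuous_subspaceT ch).
rewrite in_itv/= => /andP[ac cb] ->.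
rewrite normrM (ger0_norm (_ : 0 <= b - a)); last by rewrite subr_ge0 ltW.
rewrite ler_wpM2r//; first by rewrite subr_ge0 ltW.
by have [d [_ hd] dL] := dh c ac cb; rewrite derive1E hd.
Qed.

(* No differentiability is required at the zeros of [h]: the bound is applied
   before the first and after the last of them. *)
Lemma lipschitz_off_zeros h a b L : a <= b -> 0 <= L -> continuous h ->
  (forall t : R, h t != 0 -> exists2 d : R, is_derive t 1 h d & `|d| <= L) ->
  `|h b - h a| <= L * (b - a).
Proof.
move=> ab L0 ch dh.
have [[z [za zb hz]]|nz] := pselect (exists z : R, [/\ a <= z, z <= b & h z = 0]); last first.
  apply: mvt_bound => // t at_ tb; apply: dh; apply/eqP => ht.
  by apply: nz; exists t; split => //; exact: ltW.
pose Z := `[a, b] `&` h @^-1` [set 0].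
have cZ : compact Z.
  apply: (@subclosed_compact _ _ `[a, b]); last 2 first.
  - exact: segment_compact.
  - by move=> x [].
  apply: closedI; first exact: itv_closed.
  apply: (@closed_comp _ _ h [set 0]) => [x _|]; first exact: ch.
  rewrite (_ : [set 0] = [set x : R | x = 0]); first exact: closed_eq.
  by apply/seteqP; split.
have Z0 : Z !=set0 by exists z; split => //=; rewrite in_itv/= za.
have cid : {within Z, continuous (fun x : R => x)}.
  by apply: continuous_subspaceT => x; exact: cvg_id.
have [M /set_mem[/= MI hM] Mmax] := compact_EVT_max Z0 cZ cid.
have [m /set_mem[/= mI hm] mmin] := compact_EVT_min Z0 cZ cid.
move: MI mI; rewrite !in_itv/= => /andP[aM Mb] /andP[am mb].
have inZ t : a <= t -> t <= b -> h t = 0 -> m <= t /\ t <= M.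
  move=> at_ tb ht; have tZ : t \in Z by rewrite inE; split => //=; rewrite in_itv/= at_.
  by split; [exact: mmin|exact: Mmax].
have mM : m <= M by have [] := inZ m am mb hm.
have B1 : `|h m - h a| <= L * (m - a).
  apply: mvt_bound => // t at_ tm; apply: dh; apply/eqP => ht.
  have [] := inZ t (ltW at_) (le_trans (ltW tm) mb) ht.
  by rewrite leNgt tm.
have B2 : `|h b - h M| <= L * (b - M).
  apply: mvt_bound => // t tM tb; apply: dh; apply/eqP => ht.
  have [_] := inZ t (le_trans aM (ltW tM)) (ltW tb) ht.
  by rewrite leNgt tM.
move: B1 B2; rewrite hm hM sub0r subr0 normrN => B1 B2.
rewrite (le_trans (ler_normB _ _))//.
have : L * (m - a) + L * (b - M) <= L * (b - a).
  by rewrite -mulrDr ler_wpM2l//; lra.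
by lra.
Qed.

End lipschitz_line.

Section has_grad_lemmas.
Context {R : realType} {N : nat}.
Implicit Types (f g : 'rV[R]_N -> R) (x a : 'rV[R]_N).

Lemma has_grad_near f g x a : (\forall z \near x, f z = g z) -> has_grad f x a -> has_grad g x a.
Proof.
move=> fg hf e e0; have fgx := nbhs_singleton fg.
have [r1 r10 H1] := (nbhs_rVP _ _).1 fg.
have [r2 r20 H2] := hf e e0.
exists (Num.min (r1 / 2) r2); first by rewrite lt_min divr_gt0.
move=> y; rewrite le_min => /andP[y1 y2].
have E : f y = g y by apply: H1; rewrite (le_lt_trans y1)// ltr_pdivrMr//; lra.
by have := H2 y y2; rewrite fgx E.
Qed.

Lemma has_grad_cst x (c : R) : has_grad (fun=> c) x 0.
Proof.
move=> e e0; exists 1 => // y _.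
by rewrite dot0r subrr subr0 normr0 mulr_ge0// ltW.
Qed.

Lemma has_grad_dilation f x a (c : R) : 0 < c -> has_grad f (c *: x) a ->
  has_grad (fun z => f (c *: z)) x (c *: a).
Proof.
move=> c0 hf e e0; have ec : 0 < e / c by rewrite divr_gt0.
have [r r0 H] := hf _ ec; exists (r / c); first by rewrite divr_gt0.
move=> y; rewrite ler_pdivlMr// => yx.
have E : `|c *: y - c *: x| = c * `|y - x| by rewrite -scalerBr normrZ gtr0_norm.
have := H (c *: y); rewrite E mulrC => /(_ yx).
rewrite -scalerBr dotZr dotZl; have -> // : e / c * (`|y - x| * c) = e * `|y - x|.
by field; rewrite gt_eqF.
Qed.

Lemma within_dist (V : normedModType R) (A : set 'rV[R]_N) (f : 'rV[R]_N -> V) x :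
  {within A, continuous f} -> A x -> forall e : R, 0 < e ->
  exists2 r : R, 0 < r & forall y, A y -> `|y - x| < r -> `|f x - f y| < e.
Proof.
move=> /subspace_continuousP/(_ x) cf Ax e e0.
have /cvgrPdist_lt/(_ e e0) := cf Ax.
by move=> /nbhs_rVP[r r0 H]; exists r => // y Ay yr; exact: H.
Qed.

Lemma compact_image_bounded (V : normedModType R) (A : set 'rV[R]_N) (f : 'rV[R]_N -> V) :
  compact A -> {within A, continuous f} ->
  exists2 M : R, 0 < M & forall x, A x -> `|f x| <= M.
Proof.
move=> cA cf; have [M [Mr HM]] := compact_bounded (continuous_compact cf cA).
exists (`|M| + 1); first by rewrite ltr_wpDl.
move=> x Ax; apply: (HM (`|M| + 1)); last by exists x.
by rewrite (le_lt_trans (ler_norm _))// ltrDl.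
Qed.

End has_grad_lemmas.

Section extension_by_zero.
Context {R : realType} {N : nat}.
Variable Omega : set 'rV[R]_N.
Hypothesis hOmega : bounded_smooth_domain Omega.
Variables (u : 'rV[R]_N -> R) (Du : 'rV[R]_N -> 'rV[R]_N).
Hypothesis hC1 : C1_closure Omega u Du.
Hypothesis hu0 : forall x, bdry Omega x -> u x = 0.
Implicit Types x y z : 'rV[R]_N.

Let oO := Omega_open hOmega.

Lemma u_differentiable x : Omega x -> differentiable u x.
Proof. by case: hC1 => -[du _] _ _ _; exact: du. Qed.

Lemma gradu_continuous x i : Omega x -> {for x, continuous (fun z => grad u z 0 i)}.
Proof.
move=> Ox; case: hC1 => -[_ /(_ i) cu] _ _ _.
have -> : (fun z => grad u z 0 i) = partial i u by apply/funext => z; rewrite mxE.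
exact: cu.
Qed.

Definition ubar : 'rV[R]_N -> R := u \_ Omega.

(** The gradient of [ubar] off the boundary; the value 0 on the boundary is a convention on a null
    set. *)
Definition Dubar x : 'rV[R]_N := if x \in Omega then grad u x else 0.

Lemma ubar_in x : Omega x -> ubar x = u x.
Proof. by move=> Ox; rewrite /ubar patchE mem_set. Qed.

Lemma ubar_out x : ~ Omega x -> ubar x = 0.
Proof. by move=> Ox; rewrite /ubar patchE memNset. Qed.

Lemma Dubar_in x : Omega x -> Dubar x = grad u x.
Proof. by move=> Ox; rewrite /Dubar mem_set. Qed.

Lemma Dubar_out x : ~ Omega x -> Dubar x = 0.
Proof. by move=> Ox; rewrite /Dubar memNset. Qed.

Lemma near_Omega x : Omega x -> \forall z \near x, u z = ubar z.
Proof.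
move=> Ox; have : nbhs x Omega by exact: open_nbhs_nbhs.
by apply: filterS => z Oz; rewrite ubar_in.
Qed.

Lemma near_nclosure x : ~ closure Omega x -> \forall z \near x, (fun=> 0) z = ubar z.
Proof.
move=> nx; have [r r0 H] := nclosure_rV nx; apply/nbhs_rVP; exists r => // z /H nz.
by rewrite ubar_out// => Oz; apply: nz; exact: subset_closure.
Qed.

Lemma ubar_continuous : continuous ubar.
Proof.
move=> x; have [Ox|nOx] := pselect (Omega x).
  exact: near_eq_continuous (near_Omega Ox) (differentiable_continuous (u_differentiable Ox)).
have [cx|ncx] := pselect (closure Omega x); last first.
  by apply: near_eq_continuous (near_nclosure ncx) _; exact: cst_continuous.
have ux : u x = 0 by apply: hu0; rewrite bdryE.
apply: continuous_at_dist => e e0; rewrite ubar_out//.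
case: hC1 => _ cu _ _; have [r r0 H] := within_dist cu cx e0.
apply/nbhs_rVP; exists r => // y yx.
have [Oy|nOy] := pselect (Omega y); last by rewrite ubar_out// subrr normr0.
by rewrite ubar_in// -ux; apply: H => //; exact: subset_closure.
Qed.

Lemma ubar_has_grad x : ~ bdry Omega x -> has_grad ubar x (Dubar x).
Proof.
rewrite bdryE// => nb; have [Ox|nOx] := pselect (Omega x).
  rewrite Dubar_in//; apply: has_grad_near (near_Omega Ox) _.
  exact/differentiable_has_grad/u_differentiable.
rewrite Dubar_out//; apply: has_grad_near (near_nclosure _) (has_grad_cst _ _).
by move=> cx; exact: nb.
Qed.

Lemma gradu_bounded : exists2 M : R, 0 < M & forall x, Omega x -> `|grad u x| <= M.
Proof.
case: hC1 => _ _ cD DE.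
have [M M0 H] := compact_image_bounded (closure_compact hOmega) cD.
by exists M => // x Ox; rewrite -DE//; apply: H; exact: subset_closure.
Qed.

Lemma u_bounded : exists2 M : R, 0 < M & forall x, Omega x -> `|u x| <= M.
Proof.
case: hC1 => _ cu _ _.
have [M M0 H] := compact_image_bounded (closure_compact hOmega) cu.
by exists M => // x Ox; apply: H; exact: subset_closure.
Qed.

(** A segment between two points may leave [Omega] and return, so the mean value theorem is replaced
    by [lipschitz_off_zeros]: where [ubar] is nonzero the point is in [Omega] and the gradient is
    bounded. The factor [N] comes from pairing in the sup norm. *)
Lemma ubar_lipschitz : exists2 L : R, 0 <= L & forall x y, `|ubar x - ubar y| <= L * `|x - y|.
Proof.
have [M M0 HM] := gradu_bounded; exists (N%:R * M); first by rewrite mulr_ge0// ltW.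
move=> x y; pose w := x - y; pose h (t : R) := ubar (y + t *: w).
have ch : continuous h.
  move=> t; apply: (@continuous_comp _ _ _ (fun t : R => y + t *: w) ubar); last exact: ubar_continuous.
  by apply: cvgD; [exact: cvg_cst|apply: cvgZl; exact: cvg_id].
have := @lipschitz_off_zeros _ h 0 1 (N%:R * M * `|x - y|) ler01 _ ch _.
have h1 : h 1 = ubar x by rewrite /h scale1r /w addrC subrK.
have h0 : h 0 = ubar y by rewrite /h scale0r addr0.
rewrite h1 h0 subr0 mulr1; apply.
  by rewrite !mulr_ge0// ltW.
move=> t ht; have Ot : Omega (y + t *: w).
  by apply: contrapT => nO; move/eqP: ht; apply; rewrite /h ubar_out.
exists (dot (grad u (y + t *: w)) w); last first.
  rewrite (le_trans (norm_dot_le _ _))// ler_wpM2r//.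
  rewrite (le_trans (_ : _ <= \sum_(i < N) M))//.
    by apply: ler_sum => i _; rewrite (le_trans (normrV_coord _ _))// HM.
  by rewrite sumr_const card_ord -[X in X <= _]mulr_natl.
apply: near_eq_is_derive (is_derive_along (u_differentiable Ot)).
have [r r0 H] := open_rV oO Ot.
have w1 : 0 < `|w| + 1 by rewrite ltr_wpDl.
have rw : 0 < r / (`|w| + 1) by rewrite divr_gt0.
near=> s; rewrite /h ubar_in//; apply: H.
have -> : y + s *: w - (y + t *: w) = (s - t) *: w.
  by rewrite opprD addrACA subrr add0r scalerBl.
have st : `|t - s| < r / (`|w| + 1).
  by near: s; apply/nbhs_ballP; exists (r / (`|w| + 1)).
rewrite normrZ distrC; move: st; rewrite ltr_pdivlMr//; apply: le_lt_trans.
by rewrite ler_wpM2l// lerDl.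
Unshelve. all: by end_near. Qed.

End extension_by_zero.

(** * Integration over the domain *)

Lemma continuous_norm_bounded {R : realType} (M : R) (h : R -> R) : continuous h ->
  exists K : R, forall t, `|t| <= M -> `|h t| <= K.
Proof.
move=> ch; have M0 : - `|M| <= `|M| by rewrite -subr_ge0 opprK addr_ge0.
have chn : {within `[- `|M|, `|M|], continuous (fun t => `|h t|)}.
  by apply: continuous_subspaceT => t; apply: cvg_norm; exact: ch.
have [c _ Hc] := EVT_max M0 chn.
exists `|h c| => t tM; apply: Hc; rewrite in_itv/= -ler_norml.
by rewrite (le_trans tM)// ler_norm.
Qed.

Section integral_Omega.
Context {R : realType} {N : nat}.
Variable Omega : set 'rV[R]_N.
Hypothesis hOmega : bounded_smooth_domain Omega.
Hypothesis hstar : strictly_star_shaped Omega.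
Implicit Types (f g : 'rV[R]_N -> R) (x y : 'rV[R]_N).
Local Notation mu := (@lebesgue_tuple R N).
Local Notation I := (@integral_rV R N Omega).

Let mO : measurable (pre Omega) := measurable_Omega hOmega.

(** On a set of finite measure this implies integrability and, unlike integrability, it is closed
    under products. *)
Definition tame f := mfun_rV Omega f /\ exists M : R, forall x, Omega x -> `|f x| <= M.

Lemma tame_integrable f : tame f ->
  mu.-integrable (pre Omega) (EFin \o (f \o @rV_of_tuple R N)).
Proof.
move=> [mf [M fM]]; apply: measurable_bounded_integrable => //.
  exact: (Omega_finite hOmega).
exists M; split; first exact: num_real.
by move=> s Ms t Ot /=; rewrite (le_trans (fM _ Ot))// ltW.
Qed.

Lemma tame_continuous f (M : R) : (forall x, Omega x -> {for x, continuous f}) ->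
  (forall x, Omega x -> `|f x| <= M) -> tame f.
Proof.
move=> cf fM; split; last by exists M.
by apply: continuous_mfun_rV => //; exact: (Omega_open hOmega).
Qed.

Lemma tame_ext f g : (forall x, Omega x -> f x = g x) -> tame f -> tame g.
Proof.
move=> fg [mf [M fM]]; split; last by exists M => x Ox; rewrite -fg// fM.
apply: eq_measurable_fun mf => t; rewrite inE => Ot /=; exact: fg.
Qed.

Lemma tame_cst (c : R) : tame (fun=> c).
Proof. by split; [exact: measurable_cst|exists `|c|]. Qed.

Lemma tameD f g : tame f -> tame g -> tame (fun x => f x + g x).
Proof.
move=> [mf [M fM]] [mg [K gK]]; split; first exact: measurable_funD mf mg.
exists (M + K) => x Ox; rewrite (le_trans (ler_normD _ _))//.
by apply: lerD; [exact: fM|exact: gK].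
Qed.

Lemma tameM f g : tame f -> tame g -> tame (fun x => f x * g x).
Proof.
move=> [mf [M fM]] [mg [K gK]]; split; first exact: measurable_funM mf mg.
by exists (M * K) => x Ox; rewrite normrM ler_pM// ?fM ?gK.
Qed.

Lemma tameZ (c : R) f : tame f -> tame (fun x => c * f x).
Proof. by move=> tf; apply: tameM tf; exact: tame_cst. Qed.

Lemma tameB f g : tame f -> tame g -> tame (fun x => f x - g x).
Proof.
move=> tf tg; apply: (tame_ext (f := fun x => f x + (-1) * g x)).
  by move=> x _; rewrite mulN1r.
by apply: tameD => //; exact: tameZ.
Qed.

Lemma tame_sum (F : 'I_N -> 'rV[R]_N -> R) : (forall i, tame (F i)) ->
  tame (fun x => \sum_i F i x).
Proof.
move=> tF; elim: (index_enum _) => [|i s IH].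
  by apply: tame_ext (tame_cst 0) => x _; rewrite big_nil.
by apply: tame_ext (tameD (tF i) IH) => x _; rewrite big_cons.
Qed.

Lemma tame_dot (F G : 'rV[R]_N -> 'rV[R]_N) : (forall i, tame (fun x => F x 0 i)) ->
  (forall i, tame (fun x => G x 0 i)) -> tame (fun x => dot (F x) (G x)).
Proof. by move=> tF tG; apply: tame_sum => i; exact: tameM. Qed.

Lemma tame_comp (h : R -> R) f : continuous h -> tame f -> tame (fun x => h (f x)).
Proof.
move=> ch [mf [M fM]]; split.
  apply: (@measurableT_comp _ _ _ _ _ _ h) mf.
  exact: continuous_measurable_fun.
by have [K HK] := continuous_norm_bounded M ch; exists K => x Ox; apply: HK; exact: fM.
Qed.

Lemma integral_ext f g : (forall x, Omega x -> f x = g x) -> I f = I g.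
Proof. by move=> fg; apply: eq_Rintegral => t; rewrite inE => Ot /=; exact: fg. Qed.

Lemma integralD_rV f g : tame f -> tame g -> I (fun x => f x + g x) = I f + I g.
Proof. by move=> /tame_integrable tf /tame_integrable tg; exact: RintegralD. Qed.

Lemma integralB_rV f g : tame f -> tame g -> I (fun x => f x - g x) = I f - I g.
Proof. by move=> /tame_integrable tf /tame_integrable tg; exact: RintegralB. Qed.

Lemma integralZ_rV (c : R) f : tame f -> I (fun x => c * f x) = c * I f.
Proof. by move=> /tame_integrable tf; exact: RintegralZl. Qed.

Lemma le_integral_rV f g : tame f -> tame g -> (forall x, Omega x -> f x <= g x) -> I f <= I g.
Proof.
by move=> /tame_integrable tf /tame_integrable tg fg; apply: le_Rintegral => // t Ot; exact: fg.
Qed.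

Lemma integral_dominated_rV (F : nat -> 'rV[R]_N -> R) f (B : set 'rV[R]_N) (M : R) :
  (forall n, tame (F n)) -> tame f -> (forall n x, Omega x -> `|F n x| <= M) ->
  measurable (pre B) -> mu (pre B) = 0%E ->
  (forall x, Omega x -> ~ B x -> (fun n => F n x) @ \oo --> f x) ->
  (fun n => I (F n)) @ \oo --> I f.
Proof.
move=> tF tf FM mB B0 Ff.
have [|||||intf _] := @dominated_convergence _ _ _ mu (pre Omega) mO
  (fun n => EFin \o (F n \o @rV_of_tuple R N)) (EFin \o (f \o @rV_of_tuple R N)) (cst M%:E).
- by move=> n; apply/measurable_EFinP; have [] := tF n.
- by apply/measurable_EFinP; have [] := tf.
- exists (pre B); split => // t /= nt; apply: contrapT => nB; apply: nt => Ot.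
  by apply: cvg_EFin; [exact: nearW|exact: Ff].
- apply: (@measurable_bounded_integrable _ _ _ mu (cst M) (pre Omega) mO).
  + exact: (Omega_finite hOmega).
  + exact: measurable_cst.
  + exists `|M|; split; first exact: num_real.
    by move=> s Ms t _ /=; rewrite ltW.
- by apply: aeW => t n Ot /=; rewrite lee_fin; exact: FM.
rewrite -(fineK (integrable_fin_num mO intf)) => /fine_cvg.
exact.
Qed.

Lemma mfun_zero_outside f : (forall x, ~ Omega x -> f x = 0) -> mfun_rV Omega f -> mfun_rV setT f.
Proof.
move=> f0 mf; have /(measurable_restrictT _ mO) := mf.
rewrite /mfun_rV; apply: eq_measurable_fun => t _ /=; rewrite patchE.
by case: ifPn => // /negP nO; rewrite f0// => Ot; apply: nO; rewrite inE.
Qed.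

Lemma integral_zero_outside f : (forall x, ~ Omega x -> f x = 0) ->
  integral_rV setT f = I f.
Proof.
move=> f0; rewrite /integral_rV [RHS]Rintegral_mkcond preimage_setT.
apply: eq_Rintegral => t _ /=; rewrite patchE; case: ifPn => // /negP nO.
by rewrite f0// => Ot; apply: nO; rewrite inE.
Qed.

Lemma integrable_zero_outside f : (forall x, ~ Omega x -> f x = 0) -> tame f ->
  mu.-integrable setT (EFin \o f \o @rV_of_tuple R N).
Proof.
move=> f0 tf; have /(integrable_mkcond _ mO) := tame_integrable tf.
apply: eq_integrable => // t _ /=; rewrite patchE; case: ifPn => // /negP nO.
by rewrite f0// => Ot; apply: nO; rewrite inE.
Qed.

Lemma Omega_dilate (c : R) x : 1 < c -> Omega (c *: x) -> Omega x.
Proof.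
move=> c1 Ocx; apply: (dilate_closure hOmega hstar c1); exact: subset_closure.
Qed.

Lemma tame_dilation f (c : R) : 1 < c -> (forall x, ~ Omega x -> f x = 0) -> tame f ->
  tame (fun x => f (c *: x)).
Proof.
move=> c1 f0 [mf [M fM]]; split.
  apply: measurable_funTS; exact: mfun_dilation (mfun_zero_outside f0 mf).
exists `|M| => x _; have [Ocx|nO] := pselect (Omega (c *: x)).
  by rewrite (le_trans (fM _ Ocx))// ler_norm.
by rewrite f0// normr0.
Qed.

(** The dilation does not preserve [Omega], so the change of variables is made on the whole space.
    Both integrands vanish off [Omega], the dilated one because [c *: x] in [Omega] forces [x] in
    [Omega]. *)
Lemma integral_dilation_Omega f (c : R) : 1 < c -> (forall x, ~ Omega x -> f x = 0) -> tame f ->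
  I (fun x => f (c *: x)) = c ^- N * I f.
Proof.
move=> c1 f0 tf.
have fc0 x : ~ Omega x -> f (c *: x) = 0.
  by move=> nO; apply: f0 => /(Omega_dilate c1).
rewrite -!integral_zero_outside//.
apply: integral_dilation; first exact: lt_trans c1.
- by apply: mfun_zero_outside => //; case: tf.
- exact: integrable_zero_outside.
- exact: integrable_zero_outside (tame_dilation c1 f0 tf).
Qed.

End integral_Omega.

(** * The nonlinearity and its primitive *)

Section primitives.
Context {R : realType}.
Variable g : R -> R.
Hypothesis cg : continuous g.
Implicit Types (a b s t : R).
Local Notation leb := (@lebesgue_measure R).

Lemma continuous_integrable_itv a b : leb.-integrable `[a, b] (EFin \o g).
Proof.
apply: continuous_compact_integrable; first exact: segment_compact.
exact: continuous_subspaceT.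
Qed.

(** A base point [- A] to the left of [t] gives one formula for both signs of [t], as the
    fundamental theorem requires near 0. *)
Lemma primitive0E (A t : R) : 0 < A -> - A < t ->
  primitive0 g t = Rintegral leb `[- A, t] g - Rintegral leb `[- A, 0] g.
Proof.
move=> A0 At; rewrite /primitive0; case: ifPn => t0.
  rewrite Rintegral_itvB//; last 2 first.
  - exact: continuous_integrable_itv.
  - by rewrite bnd_simp lerNl oppr0 ltW.
  rewrite Rintegral_itv_obnd_cbnd//.
  apply: integrableS (continuous_integrable_itv 0 t) => //.
  by apply: subset_itvr; rewrite bnd_simp.
move: t0; rewrite -ltNge => t0; rewrite -opprB; congr (- _).
rewrite Rintegral_itvB//; last 3 first.
- exact: continuous_integrable_itv.
- by rewrite bnd_simp ltW.
- by rewrite bnd_simp ltW.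
rewrite Rintegral_itv_obnd_cbnd//.
apply: integrableS (continuous_integrable_itv t 0) => //.
by apply: subset_itvr; rewrite bnd_simp.
Qed.

Lemma is_derive_primitive0 t : is_derive t 1 (primitive0 g) (g t).
Proof.
pose A := `|t| + 1.
have A0 : 0 < A by rewrite ltr_wpDl.
have At : - A < t by have := ler_norm (- t); rewrite normrN /A; lra.
have cgt : {for t, continuous g} by exact: cg.
have [dF F'] := continuous_FTC1_closed (ltr_pwDr ltr01 (lexx t)) (continuous_integrable_itv (- A) (t + 1)) At cgt.
have D : is_derive t 1 (fun x => Rintegral leb `[- A, x] g) (g t).
  by apply: DeriveDef => //; rewrite -derive1E.
have D2 := is_derive_add D (is_derive_const (- Rintegral leb `[- A, 0] g) t).
rewrite addr0 in D2; apply: near_eq_is_derive D2.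
near=> s; rewrite (@primitive0E A)//.
by near: s; exact: lt_nbhsr.
Unshelve. all: by end_near. Qed.

Lemma primitive0_0 : primitive0 g 0 = 0.
Proof. by rewrite /primitive0 lexx set_itv1 Rintegral_set1. Qed.

Lemma primitive0_continuous : continuous (primitive0 g).
Proof.
move=> t; have [d _] := is_derive_primitive0 t.
exact/differentiable_continuous/derivable1_diffP.
Qed.

(** The function [G(s) - g(a) s] has derivative [g(s) - g(a)], so the mean value theorem needs only
    the oscillation of [g]. *)
Lemma primitive0_taylor a b (E : R) :
  (forall s, `|s - a| <= `|b - a| -> `|g s - g a| <= E) ->
  `|primitive0 g b - primitive0 g a - g a * (b - a)| <= E * `|b - a|.
Proof.
move=> gE; pose h (s : R) := primitive0 g s + (- g a) * s.
have hE s t : primitive0 g s - primitive0 g t - g a * (s - t) = h s - h t by rewrite /h; ring.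
have dh (s : R) : is_derive s 1 h (g s - g a).
  have := is_derive_add (is_derive_primitive0 s) (is_derive_affine (- g a) 0 s).
  by rewrite (_ : (fun y => _) = h)//; apply/funext => y; rewrite /h addr0.
have ch : continuous h.
  by move=> s; have [d _] := dh s; exact/differentiable_continuous/derivable1_diffP.
rewrite hE; have [ab|/ltW ba] := leP a b.
  rewrite (ger0_norm (_ : 0 <= b - a)) ?subr_ge0//.
  apply: mvt_bound => // s as_ sb; exists (g s - g a) => //; apply: gE.
  by rewrite !ger0_norm; lra.
rewrite distrC (distrC b) (ger0_norm (_ : 0 <= a - b)) ?subr_ge0//.
apply: mvt_bound => // s as_ sb; exists (g s - g a) => //; apply: gE.
by rewrite !ler0_norm; lra.
Qed.

End primitives.

Section limits.
Context {R : realType}.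

(** The derivative of [s^q] at 1, along the steps [1/(n+1)]; it provides the rates of [c^(p-N)] and
    of [c^-N]. *)
Lemma cvg_powR_diff (q : R) :
  (fun n : nat => n.+1%:R * ((1 + n.+1%:R^-1) `^ q - 1) : R) @ \oo --> q.
Proof.
have [D DE] := @is_derive1_powR R q 1 ltr01.
have C : (fun h : R => h^-1 *: (((fun s : R => s `^ q) \o shift 1) (h *: 1) - 1 `^ q)) @ 0^' -->
  'D_1 (fun s : R => s `^ q) (1 : R) := D.
rewrite DE powR1 mulr1 in C; have := cvg_comp (fun n : nat => n.+1%:R^-1 : R) _ _ C.
have H : (fun n : nat => n.+1%:R^-1 : R) @ \oo --> (0 : R)^'.
  move=> A [e /= e0 eA]; have := @cvg_harmonic R => /cvgr0Pnorm_lt/(_ e e0).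
  apply: filterS => n ne; apply: eA => /=; last by rewrite invr_eq0 pnatr_eq0.
  by rewrite sub0r normrN.
move=> /(_ _ H); apply: cvg_trans; apply: near_eq_cvg; apply: nearW => n /=.
by rewrite invrK /GRing.scale/= mulr1 (addrC 1).
Qed.

Lemma cvg_dot N (F G : nat -> 'rV[R]_N) (a b : 'rV[R]_N) :
  (forall i, (fun n => F n 0 i) @ \oo --> a 0 i) ->
  (forall i, (fun n => G n 0 i) @ \oo --> b 0 i) ->
  (fun n => dot (F n) (G n)) @ \oo --> dot a b.
Proof.
move=> Fa Gb; rewrite /dot; elim: (index_enum _) => [|i s IH].
  rewrite big_nil; under eq_fun do rewrite big_nil; exact: cvg_cst.
rewrite big_cons; under eq_fun do rewrite big_cons.
by apply: cvgD IH; apply: cvgM; [exact: Fa|exact: Gb].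
Qed.

End limits.

(** * The power nonlinearity and its primitive *)

Section power.
Context {R : realType}.
Variable m : R.
Hypothesis m0 : 0 < m.

Lemma power_nonlinearityE (t : R) : power_nonlinearity m t * t = `|t| `^ (m + 1).
Proof.
rewrite /power_nonlinearity; have [->|t0] := eqVneq t 0.
  by rewrite mulr0 normr0 powR0// gt_eqF// ltr_wpDl// ltW.
have n0 : `|t| != 0 by rewrite normr_eq0.
rewrite -mulrA -expr2 -real_normK ?num_real// -powR_mulrn// -powRD; last by rewrite n0 implybT.
by congr (_ `^ _); ring.
Qed.

Lemma power_nonlinearity_ge0 (t : R) : 0 <= t -> power_nonlinearity m t = t `^ m.
Proof.
rewrite le_eqVlt => /predU1P[<-|t0].
  by rewrite /power_nonlinearity mulr0 powR0// gt_eqF.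
rewrite /power_nonlinearity gtr0_norm// -[X in _ * X]powRr1 ?ltW// -powRD ?subrK//.
by rewrite gt_eqF// implybT.
Qed.

Lemma power_nonlinearityN (t : R) : power_nonlinearity m (- t) = - power_nonlinearity m t.
Proof. by rewrite /power_nonlinearity normrN mulrN. Qed.

Lemma power_nonlinearity_norm (t : R) : `|power_nonlinearity m t| = `|t| `^ m.
Proof.
rewrite /power_nonlinearity normrM ger0_norm ?powR_ge0//.
by have := power_nonlinearity_ge0 (normr_ge0 t); rewrite /power_nonlinearity normr_id.
Qed.

(** For [m < 1] the factor [|t|^(m-1)] blows up at 0; there continuity comes from the absolute value
    [|t|^m] of the product. *)
Lemma power_nonlinearity_continuous : continuous (@power_nonlinearity R m).
Proof.
move=> t; have [->|t0] := eqVneq t 0.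
  have p00 : power_nonlinearity m 0 = 0 by rewrite /power_nonlinearity mulr0.
  apply: continuous_at_dist => e e0; rewrite p00.
  have C : {for (0 : R), continuous (fun s : R => `|s| `^ m)}.
    by apply: powR_continuous => //; exact: norm_continuous.
  have := continuous_at_distP C e0; apply: filterS => s.
  by rewrite normr0 powR0 ?gt_eqF// !sub0r !normrN power_nonlinearity_norm ger0_norm ?powR_ge0.
apply: cvgM; last exact: cvg_id.
apply: (@continuous_comp _ _ _ (fun s : R => `|s|) (fun s : R => s `^ (m - 1))).
  exact: norm_continuous.
have n0 : 0 < `|t| by rewrite normr_gt0.
have [d _] := @is_derive1_powR _ (m - 1) `|t| n0.
exact/differentiable_continuous/derivable1_diffP.
Qed.

Let m1 : 0 < m + 1. Proof. by rewrite ltr_wpDl// ltW. Qed.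

(** At 0 the difference quotient has size [|h|^m / (m+1)], which tends to 0; negative [t] reduce to
    positive ones by symmetry. *)
Lemma is_derive_power (t : R) :
  is_derive t 1 (fun s : R => (m + 1)^-1 * `|s| `^ (m + 1)) (power_nonlinearity m t).
Proof.
have pos (s : R) : 0 < s -> is_derive s 1 (fun s : R => (m + 1)^-1 * s `^ (m + 1)) (s `^ m).
  move=> s0; have D := is_derive_mul (is_derive_const (m + 1)^-1 s) (is_derive1_powR (m + 1) s0).
  apply: (is_derive_eq D); rewrite mul0r add0r mulrA mulVf ?gt_eqF// mul1r.
  by congr (_ `^ _); ring.
have [t0|t0|->] := ltgtP t 0.
- have t0' : 0 < - t by rewrite oppr_gt0.
  have D' : is_derive (-1 * t + 0) 1 (fun s : R => (m + 1)^-1 * s `^ (m + 1)) ((- t) `^ m).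
    by rewrite mulN1r addr0; exact: pos.
  have D := is_derive_comp_affine D'.
  have E : power_nonlinearity m t = -1 * (- t) `^ m.
    by rewrite mulN1r -power_nonlinearity_ge0 ?ltW// power_nonlinearityN opprK.
  rewrite E; apply: near_eq_is_derive D; near=> s.
  have s0 : s < 0 by near: s; exact: lt_nbhsl.
  by rewrite mulN1r addr0 ltr0_norm.
- rewrite power_nonlinearity_ge0 ?ltW//; apply: near_eq_is_derive (pos t t0).
  near=> s; have s0 : 0 < s by near: s; exact: lt_nbhsr.
  by rewrite gtr0_norm.
- have -> : power_nonlinearity m 0 = 0 by rewrite /power_nonlinearity mulr0.
  have C0 : {for (0 : R), continuous (fun s : R => (m + 1)^-1 * `|s| `^ m)}.
    apply: cvgMr; apply: powR_continuous => //; exact: norm_continuous.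
  have lim0 : (fun h : R => h^-1 * ((m + 1)^-1 * `|h| `^ (m + 1))) @ 0^' --> (0 : R).
    apply/cvgr0Pnorm_lt => e e0; have := continuous_at_distP C0 e0.
    rewrite normr0 powR0 ?gt_eqF// mulr0 => H.
    have H' : \forall h \near (0 : R)^', `|0 - (m + 1)^-1 * `|h| `^ m| < e.
      by rewrite near_withinE; apply: filterS H.
    near=> h; have h0 : h != 0 by near: h; exact: nbhs_dnbhs_neq.
    have Hh : `|0 - (m + 1)^-1 * `|h| `^ m| < e by near: h; exact: H'.
    rewrite sub0r normrN in Hh; apply: le_lt_trans Hh.
    rewrite !normrM normfV mulrCA ler_wpM2l//.
    rewrite (ger0_norm (powR_ge0 _ _)) (ger0_norm (powR_ge0 _ _)) powRD ?powRr1//; last by rewrite normr_eq0 h0 implybT.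
    by rewrite mulrCA mulVf ?mulr1// normr_eq0.
  have E : (fun h : R => h^-1 *: (((fun s : R => (m + 1)^-1 * `|s| `^ (m + 1)) \o shift 0) (h *: 1) - (m + 1)^-1 * `|0 : R| `^ (m + 1)))
     = (fun h : R => h^-1 * ((m + 1)^-1 * `|h| `^ (m + 1))).
    apply/funext => h /=; rewrite addr0 /GRing.scale/= mulr1 normr0 powR0 ?gt_eqF//.
    by rewrite mulr0 subr0.
  by apply: DeriveDef; [apply/cvg_ex; exists 0|apply: cvg_lim => //]; rewrite E.
Unshelve. all: by end_near. Qed.

Lemma primitive0_power (t : R) : primitive0 (power_nonlinearity m) t = `|t| `^ (m + 1) / (m + 1).
Proof.
pose h (s : R) := primitive0 (power_nonlinearity m) s + -1 * ((m + 1)^-1 * `|s| `^ (m + 1)).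
have dh (s : R) : is_derive s 1 h 0.
  have D := is_derive_add (is_derive_primitive0 power_nonlinearity_continuous s)
    (is_derive_mul (is_derive_const (-1) s) (is_derive_power s)).
  by apply: (is_derive_eq D); rewrite mul0r add0r mulN1r subrr.
have ch : continuous h.
  by move=> s; have [d _] := dh s; exact/differentiable_continuous/derivable1_diffP.
have h0 : h 0 = 0.
  by rewrite /h primitive0_0 normr0 powR0 ?gt_eqF// !mulr0 addr0.
suff : h t = 0 by rewrite /h mulN1r mulrC => /eqP; rewrite subr_eq0 => /eqP.
have B (a b : R) : a <= b -> `|h b - h a| <= 0 * (b - a).
  by move=> ab; apply: mvt_bound => // s _ _; exists 0; [exact: dh|rewrite normr0].
have [t0|/ltW t0] := leP 0 t.
  by have := B 0 t t0; rewrite h0 mul0r subr0 normr_le0 => /eqP.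
by have := B t 0 t0; rewrite h0 mul0r sub0r normrN normr_le0 => /eqP.
Qed.

End power.

(** * The Pohozaev inequality *)

Section pohozaev.
Context {R : realType} {N : nat}.
Hypothesis hN : (0 < N)%N.
Variable p : R.
Hypothesis hp : 1 < p.
Variable H : 'rV[R]_N -> R.
Hypothesis hH : hypH H.
Variable Omega : set 'rV[R]_N.
Hypothesis hOmega : bounded_smooth_domain Omega.
Hypothesis hstar : strictly_star_shaped Omega.
Variable g : R -> R.
(** Continuity is what the power nonlinearity offers when [m < 1], so this form lets one section
    serve both parts of the theorem. *)
Hypothesis cg : continuous g.
Variables (u : 'rV[R]_N -> R) (Du : 'rV[R]_N -> 'rV[R]_N).
Hypothesis hC1 : C1_closure Omega u Du.
Hypothesis hweak : weak_solution p H g Omega u.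
Hypothesis hu0 : forall x, bdry Omega x -> u x = 0.
Implicit Types (x y : 'rV[R]_N).
Local Notation mu := (@lebesgue_tuple R N).
Local Notation I := (@integral_rV R N Omega).
Local Notation tame := (@tame R N Omega).
Local Notation ub := (ubar Omega u).
Local Notation Dub := (Dubar Omega u).
Local Notation fl x := (flux p H (grad u x)).
Local Notation Hp x := (H x `^ p).
Local Notation G := (primitive0 g).

Let p0 : 0 < p. Proof. exact: lt_trans ltr01 hp. Qed.

Lemma closed_ball0_compact (M : R) : compact [set xi : 'rV[R]_N | `|xi| <= M].
Proof.
apply: bounded_closed_compact.
  by exists M; split; [exact: num_real|move=> s Ms x /= xM; exact: le_trans (ltW Ms)].
rewrite (_ : [set _ | _] = Num.norm @^-1` [set t : R | t <= M]); last by [].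
by apply: closed_comp => [x _|]; [exact: norm_continuous|exact: closed_le].
Qed.

Lemma continuous_bounded_gradu (phi : 'rV[R]_N -> R) : continuous phi ->
  exists M : R, forall x, Omega x -> `|phi (grad u x)| <= M.
Proof.
move=> cphi; have [M _ HM] := gradu_bounded hOmega hC1.
have [K _ HK] := compact_image_bounded (@closed_ball0_compact M) (continuous_subspaceT cphi).
by exists K => x Ox; apply: HK; exact: HM.
Qed.

Lemma gradu_continuous_rV x : Omega x -> {for x, continuous (grad u)}.
Proof.
move=> Ox A /nbhs_rVP[e e0 eA]; case: hC1 => _ _ cD DE.
have [r r0 Hr] := within_dist cD (subset_closure Ox) e0.
have nO : nbhs x Omega by apply: open_nbhs_nbhs; split => //; exact: Omega_open.
have nr : nbhs x [set y : 'rV[R]_N | `|y - x| < r] by apply/nbhs_rVP; exists r.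
apply: filterS2 nO nr => y Oy yr; apply: eA; rewrite -!DE// distrC.
by apply: Hr => //; exact: subset_closure.
Qed.

Lemma tame_gradu (phi : 'rV[R]_N -> R) : continuous phi -> tame (fun x => phi (grad u x)).
Proof.
move=> cphi; have [M HM] := continuous_bounded_gradu cphi.
apply: (tame_continuous hOmega (M := M)) => // x Ox.
by apply: continuous_comp; [exact: gradu_continuous_rV|exact: cphi].
Qed.

Lemma tame_u (h : R -> R) : continuous h -> tame (fun x => h (u x)).
Proof.
move=> ch; apply: tame_comp => //; have [M _ HM] := u_bounded hOmega hC1.
apply: (tame_continuous hOmega (M := M)) => // x Ox.
exact/differentiable_continuous/(u_differentiable hC1).
Qed.

Lemma coord_cont i : continuous (fun xi : 'rV[R]_N => xi 0 i).
Proof. exact: coord_continuous. Qed.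

Lemma tame_flux i : tame (fun x => fl x 0 i).
Proof. apply: (tame_gradu (phi := fun xi => flux p H xi 0 i)); exact: flux_continuous. Qed.

Lemma tame_Hp : tame (fun x => Hp (grad u x)).
Proof. apply: (tame_gradu (phi := fun xi => Hp xi)); exact: Hp_continuous. Qed.

Lemma flux_bounded : exists M : R, forall x, Omega x -> \sum_i `|fl x 0 i| <= M.
Proof.
have /choice[M HM] i : exists M : R, forall x, Omega x -> `|fl x 0 i| <= M.
  by apply: (continuous_bounded_gradu (phi := fun xi => flux p H xi 0 i)); exact: flux_continuous.
by exists (\sum_i M i) => x Ox; apply: ler_sum => i _; exact: HM.
Qed.

(** Passing to the limit along [lipschitz_approx] enlarges the class of test functions; [B] collects
    the points without a gradient. *)
Lemma weak_lipschitz (f : 'rV[R]_N -> R) (Df : 'rV[R]_N -> 'rV[R]_N)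
    (K B : set 'rV[R]_N) (L : R) : 0 <= L ->
  (forall x y, `|f x - f y| <= L * `|x - y|) ->
  compact K -> K `<=` Omega -> (forall x, f x != 0 -> K x) ->
  tame f -> (forall i, tame (fun x => Df x 0 i)) ->
  measurable (pre B) -> mu (pre B) = 0%E ->
  (forall x, Omega x -> ~ B x -> has_grad f x (Df x)) ->
  I (fun x => dot (fl x) (Df x)) = I (fun x => g (u x) * f x).
Proof.
move=> L0 fL cK KO fK tf tDf mB B0 fDf.
have [r r0 Hr] := Omega_bounded hOmega.
have HrO x : Omega x -> `|x| <= r by move=> Ox; apply: Hr; exact: subset_closure.
have [phi [C [phiC phiS phiV phiG phiL]]] := lipschitz_approx r L0 fL.
have [r1 r10 Hr1] := compact_margin cK (Omega_open hOmega) KO.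
(* The approximants live within two grid steps of [K], and taking the closure of the support costs
   one more; three steps have to fit into the margin [r1], whence the shift of the sequence by
   [n0]. *)
have r13 : 0 < r1 / 3 by rewrite divr_gt0.
have [n0 _ Hn0] := near_infty_natSinv_lt (PosNum r13).
pose psi n := phi (n + n0)%N.
have small n : (n + n0).+1%:R^-1 < r1 / 3 :> R by apply: Hn0; rewrite /= leq_addl.
have pos n : 0 < n.+1%:R^-1 :> R by rewrite invr_gt0.
have supp n : closure [set x | psi n x != 0] `<=` Omega.
  move=> x /closure_rVP/(_ _ (pos (n + n0)%N))[y /= /phiS[z /fK Kz zy] yx].
  apply: (Hr1 x z Kz); rewrite -(subrKA y) (le_trans (ler_normD _ _))//.
  rewrite distrC in yx; rewrite distrC in zy.
  move: (small n) yx zy; move: ((n + n0).+1%:R^-1) => k; lra.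
have test n : test_function Omega (psi n).
  split; [exact: phiC| |exact: supp].
  apply: bounded_closed_compact; last exact: closed_closure.
  exists r; split; first exact: num_real.
  by move=> s rs x /supp Ox; exact: le_trans (HrO x Ox) (ltW rs).
have E n := (hweak).2 _ (test n).
have psidiff n x : differentiable (psi n) x by have [d _] := phiC (n + n0)%N 1%N; exact: d.
have psicont n i : continuous (partial i (psi n)).
  by move=> x; have [_ /(_ i) c] := phiC (n + n0)%N 1%N; exact: c.
have tpsi n : tame (psi n).
  have [M HM] : exists M : R, forall x, Omega x -> `|f x| <= M by case: tf.
  apply: (tame_continuous hOmega (M := M + C * (n + n0).+1%:R^-1)).
    by move=> x _; exact/differentiable_continuous.
  move=> x Ox; rewrite -(subrK (f x) (psi n x)) addrC (le_trans (ler_normD _ _))//.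
  by apply: lerD; [exact: HM|apply: phiV; exact: HrO].
have tgpsi n i : tame (fun x => grad (psi n) x 0 i).
  apply: (tame_continuous hOmega (M := C)).
    move=> x _; have -> : (fun x => grad (psi n) x 0 i) = partial i (psi n).
      by apply/funext => z; rewrite mxE.
    exact: psicont.
  by move=> x Ox; rewrite mxE; apply: phiG; exact: HrO.
have [Fb HFb] := flux_bounded.
have C0 : 0 <= C.
  have := phiV 0 0; rewrite normr0 => /(_ (ltW r0)).
  by rewrite invr1 mulr1; apply: le_trans.
have lim1 : (fun n => I (fun x => dot (fl x) (grad (psi n) x))) @ \oo --> I (fun x => dot (fl x) (Df x)).
  apply: (integral_dominated_rV hOmega (B := B) (M := Fb * C)) => //.
  - by move=> n; apply: tame_dot => //; exact: tame_flux.
  - by apply: tame_dot => //; exact: tame_flux.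
  - move=> n x Ox; rewrite (le_trans (norm_dot_le _ _))//.
    apply: ler_pM => //; [by rewrite sumr_ge0|exact: HFb|].
    apply/normrV_le => // i; rewrite mxE; apply: phiG; exact: HrO.
  - move=> x Ox nB; apply: cvg_dot => i; first exact: cvg_cst.
    under eq_fun do rewrite mxE.
    have := phiL x (Df x) (HrO x Ox) (fDf x Ox nB) i.
    by rewrite -(cvg_shiftn n0).
have lim2 : (fun n => I (fun x => g (u x) * psi n x)) @ \oo --> I (fun x => g (u x) * f x).
  have tgu := tame_u cg.
  have [Mg HMg] := tgu.2; have [Mf HMf] := tf.2.
  apply: (integral_dominated_rV hOmega (B := set0) (M := `|Mg| * (`|Mf| + C))) => //.
  - by move=> n; exact: tameM.
  - exact: tameM.
  - move=> n x Ox; rewrite normrM ler_pM//.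
      by rewrite (le_trans (HMg x Ox))// ler_norm.
    rewrite -(subrK (f x) (psi n x)) addrC (le_trans (ler_normD _ _))//.
    apply: lerD; first by rewrite (le_trans (HMf x Ox))// ler_norm.
    apply: (le_trans (phiV _ x (HrO x Ox))).
    by rewrite ler_piMr// invf_le1// ler1n.
  - by rewrite /pre preimage_set0.
  - by rewrite /pre preimage_set0 measure0.
  - move=> x Ox _; apply: cvgMr.
    suff : (fun n => phi n x) @ \oo --> f x by rewrite -(cvg_shiftn n0).
    apply/cvgrPdist_le => e e0; have Ce : 0 < e / (C + 1) by rewrite divr_gt0// ltr_wpDl.
    have Hn := near_infty_natSinv_lt (PosNum Ce).
    near=> n; rewrite distrC (le_trans (phiV n x (HrO x Ox)))//.
    have : n.+1%:R^-1 < e / (C + 1) by near: n; exact: Hn.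
    rewrite ltr_pdivlMr ?ltr_wpDl// => h.
    by move: h (pos n); move: (n.+1%:R^-1) => k h k0; nra.
have lim2' : (fun n => I (fun x => dot (fl x) (grad (psi n) x))) @ \oo --> I (fun x => g (u x) * f x).
  by under eq_fun do rewrite E.
exact: cvg_unique lim1 lim2'.
Unshelve. all: by end_near. Qed.

Lemma Dub_zero x : ~ Omega x -> forall i, Dub x 0 i = 0.
Proof. by move=> nO i; rewrite Dubar_out// mxE. Qed.

Lemma tame_Dub i : tame (fun x => Dub x 0 i).
Proof.
have := tame_gradu (@coord_cont i); apply: tame_ext => x Ox.
by rewrite Dubar_in.
Qed.

Lemma tame_ub : tame ub.
Proof.
have := tame_u (h := fun t => t) (fun t => cvg_id); apply: tame_ext => x Ox.
by rewrite ubar_in.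
Qed.

Lemma tame_ub_dil (c : R) : 1 < c -> tame (fun x => ub (c *: x)).
Proof.
move=> c1; apply: (tame_dilation hOmega c1 (f := ub)); last exact: tame_ub.
by move=> x; exact: ubar_out.
Qed.

Lemma tame_Dub_dil (c : R) i : 1 < c -> tame (fun x => (c *: Dub (c *: x)) 0 i).
Proof.
move=> c1; apply: (tame_ext (f := fun x => c * Dub (c *: x) 0 i)).
  by move=> x _; rewrite !mxE.
apply: tameZ; apply: (tame_dilation hOmega c1 (f := fun x => Dub x 0 i)); last exact: tame_Dub.
by move=> x nO; exact: Dub_zero.
Qed.

Lemma weak_dilation (c : R) : 1 < c ->
  I (fun x => dot (fl x) (c *: Dub (c *: x))) = I (fun x => g (u x) * ub (c *: x)).
Proof.
move=> c1; have c0 : 0 < c by exact: lt_trans c1.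
have [L L0 HL] := ubar_lipschitz hOmega hC1 hu0.
have clc : [set x | closure Omega (c *: x)] `<=` Omega.
  by move=> x; exact: dilate_closure.
have [r r0 Hr] := Omega_bounded hOmega.
apply: (@weak_lipschitz _ _ [set x | closure Omega (c *: x)] [set x | bdry Omega (c *: x)] (L * c)).
- by rewrite mulr_ge0// ltW.
- move=> x y; rewrite (le_trans (HL _ _))// -scalerBr normrZ gtr0_norm//.
  by rewrite mulrA.
- apply: bounded_closed_compact.
    exists r; split; first exact: num_real.
    move=> s rs x /clc Ox; apply: le_trans (ltW rs).
    by apply: Hr; exact: subset_closure.
  apply: closed_comp => [x _|]; last exact: closed_closure.
  have C : {for x, continuous (fun y : 'rV[R]_N => c *: y)} by exact: scaler_continuous.
  exact: C.
- exact: clc.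
- move=> x fx; apply: subset_closure; apply: contrapT => nO.
  by move/eqP: fx; rewrite ubar_out.
- exact: tame_ub_dil.
- by move=> i; exact: tame_Dub_dil.
- rewrite (_ : pre _ = dil c @^-1` pre (bdry Omega)); last first.
    by apply/seteqP; split => t; rewrite /pre/= rV_of_dil.
  rewrite -[X in measurable X]setTI; apply: (@measurable_dil R N c) => //.
  exact: measurable_bdry.
- rewrite measure_dilation ?bdry_null ?mule0//; exact: measurable_bdry.
- by move=> x _ nb; apply: has_grad_dilation => //; apply: (ubar_has_grad hOmega hC1).
Qed.

Definition stretch (n : nat) : R := 1 + n.+1%:R^-1.

Lemma stretch_gt1 n : 1 < stretch n.
Proof. by rewrite ltrDl invr_gt0. Qed.

Lemma stretch_le2 n : stretch n <= 2.
Proof. by rewrite /stretch (_ : 2 = 1 + 1)// lerD2l invf_le1// ler1n. Qed.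

Lemma cvg_stretch x : (fun n => stretch n *: x) @ \oo --> x.
Proof. by rewrite -[X in _ --> X]scale1r; apply: cvgZl; exact: cvg_dilation_ratio. Qed.

Lemma stretch_near_Omega x : Omega x -> \forall n \near \oo, Omega (stretch n *: x).
Proof.
move=> Ox; have nO : nbhs x Omega by apply: open_nbhs_nbhs; split => //; exact: Omega_open.
by have := @cvg_stretch x Omega nO.
Qed.

Lemma ub_bounded : exists M : R, forall x, `|ub x| <= M.
Proof.
have [M M0 HM] := u_bounded hOmega hC1; exists M => x.
have [Ox|nO] := pselect (Omega x); first by rewrite ubar_in// HM.
by rewrite ubar_out// normr0 ltW.
Qed.

(** Formally this is testing with [u], whose support may reach the boundary; instead [c -> 1] in
    [weak_dilation]. For fixed [x] in [Omega] the dilated point is eventually in [Omega], where [u]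
    is of class [C^1]. *)
Lemma energy_identity : I (fun x => Hp (grad u x)) = I (fun x => g (u x) * u x).
Proof.
have [Fb HFb] := flux_bounded.
have [M M0 HM] := gradu_bounded hOmega hC1.
have HMD x : `|Dub x| <= M.
  have [Ox|nO] := pselect (Omega x); first by rewrite Dubar_in// HM.
  by rewrite Dubar_out// normr0 ltW.
have lim1 : (fun n => I (fun x => dot (fl x) (stretch n *: Dub (stretch n *: x)))) @ \oo -->
    I (fun x => Hp (grad u x)).
  apply: (integral_dominated_rV hOmega (B := set0) (M := Fb * (2 * M))).
  - move=> n; apply: tame_dot => i; first exact: tame_flux.
    by apply: tame_Dub_dil; exact: stretch_gt1.
  - exact: tame_Hp.
  - move=> n x Ox; rewrite (le_trans (norm_dot_le _ _))//.
    apply: ler_pM => //; [by rewrite sumr_ge0|exact: HFb|].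
    rewrite normrZ ger0_norm; last by rewrite ltW// (lt_trans _ (stretch_gt1 n)).
    by apply: ler_pM => //; [rewrite ltW// (lt_trans _ (stretch_gt1 n))|exact: stretch_le2].
  - by rewrite /pre preimage_set0.
  - by rewrite /pre preimage_set0 measure0.
  - move=> x Ox _; rewrite -(flux_self hN hH hp).
    apply: cvg_dot => i; first exact: cvg_cst.
    under eq_fun do rewrite mxE.
    have C : (fun n => Dub (stretch n *: x) 0 i) @ \oo --> grad u x 0 i.
      have C := cvg_comp _ _ (@cvg_stretch x) (gradu_continuous hC1 (i := i) Ox).
      apply: cvg_trans C; apply: near_eq_cvg.
      by have := stretch_near_Omega Ox; apply: filterS => n On; rewrite /= Dubar_in.
    have C2 := cvgM (@cvg_dilation_ratio R) C; rewrite mul1r in C2; exact: C2.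
have lim2 : (fun n => I (fun x => g (u x) * ub (stretch n *: x))) @ \oo --> I (fun x => g (u x) * u x).
  have tgu := tame_u cg; have [Mg HMg] := tgu.2; have [Mu HMu] := ub_bounded.
  apply: (integral_dominated_rV hOmega (B := set0) (M := Mg * Mu)).
  - by move=> n; apply: tameM => //; apply: tame_ub_dil; exact: stretch_gt1.
  - by apply: tameM => //; exact: (tame_u (h := fun t => t) (fun t => cvg_id)).
  - by move=> n x Ox; rewrite normrM ler_pM// HMg.
  - by rewrite /pre preimage_set0.
  - by rewrite /pre preimage_set0 measure0.
  - move=> x Ox _; apply: cvgMr; rewrite -(ubar_in u Ox).
    exact: cvg_comp _ _ (@cvg_stretch x) (ubar_continuous hOmega hC1 hu0 (x := x)).
have lim1' : (fun n => I (fun x => g (u x) * ub (stretch n *: x))) @ \oo --> I (fun x => Hp (grad u x)).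
  by apply: cvg_trans lim1; apply: near_eq_cvg; apply: nearW => n; rewrite weak_dilation// stretch_gt1.
exact: cvg_unique lim1' lim2.
Qed.

Lemma boundary_energy x0 : bdry Omega x0 -> Du x0 != 0 ->
  exists c r : R, [/\ 0 < c, 0 < r &
    forall x, Omega x -> `|x - x0| < r -> c <= Hp (grad u x)].
Proof.
move=> [cx0 _] D0; case: hC1 => _ _ cD DE.
have P0 : 0 < Hp (Du x0) by rewrite powR_gt0// (H_gt0 hH).
have P2 : 0 < Hp (Du x0) / 2 by rewrite divr_gt0.
have C : {for Du x0, continuous (fun xi : 'rV[R]_N => Hp xi)} by exact: (Hp_continuous hN hH hp).
have /nbhs_rVP[e e0 He] := continuous_at_distP C P2.
have [r r0 Hr] := within_dist cD cx0 e0.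
exists (Hp (Du x0) / 2), r; split => // x Ox xr.
have /= := He (Du x); rewrite distrC => /(_ (Hr x (subset_closure Ox) xr)).
by rewrite (DE x Ox) => /(le_lt_trans (ler_norm _)); lra.
Qed.

Lemma tame_indic (A : set 'rV[R]_N) : open A -> tame (\1_A : 'rV[R]_N -> R).
Proof.
move=> oA; split; last first.
  by exists 1 => x _; rewrite indicE; case: (x \in A); rewrite ?normr1 ?normr0.
apply: (measurable_indic (D := pre Omega)); exact: open_measurable_rV.
Qed.

Lemma integral_indic_gt0 (A : set 'rV[R]_N) : open A -> Omega `&` A !=set0 ->
  0 < I (\1_A : 'rV[R]_N -> R).
Proof.
move=> oA A0; have mA : measurable (pre A) by exact: open_measurable_rV.
have mO := measurable_Omega hOmega.
rewrite /integral_rV /Rintegral (eq_integral (fun t => (\1_(pre A) t)%:E)); last by [].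
rewrite integral_indic//; apply: fine_gt0; apply/andP; split.
  rewrite setIC; apply: (open_measure_gt0 (U := Omega `&` A)) => //.
  by apply: openI => //; exact: Omega_open.
apply: le_lt_trans (Omega_finite hOmega); apply: le_measure; rewrite ?inE//.
exact: measurableI.
Qed.

Lemma Hp_hom (c : R) (xi : 'rV[R]_N) : 0 < c -> Hp (c *: xi) = c `^ p * Hp xi.
Proof.
move=> c0; rewrite (H_hom hN hH) gtr0_norm// powRM//; first exact: ltW.
exact: (H_ge0 hN hH).
Qed.

Lemma tame_Hp_Dub : tame (fun x => Hp (Dub x)).
Proof.
by have := tame_Hp; apply: tame_ext => x Ox; rewrite Dubar_in.
Qed.

Lemma Hp_Dub_out x : ~ Omega x -> Hp (Dub x) = 0.
Proof. by move=> nO; rewrite Dubar_out// (H0 hN hH) powR0// gt_eqF. Qed.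

(* [V] comes from the part of the cone which the dilation pushes out of [Omega]:
   there the dilated function vanishes and the energy density is at least [k]. *)
Lemma dilation_gain x0 : bdry Omega x0 -> Du x0 != 0 ->
  exists V c0 : R, [/\ 0 < V, 1 < c0 & forall c : R, 1 < c -> c < c0 ->
    I (fun x => g (u x) * ub (c *: x)) <=
    (1 - p^-1) * I (fun x => Hp (grad u x)) +
    p^-1 * c `^ p * (c ^- N * I (fun x => Hp (grad u x))) - V * (1 - c ^- N)].
Proof.
move=> bx0 D0; have [k [r [k0 r0 Hr]]] := boundary_energy bx0 D0.
have [C [c0 [oC OC coneC c01 HC]]] := boundary_cone hOmega hstar bx0 r0.
pose A := Omega `&` C; have oA : open A by apply: openI => //; exact: Omega_open.
pose psi : 'rV[R]_N -> R := \1_A.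
have tpsi : tame psi by exact: tame_indic.
have psi_out x : ~ Omega x -> psi x = 0.
  by move=> nO; rewrite /psi indicE memNset// => -[].
have ip : 0 < I psi by apply: integral_indic_gt0 => //; rewrite /A setIA setIid.
have q0 : 0 < 1 - p^-1 by rewrite subr_gt0 invf_lt1.
(* The coefficient [1 - p^-1] is the one that [flux_young] puts on [H xi ^ p]. *)
exists ((1 - p^-1) * k * I psi), c0; split => //; first by rewrite !mulr_gt0.
move=> c c1 cc0; have cp : 0 < c by exact: lt_trans c1.
rewrite -(weak_dilation c1).
have -> : I (fun x => Hp (grad u x)) = I (fun x => Hp (Dub x)).
  by apply: integral_ext => x Ox; rewrite Dubar_in.
have tH := tame_Hp_Dub.
have tHc := tame_dilation hOmega (f := fun x => Hp (Dub x)) c1 Hp_Dub_out tH.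
have tpc := tame_dilation hOmega c1 psi_out tpsi.
rewrite -(integral_dilation_Omega hOmega hstar (f := fun x => Hp (Dub x)))//; last exact: Hp_Dub_out.
(* The gain is rewritten as an integral over [Omega], so that the whole estimate becomes a pointwise
   inequality. *)
have -> : (1 - p^-1) * k * I psi * (1 - c ^- N) =
    I (fun x => (1 - p^-1) * k * (psi x - psi (c *: x))).
  rewrite (integralZ_rV hOmega); last exact: tameB.
  by rewrite (integralB_rV hOmega)// (integral_dilation_Omega hOmega hstar)//; ring.
rewrite -!(integralZ_rV hOmega)// -(integralD_rV hOmega); [|exact: tameZ|exact: tameZ].
rewrite -(integralB_rV hOmega); last 2 first.
- by apply: tameD; exact: tameZ.
- by apply: tameZ; exact: tameB.
apply: (le_integral_rV hOmega).
- apply: tame_dot => i; first exact: (tame_flux).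
  exact: (tame_Dub_dil).
- by apply: tameB; [apply: tameD; exact: tameZ|apply: tameZ; exact: tameB].
move=> x Ox; rewrite (Dubar_in u Ox).
(* If [c *: x] stays in [Omega], the cone is invariant, the indicators cancel and [flux_young]
   suffices. Otherwise the left side is 0, and in the cone [x] is within [r] of [x0], where the
   energy density is at least [k]. *)
have [Ocx|nO] := pselect (Omega (c *: x)).
  have -> : psi (c *: x) = psi x.
    rewrite /psi !indicE; congr (nat_of_bool _)%:R; apply/idP/idP; rewrite !inE => -[_ Cx]; split => //.
      by rewrite -(scale1r x) -(mulVf (lt0r_neq0 cp)) -scalerA; apply: coneC => //; rewrite invr_gt0.
    exact: coneC.
  rewrite subrr mulr0 subr0 -mulrA -Hp_hom//.
  exact: (flux_young hN hH hp).
rewrite (Hp_Dub_out nO) Dubar_out// scaler0 dotr0 (psi_out _ nO) subr0 mulr0 addr0.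
rewrite -mulrA -mulrBr; apply: mulr_ge0; first exact: ltW.
rewrite subr_ge0.
rewrite /psi indicE; have [|] := boolP (x \in A); last first.
  by move=> _; rewrite mulr0 powR_ge0.
rewrite inE => -[_ Cx]; rewrite mulr1; apply: Hr => //; exact: (HC x c).
Qed.

(** The dilated function differs from [u] by at most [L * |x| / (n+1)], so [n+1] times the Taylor
    remainder of [G] is at most [L * r] times the oscillation of [g] between the two values, which
    tends to 0. *)
Lemma primitive_defect_cvg :
  (fun n => I (fun x => n.+1%:R * (G (ub (stretch n *: x)) - G (u x)
    - g (u x) * (ub (stretch n *: x) - u x)))) @ \oo --> (0 : R).
Proof.
have [L L0 HL] := ubar_lipschitz hOmega hC1 hu0.
have [r r0 Hr] := Omega_bounded hOmega.
have [M HM] := ub_bounded.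
(* Intermediate arguments lie within [2 * M] of [u x], itself bounded by [M]. *)
have [K HK] := continuous_norm_bounded (3 * M) cg.
have tG : tame (fun x => G (u x)) := tame_u (primitive0_continuous cg).
have tu : tame u := tame_u (h := fun t => t) (fun t => cvg_id).
have diff n x : `|ub (stretch n *: x) - ub x| <= L * `|x| * n.+1%:R^-1.
  apply: le_trans (HL _ _) _; rewrite -[X in _ - X]scale1r -scalerBl normrZ.
  by rewrite /stretch addrC addKr ger0_norm ?invr_ge0// -mulrA (mulrC `|x|).
have step n x (E : R) : 0 <= E -> Omega x ->
    (forall s, `|s - u x| <= `|ub (stretch n *: x) - u x| -> `|g s - g (u x)| <= E) ->
    `|n.+1%:R * (G (ub (stretch n *: x)) - G (u x)
      - g (u x) * (ub (stretch n *: x) - u x))| <= E * (L * r).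
  move=> E0 Ox HE; rewrite normrM ger0_norm//.
  have T := primitive0_taylor cg HE; have D := diff n x; rewrite (ubar_in u Ox) in D.
  apply: le_trans (ler_wpM2l _ T) _ => //.
  rewrite mulrCA ler_wpM2l// mulrC -ler_pdivlMr//; apply: le_trans D _.
  rewrite ler_wpM2r ?invr_ge0// ler_wpM2l//; apply: Hr; exact: subset_closure.
have -> : (0 : R) = I (fun=> 0).
  by rewrite -[LHS](mul0r (I u)) -(integralZ_rV hOmega)//; apply: integral_ext => x _; rewrite mul0r.
apply: (integral_dominated_rV hOmega (B := set0) (M := (2 * `|K|) * (L * r))).
- move=> n; have tc := tame_ub_dil (stretch_gt1 n).
  apply: tameZ; apply: tameB; first by apply: tameB => //; apply: tame_comp tc; exact: primitive0_continuous.
  by apply: tameM; [exact: tame_u|exact: tameB].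
- exact: tame_cst.
- move=> n x Ox; apply: step => // s; have Mx := HM x; have Mrx := HM (stretch n *: x).
  rewrite (ubar_in u Ox) in Mx => sb.
  have B1 : `|g s| <= `|K|.
    apply: le_trans (ler_norm _); apply: HK; rewrite -(subrK (u x) s).
    apply: le_trans (ler_normD _ _) _.
    have := ler_normB (ub (stretch n *: x)) (u x); lra.
  have B2 : `|g (u x)| <= `|K|.
    by apply: le_trans (ler_norm _); apply: HK; have := normr_ge0 (u x); lra.
  have := ler_normB (g s) (g (u x)); lra.
- by rewrite /pre preimage_set0.
- by rewrite /pre preimage_set0 measure0.
- move=> x Ox _; apply/cvgr0Pnorm_le => e e0.
  have Lr : 0 < L * r + 1 by rewrite ltr_wpDl// mulr_ge0// ltW.
  have e1 : 0 < e / (L * r + 1) by rewrite divr_gt0.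
  have [d /= d0 Hd] := continuous_at_distP (@cg (u x)) e1.
  have Lx : 0 < L * `|x| + 1 by rewrite ltr_wpDl// mulr_ge0.
  have dL : 0 < d / (L * `|x| + 1) by rewrite divr_gt0.
  have Hn := near_infty_natSinv_lt (PosNum dL).
  near=> n; have nd : n.+1%:R^-1 < d / (L * `|x| + 1) by near: n; exact: Hn.
  apply: (le_trans (step n x (e / (L * r + 1)) (ltW e1) Ox _)); last first.
    by rewrite mulrAC ler_pdivrMr//; apply: ler_wpM2l; [exact: ltW|lra].
  move=> s sb; rewrite distrC ltW//; apply: Hd; rewrite /= distrC.
  apply: le_lt_trans sb _; rewrite -(ubar_in u Ox); apply: le_lt_trans (diff n x) _.
  rewrite ltr_pdivlMr// in nd; apply: le_lt_trans nd; rewrite mulrC ler_wpM2l ?invr_ge0//; lra.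
Unshelve. all: by end_near. Qed.

Lemma pohozaev_inequality : (exists2 x, bdry Omega x & Du x != 0) ->
  0 < N%:R * I (fun x => G (u x)) - (N%:R - p) / p * I (fun x => g (u x) * u x).
Proof.
move=> [x0 bx0 D0]; have [V [c0 [V0 c01 gain]]] := dilation_gain bx0 D0.
rewrite (energy_identity) in gain.
set a := I (fun x => g (u x) * u x) in gain *; set B := I (fun x => G (u x)).
have tu : tame u := tame_u (h := fun t => t) (fun t => cvg_id).
have tgu : tame (fun x => g (u x)) := tame_u cg.
have tub := tame_ub.
have tG : tame (fun x => G (u x)) := tame_u (primitive0_continuous cg).
have Gout x : ~ Omega x -> G (ub x) = 0 by move=> nO; rewrite ubar_out// primitive0_0.
have tGb : tame (fun x => G (ub x)) by apply: tame_comp tub; exact: primitive0_continuous.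
have BE : B = I (fun x => G (ub x)) by apply: integral_ext => x Ox; rewrite ubar_in.
have GB (c : R) (c1 : 1 < c) : I (fun x => G (ub (c *: x))) = c ^- N * B.
  by rewrite BE; exact: (integral_dilation_Omega hOmega hstar c1 Gout tGb).
have E n : I (fun x => n.+1%:R * (G (ub (stretch n *: x)) - G (u x)
    - g (u x) * (ub (stretch n *: x) - u x))) =
  n.+1%:R * (stretch n ^- N * B - B - (I (fun x => g (u x) * ub (stretch n *: x)) - a)).
  have tc := tame_ub_dil (stretch_gt1 n).
  have tGc : tame (fun x => G (ub (stretch n *: x))).
    by apply: tame_comp tc; exact: primitive0_continuous.
  have t1 := tameM tgu tc; have t2 := tameM tgu tu.
  have -> : I (fun x => n.+1%:R * (G (ub (stretch n *: x)) - G (u x)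
      - g (u x) * (ub (stretch n *: x) - u x))) =
    I (fun x => n.+1%:R * ((G (ub (stretch n *: x)) - G (u x))
      - (g (u x) * ub (stretch n *: x) - g (u x) * u x))).
    by apply: integral_ext => x _; rewrite (mulrBr (g (u x))).
  rewrite (integralZ_rV hOmega); last by apply: tameB; exact: tameB.
  rewrite (integralB_rV hOmega); [|exact: tameB|exact: tameB].
  by rewrite (integralB_rV hOmega tGc tG) (integralB_rV hOmega t1 t2) (GB _ (stretch_gt1 n)).
have := primitive_defect_cvg; under eq_fun do rewrite E; move=> lim0.
have X := @cvg_powR_diff R (p - N%:R); have Y := @cvg_powR_diff R (- N%:R).
(* Inserting [gain] into the defect bounds it below by this sequence. The defect tends to 0, so the
   limit here is at most 0, which is the claim with the margin [N * V]. *)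
have lim1 : (fun n => - (p^-1 * a) * (n.+1%:R * (stretch n `^ (p - N%:R) - 1))
   + (B - V) * (n.+1%:R * (stretch n `^ (- N%:R) - 1))) @ \oo -->
   - (p^-1 * a) * (p - N%:R) + (B - V) * - N%:R.
  by apply: cvgD; apply: cvgMr.
have N0 : 0 < N%:R :> R by rewrite ltr0n.
suff : - (p^-1 * a) * (p - N%:R) + (B - V) * - N%:R <= 0.
  move=> le0; have : N%:R * V <= N%:R * B - (N%:R - p) / p * a.
    by rewrite -subr_ge0 (_ : _ - _ = - (- (p^-1 * a) * (p - N%:R) + (B - V) * - N%:R));
      [rewrite oppr_ge0|ring].
  by apply: lt_le_trans; rewrite mulr_gt0.
apply: (ler_cvg_to lim1 lim0).
have := @cvg_dilation_ratio R => /cvgr_lt/(_ c0 c01); apply: filterS => n nc0.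
have r1 := stretch_gt1 n; have r0 : 0 < stretch n :> R by exact: lt_trans r1.
have := gain _ r1 nc0; rewrite -/(stretch n).
rewrite powRD; last by apply/implyP => _; rewrite gt_eqF.
rewrite (powR_invn N (ltW r0)).
move: (stretch n `^ p) (stretch n ^- N) (I _) => A D J gainJ.
(* The defect minus its lower bound is exactly [n+1] times the slack in [gain]. *)
rewrite -subr_ge0 (_ : _ - _ = n.+1%:R *
  ((1 - p^-1) * a + p^-1 * A * (D * a) - V * (1 - D) - J)); last by ring.
apply: mulr_ge0; first exact: ler0n.
by rewrite subr_ge0.
Qed.

End pohozaev.

Unset Implicit Arguments.

Theorem corollary2p5 (R : realType) (N : nat) (hN : (0 < N)%N)
    (p : R) (hp : 1 < p) (H : 'rV[R]_N -> R) (hH : hypH H)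
    (Omega : set 'rV[R]_N) (hOmega : bounded_smooth_domain Omega)
    (hstar : strictly_star_shaped Omega) :
  (forall g : R -> R, C1_real g ->
   forall (u : 'rV[R]_N -> R) (Du : 'rV[R]_N -> 'rV[R]_N),
     dirichlet_solution p H g Omega u Du ->
     (exists2 x, bdry Omega x & Du x != 0) ->
     N%:R * integral_rV Omega (fun x => primitive0 g (u x))
     - (N%:R - p) / p * integral_rV Omega (fun x => g (u x) * u x) > 0)
  /\
  (p < N%:R -> forall m : R, 0 < m ->
   let g := power_nonlinearity m in
   forall (u : 'rV[R]_N -> R) (Du : 'rV[R]_N -> 'rV[R]_N),
     dirichlet_solution p H g Omega u Du ->
     (exists2 x, bdry Omega x & Du x != 0) ->
     [/\ N%:R * integral_rV Omega (fun x => primitive0 g (u x))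
         - (N%:R - p) / p * integral_rV Omega (fun x => g (u x) * u x) > 0,
         (N%:R / (m + 1) - (N%:R - p) / p)
         * integral_rV Omega (fun x => `|u x| `^ (m + 1)) > 0
       & (exists2 x, Omega x & u x != 0) ->
         m < (N%:R * (p - 1) + p) / (N%:R - p)
         /\ (N%:R * (p - 1) + p) / (N%:R - p) = pstar N p - 1]).
Proof.
split=> [g [dg _] u Du [hC1 hweak hu0] hD|pN m m0 g u Du [hC1 hweak hu0] hD].
  apply: (pohozaev_inequality hN hp hH hOmega hstar _ hC1 hweak hu0 hD) => t.
  exact/differentiable_continuous/derivable1_diffP.
have cg : continuous g by exact: power_nonlinearity_continuous.
have P := pohozaev_inequality hN hp hH hOmega hstar cg hC1 hweak hu0 hD.
have m1 : 0 < m + 1 by rewrite ltr_wpDl// ltW.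
have p0 : 0 < p by exact: lt_trans hp.
have tu := tame_u hOmega hC1 (h := fun t => t) (fun t => cvg_id).
have tum : tame Omega (fun x => `|u x| `^ (m + 1)).
  apply: (tame_u hOmega hC1 (h := fun t => `|t| `^ (m + 1))).
  by move=> t; apply: powR_continuous => //; exact: norm_continuous.
have Q : 0 < (N%:R / (m + 1) - (N%:R - p) / p) * integral_rV Omega (fun x => `|u x| `^ (m + 1)).
  have E1 : integral_rV Omega (fun x => primitive0 g (u x)) =
      (m + 1)^-1 * integral_rV Omega (fun x => `|u x| `^ (m + 1)).
    rewrite -(integralZ_rV hOmega)//; apply: integral_ext => x _.
    by rewrite primitive0_power// mulrC.
  have E2 : integral_rV Omega (fun x => g (u x) * u x) =
      integral_rV Omega (fun x => `|u x| `^ (m + 1)).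
    by apply: integral_ext => x _; exact: power_nonlinearityE.
  by move: P; rewrite E1 E2 mulrA -mulrBl.
split=> // _; have Np : 0 < N%:R - p by rewrite subr_gt0.
split; last by rewrite /pstar; field; rewrite gt_eqF.
have J0 : 0 <= integral_rV Omega (fun x => `|u x| `^ (m + 1)).
  by apply: Rintegral_ge0 => t _; exact: powR_ge0.
(* A positive product with a nonnegative integral forces the other factor to be positive; clearing
   denominators then bounds [m]. *)
have F0 : 0 < N%:R / (m + 1) - (N%:R - p) / p.
  by rewrite ltNge; apply/negP => F0; have := mulr_le0_ge0 F0 J0; lra.
move: F0; rewrite subr_gt0 ltr_pdivrMr// mulrAC ltr_pdivlMr// ltr_pdivlMr//; lra.
Qed.
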